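(* Let $N\in\mathbb{N}$ and assume that $$E_{\mathbb{Q}}\big[|P_T-1|^{n-k}\,|I_T-E_{\mathbb{Q}}[I_T]|^k\big]<\infty\quad\text{for all } n=1,\dots,N+1,\ k=0,\dots,n.$$ Then $\Pi_{\mathrm{Put}}(S_0,K,T)=\Pi_N+R_N$, where $$\Pi_N=\mathrm{BS}_{\mathrm{Put}}(S_0,E_{\mathbb{Q}}[I_T])+\sum_{n=2}^N\frac{1}{n!}\sum_{k=0}^n\binom{n}{k}S_0^{n-k}\,E_{\mathbb{Q}}\big[(P_T-1)^{n-k}(I_T-E_{\mathbb{Q}}[I_T])^k\big]\,\frac{\partial^n\mathrm{BS}_{\mathrm{Put}}}{\partial x^{n-k}\partial y^k}(S_0,E_{\mathbb{Q}}[I_T])$$ (the sum being empty if $N=1$) and $$R_N=\frac{1}{N!}\sum_{n=0}^{N+1}\binom{N+1}{n}S_0^{N+1-n}E_{\mathbb{Q}}\Big[(P_T-1)^{N+1-n}(I_T-E_{\mathbb{Q}}[I_T])^n\int_0^1(1-u)^N\frac{\partial^{N+1}\mathrm{BS}_{\mathrm{Put}}}{\partial x^{N+1-n}\partial y^n}\big((1-u)S_0+uP_TS_0,\,(1-u)E_{\mathbb{Q}}[I_T]+uI_T\big)\,du\Big].$$ All derivatives appearing are evaluated at points with both coordinates positive (almost surely for those inside $R_N$), and all expectations are finite.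
   Context: Barndorff-Nielsen–Shephard model. Fix $T>0$, $r\in\mathbb{R}$, $\lambda>0$, $\sigma_0^2>0$, $S_0>0$, strike $K>0$, $\rho\in\mathbb{R}$. On a probability space with measure $\mathbb{Q}$ let $W$ be a standard Brownian motion and $Z$ an independent Lévy subordinator (nondecreasing Lévy process, $Z_0=0$). Let $\kappa(\theta)=\ln E_{\mathbb{Q}}[e^{\theta Z_1}]\in(-\infty,\infty]$ and $\hat\kappa=\sup\{\theta:\kappa(\theta)<\infty\}$; assume $\hat\kappa>0$ and $\rho<\hat\kappa$. Set $\alpha_{s,t}=\frac1\lambda(1-e^{-\lambda(t-s)})$, variance $\sigma_t^2=e^{-\lambda t}(\sigma_0^2+\int_0^te^{\lambda s}dZ_{\lambda s})$ (pathwise Stieltjes integrals), integrated variance $I_t=\int_0^t\sigma_s^2ds=\sigma_0^2\alpha_{0,t}+\int_0^t\alpha_{s,t}\,dZ_{\lambda s}$, $P_t=e^{\rho Z_{\lambda t}-\lambda t\kappa(\rho)}$, and stock price $S_t=S_0P_t\exp(rt-\tfrac12I_t+\int_0^t\sigma_sdW_s)$. The put price is $\Pi_{\mathrm{Put}}(S_0,K,T)=E_{\mathbb{Q}}[e^{-rT}(K-S_T)^+]$. For $x,y>0$, $\mathrm{BS}_{\mathrm{Put}}(x,y)=Ke^{-rT}\Phi(-d_-(x,y))-x\Phi(-d_+(x,y))$ with $d_\pm(x,y)=\frac{1}{\sqrt y}(\ln\frac xK+rT\pm\frac12 y)$ and $\Phi$ the standard normal cdf. *)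

(* Defs.v *)
From HB Require Import structures.
From mathcomp Require Import all_boot all_order all_algebra.
From mathcomp Require Import all_classical all_reals all_analysis.

Set Implicit Arguments.
Unset Strict Implicit.
Unset Printing Implicit Defensive.

Import Order.TTheory GRing.Theory Num.Theory.
Import numFieldNormedType.Exports.

Local Open Scope classical_set_scope.
Local Open Scope ring_scope.

Definition Phi {R : realType} (z : R) : R :=
  fine (\int[@lebesgue_measure R]_(u in `]-oo, z]) (normal_pdf 0 1 u)%:E)%E.

Definition BS_d {R : realType} (K T r : R) (sgn : R) (x y : R) : R :=
  (ln (x / K) + r * T + sgn * (y / 2)) / Num.sqrt y.

Definition BS_put {R : realType} (K T r : R) (x y : R) : R :=
  K * expR (- (r * T)) * Phi (- BS_d K T r (-1) x y)
  - x * Phi (- BS_d K T r 1 x y).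

Definition BS_put_partial {R : realType} (K T r : R) (j k : nat) (x y : R) : R :=
  derive1n j (fun x' : R => derive1n k (fun y' : R => BS_put K T r x' y') y) x.

(* Pathwise Stieltjes integral of a continuous integrand g against a   *)
(* nondecreasing right-continuous integrator f on [a,b]:  limit of the *)
(* Riemann--Stieltjes sums along the dyadic partitions of [a,b].       *)
Definition dyadic_pt {R : realType} (a b : R) (n i : nat) : R :=
  a + i%:R * (b - a) / 2 ^+ n.

Definition stieltjes_int {R : realType} (g f : R -> R) (a b : R) : R :=
  limn (fun n : nat => \sum_(i < 2 ^ n)
          g (dyadic_pt a b n i) *
          (f (dyadic_pt a b n i.+1) - f (dyadic_pt a b n i))).

Section probability_defs.
Context {R : realType} {d : measure_display} {Omega : measurableType d}.
Variable P : probability Omega R.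

(* expectation as a real number (meaningful when the integral is finite) *)
Definition Ex (X : Omega -> R) : R := fine (\int[P]_w (X w)%:E)%E.

Definition indep_RVs (n : nat) (X : 'I_n -> Omega -> R) : Prop :=
  forall B : 'I_n -> set R, (forall i, measurable (B i)) ->
    P (\bigcap_i (X i @^-1` B i)) = (\prod_(i < n) P (X i @^-1` B i))%E.

Definition indep_increments (X : R -> Omega -> R) : Prop :=
  forall (n : nat) (t : nat -> R), 0 <= t 0%N -> (forall i, t i <= t i.+1) ->
    indep_RVs (fun (i : 'I_n) w => X (t i.+1) w - X (t i) w).

(* independence of two processes (of their generated sigma-algebras,
   characterised through finite-dimensional cylinder events) *)
Definition indep_processes (X Y : R -> Omega -> R) : Prop :=
  forall (n m : nat) (s : 'I_n -> R) (t : 'I_m -> R)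
         (A : 'I_n -> set R) (B : 'I_m -> set R),
    (forall i, 0 <= s i) -> (forall j, 0 <= t j) ->
    (forall i, measurable (A i)) -> (forall j, measurable (B j)) ->
    P ((\bigcap_i (X (s i) @^-1` A i)) `&` (\bigcap_j (Y (t j) @^-1` B j))) =
    (P (\bigcap_i (X (s i) @^-1` A i)) * P (\bigcap_j (Y (t j) @^-1` B j)))%E.

Definition brownian_motion (W : R -> Omega -> R) : Prop :=
  [/\ (forall t, measurable_fun setT (W t)),
      {ae P, forall w, W 0 w = 0 /\ {within `[0, +oo[, continuous (fun s => W s w)}},
      (forall s t, 0 <= s -> s < t -> forall B : set R, measurable B ->
          P ((fun w => W t w - W s w) @^-1` B) = normal_prob 0 (Num.sqrt (t - s)) B)
    & indep_increments W].

Definition levy_subordinator (Z : R -> Omega -> R) : Prop :=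
  [/\ (forall t, measurable_fun setT (Z t)),
      {ae P, forall w, [/\ Z 0 w = 0,
             (forall s t, 0 <= s -> s <= t -> Z s w <= Z t w)
           & (forall t, 0 <= t -> (fun s => Z s w) @ at_right t --> Z t w)]},
      (forall s t, 0 <= s -> s <= t -> forall B : set R, measurable B ->
          P ((fun w => Z t w - Z s w) @^-1` B) = P (Z (t - s) @^-1` B))
    & indep_increments Z].

Definition mgf (Z : R -> Omega -> R) (theta : R) : \bar R :=
  (\int[P]_w (expR (theta * Z 1 w))%:E)%E.

Definition kappa (Z : R -> Omega -> R) (theta : R) : \bar R :=
  if mgf Z theta is +oo%E then +oo%E else (ln (fine (mgf Z theta)))%:E.

Definition kappa_hat (Z : R -> Omega -> R) : \bar R :=
  ereal_sup [set theta%:E | theta in [set theta : R | (kappa Z theta < +oo)%E]].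

(* stochastic integral int_0^T H_s dW_s : X is the limit in probability
   of the (left-point) Riemann sums along the dyadic partitions of [0,T] *)
Definition stoch_int_of (H W : R -> Omega -> R) (T : R) (X : Omega -> R) : Prop :=
  measurable_fun setT X /\
  forall eps : R, 0 < eps ->
    (fun n : nat => P [set w | eps <= `| \sum_(i < 2 ^ n)
          H (dyadic_pt 0 T n i) w *
          (W (dyadic_pt 0 T n i.+1) w - W (dyadic_pt 0 T n i) w) - X w |])
    @ \oo --> 0%E.

End probability_defs.

Section bns.
Context {R : realType} {Omega : Type}.

Definition alpha (lam s t : R) : R := (1 - expR (- (lam * (t - s)))) / lam.

Definition bns_var (lam sig0sq : R) (Z : R -> Omega -> R) (t : R) (w : Omega) : R :=
  expR (- (lam * t)) *
  (sig0sq + stieltjes_int (fun s => expR (lam * s)) (fun s => Z (lam * s) w) 0 t).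

Definition bns_vol (lam sig0sq : R) (Z : R -> Omega -> R) (t : R) (w : Omega) : R :=
  Num.sqrt (bns_var lam sig0sq Z t w).

Definition bns_intvar (lam sig0sq : R) (Z : R -> Omega -> R) (t : R) (w : Omega) : R :=
  sig0sq * alpha lam 0 t +
  stieltjes_int (fun s => alpha lam s t) (fun s => Z (lam * s) w) 0 t.

(* P_t = exp(rho Z_{lam t} - lam t kappa(rho)) ; kap stands for kappa(rho) *)
Definition bns_P (lam rho kap : R) (Z : R -> Omega -> R) (t : R) (w : Omega) : R :=
  expR (rho * Z (lam * t) w - lam * t * kap).

(* S_t = S_0 P_t exp(r t - I_t/2 + int_0^t sigma_s dW_s) ; stoch = int_0^t sigma dW *)
Definition bns_S (S0 r lam sig0sq rho kap : R) (Z : R -> Omega -> R)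
    (stoch : Omega -> R) (t : R) (w : Omega) : R :=
  S0 * bns_P lam rho kap Z t w *
  expR (r * t - bns_intvar lam sig0sq Z t w / 2 + stoch w).

End bns.

(* Main.v *)
Require Import Defs.
From HB Require Import structures.
From mathcomp Require Import all_boot all_order all_algebra.
From mathcomp Require Import all_classical all_reals all_analysis.
From mathcomp Require Import measurable_realfun ring lra.

Set Implicit Arguments.
Unset Strict Implicit.
Unset Printing Implicit Defensive.

Import Order.TTheory GRing.Theory Num.Theory.
Import numFieldNormedType.Exports.

Local Open Scope classical_set_scope.
Local Open Scope ring_scope.

(* Given the subordinator Z, the integral of sigma against W is Gaussian with variance I_T: its
   left-point Riemann sums are conditionally Gaussian because W and Z are independent, their
   conditional variances converge to I_T path by path, and the put payoff is bounded and Lipschitz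
   in the log-price. Hence the put price is E[BS_Put(S_0 P_T, I_T)]. Taylor's formula with integral
   remainder along the segment from (S_0, E[I_T]) to (S_0 P_T, I_T) then gives the expansion after
   taking expectations; the first-order terms vanish since E[P_T] = 1, where E[exp(rho Z_t)] is
   computed from its multiplicativity and monotonicity in t. Expectations of the remainder exist
   because I_T is almost surely at least sigma_0^2 alpha_{0,T} > 0, and on the half plane of
   variances above a positive level every derivative of order at least 2 of BS_Put is, up to a
   constant, at most x^(1-j), respectively 1, if it contains j > 0, respectively j = 0,
   derivatives in x. *)

(** * Gaussian integrals *)

(** [stoch] is known only as a limit in probability of dyadic Riemann sums, and [indep_processes]
    speaks only of cylinder events. Conditioning on [Z] is therefore Tonelli's theorem for a
    functional on two copies of [Omega], one with the sigma-algebra generated by [W], the other with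
    that of [Z]. The derivative bounds have an algebraic source. With D the derivative in the
    log-moneyness, each derivative of the price is a polynomial in D applied to the unit-strike put;
    order at least 2 makes it divisible by D^2 - D, which sends the put to a Gaussian density, so
    the distribution functions disappear. The singularity x^(1-j) at x = 0 is harmless although [PT]
    may come close to 0: on the segment x is at least (1-u) S_0, and the weight (1-u)^N absorbs
    (1-u)^(1-j) because j <= N+1. Lower bounds on I_T hold almost surely, but measurability of the
    remainder must hold on all of [Omega]. This is why the partial derivatives are also evaluated at
    negative variances. *)

Section gaussian.
Context {R : realType}.
Notation mu := (@lebesgue_measure R).
Notation phi := (@normal_pdf R 0 1).

Lemma std_pdfE (z : R) : phi z = (Num.sqrt (2 * pi))^-1 * expR (- (z ^+ 2 / 2)).
Proof.
rewrite normal_pdfE ?oner_eq0// /normal_peak /normal_fun.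
by rewrite subr0 expr1n mul1r -(mulr_natl pi) mulNr.
Qed.

Lemma affine_derive1 (a b : R) : derive1 (fun z : R => a * z + b) = cst a.
Proof.
apply/funext => x; rewrite derive1E.
have : is_derive x 1 (fun z : R => a * z + b) (a *: 1 + 0) by exact: is_deriveD.
by case=> _ ->; rewrite addr0 /GRing.scale /= mulr1.
Qed.

Lemma derivable_affine (a b x : R) : derivable (fun z : R => a * z + b) x 1.
Proof.
by have : is_derive x 1 (fun z : R => a * z + b) (a *: 1 + 0) by exact: is_deriveD.
Qed.

Lemma integral_affine (a b : R) (G : R -> R) : 0 < a -> continuous G ->
  (forall x, 0 <= G x) ->
  (\int[mu]_x (G x)%:E = \int[mu]_x (G (a * x + b) * a)%:E)%E.
Proof.
move=> a0 cG G0.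
rewrite (@increasing_ge0_integration_by_substitutionT _ (fun z => a * z + b) G)//.
- by under eq_integral do rewrite affine_derive1 /=.
- by move=> x y xy; rewrite ltrD2r ltr_pM2l.
- by rewrite affine_derive1; move=> x; exact: cvg_cst.
- by rewrite affine_derive1; exact: is_cvg_cst.
- by rewrite affine_derive1; exact: is_cvg_cst.
- apply: (@cvg_comp _ _ _ (fun z : R => a * z) (fun z => z + b)); last exact: cvg_addrr_Ny.
  exact: gt0_cvgMrNy cvg_id.
- apply: (@cvg_comp _ _ _ (fun z : R => a * z) (fun z => z + b)); last exact: cvg_addrr.
  exact: gt0_cvgMry cvg_id.
Qed.

Lemma integral_affine_Ny (b c : R) (G : R -> R) : continuous G ->
  (forall x, 0 <= G x) ->
  (\int[mu]_(x in `]-oo, (c + b)%R]) (G x)%:E = \int[mu]_(x in `]-oo, c]) (G (x + b))%:E)%E.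
Proof.
move=> cG G0.
have E : (fun z : R => z + b) = (fun z => 1 * z + b) by apply/funext => z; rewrite mul1r.
have D1 := @affine_derive1 1 b; rewrite -E in D1.
have dD x : derivable (fun z : R => z + b) x 1 by rewrite E; exact: derivable_affine.
rewrite (@increasing_ge0_integration_by_substitutionNy _ (fun z => z + b) G c)//.
- by under eq_integral do rewrite D1 /= mulr1.
- by move=> x y _ _; rewrite ltrD2r.
- by rewrite D1 => x _; exact: cvg_cst.
- by rewrite D1; exact: is_cvg_cst.
- by rewrite D1; exact: cvg_cst.
- split=> [x _//|]. apply: cvg_at_left_filter.
  by apply: cvgD; [exact: cvg_id|exact: cvg_cst].
- exact: cvg_addrr_Ny.
- exact: continuous_subspaceT.
Qed.

(** With c s = a z + b y, the points (z, y) and (s, (b z - a y)/c) of the plane differ by an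
    orthogonal map, so the product of the densities is the same; here y = (c s - a z)/b has been
    eliminated. *)
Lemma std_pdf_rotation (a b c s z : R) : 0 < b -> c ^+ 2 = a ^+ 2 + b ^+ 2 ->
  phi z * phi ((c * s - a * z) / b) = phi s * phi ((c * z - a * s) / b).
Proof.
move=> b0 cab; rewrite !std_pdfE.
rewrite mulrACA -expRD [RHS]mulrACA -expRD; congr (_ * expR _).
have b2 : b != 0 by rewrite gt_eqF.
rewrite !expr_div_n.
transitivity (- ((b ^+ 2 * z ^+ 2 + (c * s - a * z) ^+ 2) / b ^+ 2 / 2)); first by field.
transitivity (- ((b ^+ 2 * s ^+ 2 + (c * z - a * s) ^+ 2) / b ^+ 2 / 2)); last by field.
congr (- (_ / _ / _)).
have -> : b ^+ 2 = c ^+ 2 - a ^+ 2 by rewrite cab; ring.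
by ring.
Qed.

Lemma continuous_std_pdf : continuous phi.
Proof. by apply: continuous_normal_pdf; rewrite oner_eq0. Qed.

Lemma integral_std_pdfZ (k : R) : 0 <= k ->
  (\int[mu]_z (k * phi z)%:E = k%:E)%E.
Proof.
move=> k0; under eq_integral do rewrite EFinM.
rewrite ge0_integralZl ?lee_fin//; first by rewrite integral_normal_pdf mule1.
  by apply/measurable_EFinP; exact: measurable_normal_pdf.
by move=> z _; rewrite lee_fin normal_pdf_ge0.
Qed.

Lemma integral_std_pdf_affine (a b c s : R) : 0 < b -> 0 < c ->
  (\int[mu]_z (phi ((c * z - a * s) / b) * (c / b))%:E = 1)%E.
Proof.
move=> b0 c0; rewrite -(@integral_normal_pdf R 0 1).
rewrite (integral_affine (- (a * s / b)) (divr_gt0 c0 b0) continuous_std_pdf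
  (normal_pdf_ge0 0 1)).
apply: eq_integral => z _; congr (phi _ * _)%:E.
by rewrite mulrBl; congr (_ - _); rewrite mulrAC.
Qed.

(** Substituting c s = a z1 + b z2 with c = sqrt(a^2 + b^2) and swapping the integrals leaves in
    [z1] an affine Gaussian density of mass 1. The case b = 0, where the substitution degenerates,
    is treated apart. *)
Lemma gaussian_convolution (h : R -> R) (a b x : R) : continuous h ->
  (forall t, 0 <= h t) -> 0 <= a -> 0 <= b ->
  (\int[mu]_z1 \int[mu]_z2 (h (x + a * z1 + b * z2) * phi z2 * phi z1)%:E =
   \int[mu]_z (h (x + Num.sqrt (a ^+ 2 + b ^+ 2) * z) * phi z)%:E)%E.
Proof.
move=> ch h0 a0 b0.
have [->|bn0] := eqVneq b 0.
  rewrite expr0n addr0 sqrtr_sqr ger0_norm//; apply: eq_integral => z _.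
  under eq_integral do rewrite mul0r addr0 mulrAC.
  by rewrite integral_std_pdfZ// mulr_ge0 ?h0 ?normal_pdf_ge0.
have bp : 0 < b by rewrite lt_neqAle eq_sym bn0.
set c := Num.sqrt _.
have cab : c ^+ 2 = a ^+ 2 + b ^+ 2 by rewrite sqr_sqrtr// addr_ge0 ?sqr_ge0.
have c0 : 0 < c by rewrite sqrtr_gt0 ltr_wpDl ?sqr_ge0// exprn_gt0.
have cb0 : 0 < c / b by rewrite divr_gt0.
pose f (p : measurableTypeR R * measurableTypeR R) : \bar R :=
  (h (x + c * p.2) * phi p.2 * (phi ((c * p.1 - a * p.2) / b) * (c / b)))%:E.
have step1 z1 : (\int[mu]_z2 (h (x + a * z1 + b * z2) * phi z2 * phi z1)%:E =
    \int[mu]_s f (z1, s))%E.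
  rewrite (@integral_affine (c / b) (- (a * z1 / b))
     (fun z2 => h (x + a * z1 + b * z2) * phi z2 * phi z1))//.
  - apply: eq_integral => s _; rewrite /f /=; congr EFin.
    have -> : x + a * z1 + b * (c / b * s - a * z1 / b) = x + c * s by field.
    have -> : c / b * s - a * z1 / b = (c * s - a * z1) / b by field.
    rewrite -[X in _ = X * _ * _]/(h (x + c * s)).
    transitivity (h (x + c * s) * (phi z1 * phi ((c * s - a * z1) / b)) * (c / b)); first by ring.
    by rewrite (std_pdf_rotation _ _ bp cab); ring.
  - move=> s; apply: cvgM; last exact: cvg_cst.
    apply: cvgM; last exact: continuous_std_pdf.
    apply: continuous_comp; last exact: ch.
    by apply: cvgD; [exact: cvg_cst|apply: cvgM; [exact: cvg_cst|exact: cvg_id]].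
  - by move=> s; rewrite !mulr_ge0 ?h0 ?normal_pdf_ge0.
under eq_integral do rewrite step1.
have mh : measurable_fun setT h by exact: continuous_measurable_fun.
have mphi : measurable_fun setT phi by exact: measurable_normal_pdf.
transitivity (\int[mu]_s \int[mu]_z1 f (z1, s))%E.
  apply: (fubini_tonelli f); last first.
    by move=> [z1 s]; rewrite /f lee_fin !mulr_ge0 ?h0 ?normal_pdf_ge0 ?invr_ge0// ltW.
  apply/measurable_EFinP; apply: measurable_funM.
    apply: measurable_funM; last exact: measurableT_comp.
    by apply: measurableT_comp => //; apply: measurable_funD => //; exact: measurable_funM.
  apply: measurable_funM => //; apply: measurableT_comp => //; apply: measurable_funM => //.
  by apply: measurable_funB; exact: measurable_funM.
apply: eq_integral => s _; rewrite /f /=.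
under eq_integral do rewrite EFinM.
rewrite ge0_integralZl//.
- rewrite [X in (_ * X)%E](_ : _ = 1%E) ?mule1//.
  exact: integral_std_pdf_affine.
- apply/measurable_EFinP; apply: measurable_funM => //; apply: measurableT_comp => //.
  by apply: measurable_funM => //; apply: measurable_funB => //; exact: measurable_funM.
- by move=> z _; rewrite lee_fin !mulr_ge0 ?normal_pdf_ge0 ?invr_ge0// ltW.
- by rewrite lee_fin mulr_ge0 ?h0 ?normal_pdf_ge0.
Qed.

Lemma integrable_std_pdf_shift (D : set R) (b : R) : measurable D ->
  mu.-integrable D (fun z => (phi (z + b))%:E).
Proof.
move=> mD; apply: (@integrableS _ _ _ _ setT) => //.
apply/integrableP; split.
  apply/measurable_EFinP; apply: measurableT_comp; first exact: measurable_normal_pdf.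
  exact: measurable_funD.
under eq_integral do rewrite gee0_abs ?lee_fin ?normal_pdf_ge0//.
have <- : (\int[mu]_z (phi z)%:E = \int[mu]_z (phi (z + b))%:E)%E; last first.
  by rewrite integral_normal_pdf ltry.
rewrite [LHS](@integral_affine 1 b phi)//.
- by apply: eq_integral => z _; rewrite mul1r mulr1.
- exact: continuous_std_pdf.
- exact: normal_pdf_ge0.
Qed.

Lemma PhiE (z : R) : (\int[mu]_(u in `]-oo, z]) (phi u)%:E = (Phi z)%:E)%E.
Proof.
rewrite /Phi fineK//; apply: integrable_fin_num => //.
rewrite (_ : (fun u => _) = (fun u => (phi (u + 0))%:E)); last first.
  by apply/funext => u; rewrite addr0.
exact: integrable_std_pdf_shift.
Qed.

Lemma std_pdf_shift (y z : R) : 0 < y ->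
  expR (- (y / 2) + Num.sqrt y * z) * phi z = phi (z - Num.sqrt y).
Proof.
move=> y0; rewrite !std_pdfE mulrCA -expRD; congr (_ * expR _).
have {1}-> : y = Num.sqrt y ^+ 2 by rewrite sqr_sqrtr// ltW.
by field.
Qed.

Lemma put_exercise_region (K T r x y z : R) : 0 < K -> 0 < x -> 0 < y ->
  (x * expR (- (y / 2) + Num.sqrt y * z) <= K * expR (- (r * T))) =
  (z <= - BS_d K T r (-1) x y).
Proof.
move=> K0 x0 y0; have sy : 0 < Num.sqrt y by rewrite sqrtr_gt0.
rewrite -[in LHS](lnK x0) -[in LHS](lnK K0) -!expRD ler_expR /BS_d.
rewrite -[- (_ / Num.sqrt y)]mulNr ler_pdivlMr// ln_div ?posrE// [z * _]mulrC.
by apply/idP/idP; lra.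
Qed.

(** The summand in [z + 0] gives both densities the form required by [integrable_std_pdf_shift]. *)
Lemma put_integrandE (K T r x y z : R) : 0 < K -> 0 < x -> 0 < y ->
  Num.max (K * expR (- (r * T)) - x * expR (- (y / 2) + Num.sqrt y * z)) 0 * phi z =
  if z <= - BS_d K T r (-1) x y
  then K * expR (- (r * T)) * phi (z + 0) - x * phi (z - Num.sqrt y) else 0.
Proof.
move=> K0 x0 y0; rewrite -put_exercise_region//; case: ifPn => h.
  by rewrite max_l ?subr_ge0// mulrBl addr0 -(std_pdf_shift _ y0) mulrA.
by rewrite max_r ?mul0r// subr_le0 ltW// ltNge.
Qed.

(** The exercise region is a half line ending at -d_-; completing the square shifts the density by
    sqrt y, and -d_- - sqrt y = -d_+. The discount factor sits in the strike, so no drift r appears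
    in the exponent. *)
Lemma gaussian_put (K T r x y : R) : 0 < K -> 0 < x -> 0 < y ->
  (\int[mu]_z (Num.max (K * expR (- (r * T)) - x * expR (- (y / 2) + Num.sqrt y * z)) 0
     * phi z)%:E = (BS_put K T r x y)%:E)%E.
Proof.
move=> K0 x0 y0; have sy : 0 < Num.sqrt y by rewrite sqrtr_gt0.
set c := - BS_d K T r (-1) x y.
transitivity (\int[mu]_(z in `]-oo, c]) ((K * expR (- (r * T)))%:E * (phi (z + 0))%:E -
    x%:E * (phi (z - Num.sqrt y))%:E))%E.
  rewrite [RHS]integral_mkcond; apply: eq_integral => z _.
  rewrite patchE mem_setE in_itv/= put_integrandE// -/c.
  by case: ifPn.
rewrite integralB//; first last.
- by apply: integrableZl => //; exact: integrable_std_pdf_shift.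
- by apply: integrableZl => //; exact: integrable_std_pdf_shift.
rewrite !integralZl//; try exact: integrable_std_pdf_shift.
have -> : (\int[mu]_(z in `]-oo, c]) (phi (z - Num.sqrt y))%:E = (Phi (- BS_d K T r 1 x y))%:E)%E.
  have cE : - BS_d K T r 1 x y = c - Num.sqrt y.
    rewrite /c /BS_d; have yE : y = Num.sqrt y ^+ 2 by rewrite sqr_sqrtr// ltW.
    by move: yE sy; set s := Num.sqrt y => -> s0; field; rewrite gt_eqF.
  rewrite cE -PhiE integral_affine_Ny//; first exact: continuous_std_pdf.
  exact: normal_pdf_ge0.
by under eq_integral do rewrite addr0; rewrite PhiE -!EFinM -EFinB.
Qed.

(** In the exercise region the slope is -exp(a), of size at most [K]. The estimates are instances of
    exp(t) >= 1 + t; when only [b] lies in the region, [ln K] takes the place of [a]. *)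
Lemma put_payoff_lipschitz (K a b : R) : 0 < K ->
  `|Num.max (K - expR a) 0 - Num.max (K - expR b) 0| <= K * `|a - b|.
Proof.
move=> K0; wlog ab : a b / b <= a.
  move=> H; have [ba|/ltW ab] := leP b a; first exact: H.
  by rewrite distrC (distrC a); exact: H.
have eab : expR b <= expR a by rewrite ler_expR.
have : expR a - expR b <= expR a * (a - b).
  have := expR_ge1Dx (b - a); rewrite -(ler_pM2l (expR_gt0 a)) -expRD.
  by rewrite [a + _]addrC subrK; nra.
rewrite (ger0_norm (_ : 0 <= a - b)) ?subr_ge0// => h.
have [aK|Ka] := lerP (expR a) K.
  rewrite !max_l ?subr_ge0 ?(le_trans eab)//.
  have ba0 : 0 <= a - b by rewrite subr_ge0.
  by rewrite ler0_norm; nra.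
rewrite (max_r (x := K - expR a)) ?subr_le0 ?(ltW Ka)//.
have [bK|Kb] := lerP (expR b) K; last first.
  by rewrite max_r ?subr_le0 ?(ltW Kb)// subr0 normr0 mulr_ge0 ?subr_ge0// ltW.
rewrite max_l ?subr_ge0// sub0r normrN ger0_norm ?subr_ge0//.
have lK : ln K - b >= 0 by rewrite subr_ge0 -ler_expR lnK.
have lKa : ln K <= a by rewrite -ler_expR lnK// ltW.
have := expR_ge1Dx (b - ln K); rewrite -(ler_pM2l K0) -{3}(lnK K0) -expRD.
rewrite [ln K + _]addrC subrK => h2.
by nra.
Qed.

End gaussian.

(** * Laws and independence *)

Section layer_cake.
Context {R : realType} {d : measure_display} {T : measurableType d}.
Notation mu := (@lebesgue_measure R).
Variable nu : {sigma_finite_measure set T -> \bar R}.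

(** Tonelli on the region under the graph of [f]: an integral is reduced to the level sets {f > t},
    weighted by [p]. *)
Lemma layer_cake (f p : T -> R) : measurable_fun setT f -> measurable_fun setT p ->
  (forall x, 0 <= f x) -> (forall x, 0 <= p x) ->
  (\int[nu]_x (f x * p x)%:E =
   \int[mu]_t \int[nu]_(x in [set x | ((0 <= t) && (t < f x))%R]) (p x)%:E)%E.
Proof.
move=> mf mp f0 p0.
pose A : set (T * measurableTypeR R) := [set q | (0 <= q.2) && (q.2 < f q.1)].
have mfst : measurable_fun setT (fun q : T * measurableTypeR R => f q.1).
  exact: measurableT_comp.
have msnd : measurable_fun setT (fun q : T * measurableTypeR R => q.2 : R).
  exact: measurable_snd.
have mA : measurable A.
  rewrite (_ : A = (fun q : T * measurableTypeR R => (0 <= q.2) && (q.2 < f q.1)) @^-1` [set true]).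
    rewrite -[X in measurable X]setTI.
    apply: measurable_and => //; last exact: measurable_fun_ltr.
    exact: measurable_fun_ler.
  by apply/seteqP; split => q.
pose F (q : T * measurableTypeR R) : \bar R := (\1_A q * p q.1)%:E.
transitivity (\int[nu]_x \int[mu]_t F (x, t))%E.
  apply: eq_integral => x _.
  rewrite (_ : (fun t => F (x, t)) =
      (fun t : measurableTypeR R => (\1_`[0, f x[%classic t)%:E * (p x)%:E)%E); last first.
    by apply/funext => t; rewrite /F !indicE !mem_setE /A /= in_itv EFinM.
  rewrite ge0_integralZr ?lee_fin//; last exact/measurable_EFinP.
  rewrite integral_indic//= setIT lebesgue_measure_itv/= lte_fin.
  have [->|fx0] := eqVneq (f x) 0; first by rewrite ltxx mul0r mul0e.
  by rewrite lt_neqAle eq_sym fx0 f0 oppr0 adde0 EFinM.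
rewrite (fubini_tonelli (m1 := nu) (m2 := mu) F)//; first last.
- by move=> q; rewrite lee_fin mulr_ge0.
- apply/measurable_EFinP; apply: measurable_funM => //.
  exact: measurableT_comp.
apply: eq_integral => t _; rewrite [RHS]integral_mkcond.
apply: eq_integral => x _; rewrite patchE /F indicE.
have -> : ((x, t) \in A) = ((0 <= t) && (t < f x))%R by apply/idP/idP; rewrite inE.
have -> : (x \in [set x | 0 <= t < f x]) = ((0 <= t) && (t < f x))%R.
  by apply/idP/idP; rewrite inE.
by case: ifPn => h; rewrite ?mul1r// mul0r.
Qed.

End layer_cake.

Section density.
Context {R : realType} {d : measure_display} {Omega : measurableType d}.
Notation mu := (@lebesgue_measure R).
Variable P : probability Omega R.

(** The density hypothesis concerns sets only, so both integrals are cut into level sets of [h] and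
    compared level by level. *)
Lemma integral_density (X : Omega -> R) (p h : R -> R) :
  measurable_fun setT X -> measurable_fun setT p -> (forall x, 0 <= p x) ->
  (forall B, measurable B -> P (X @^-1` B) = (\int[mu]_(x in B) (p x)%:E)%E) ->
  measurable_fun setT h -> (forall x, 0 <= h x) ->
  (\int[P]_w (h (X w))%:E = \int[mu]_x (h x * p x)%:E)%E.
Proof.
move=> mX mp p0 Xp mh h0.
rewrite [RHS](@layer_cake _ _ _ mu)//.
transitivity (\int[P]_w (h (X w) * 1)%:E)%E.
  by apply: eq_integral => w _; rewrite mulr1.
rewrite (@layer_cake _ _ _ P (h \o X) (cst 1))//=; last exact: measurableT_comp.
apply: eq_integral => t _; rewrite -Xp; last first.
  rewrite -[X in measurable X]setTI.
  rewrite (_ : [set x | _] = (fun x => (0 <= t) && (t < h x)) @^-1` [set true]); last first.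
    by apply/seteqP; split => q.
  by apply: measurable_and => //; exact: measurable_fun_ltr.
rewrite integral_cst ?mul1e//.
rewrite -[X in measurable X]setTI.
rewrite (_ : [set x | _] = (fun x => (0 <= t) && (t < h (X x))) @^-1` [set true]); last first.
  by apply/seteqP; split => q.
apply: measurable_and => //; apply: measurable_fun_ltr => //; exact: measurableT_comp.
Qed.

End density.

(** * Independence as a product of laws *)

Section independence.
Context {R : realType} {d : measure_display} {Omega : measurableType d}.
Variable P : probability Omega R.

(** Dynkin's pi-lambda theorem: the [A] obeying the product rule with the fixed event [C] are closed
    under complement and countable disjoint union. *)
Lemma indep_dynkin d1 (T1 : measurableType d1) (X : Omega -> T1) (G : set (set T1))
    (C : set Omega) :
  @measurable d1 T1 = <<s G >> -> setI_closed G -> measurable_fun setT X -> measurable C ->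
  (forall A, G A -> P (X @^-1` A `&` C) = (P (X @^-1` A) * P C)%E) ->
  forall A, measurable A -> P (X @^-1` A `&` C) = (P (X @^-1` A) * P C)%E.
Proof.
move=> GE GI mX mC GC A mA.
have mXA B : measurable B -> measurable (X @^-1` B).
  by move=> mB; rewrite -[X in measurable X]setTI; exact: mX.
have tX (F : (set T1)^nat) : trivIset setT F -> trivIset setT (fun i => X @^-1` F i).
  move=> /trivIsetP tF; apply/trivIsetP => /= i j _ _ ij.
  by rewrite -preimage_setI tF// preimage_set0.
apply: (dynkin_induction (P := [set A | P (X @^-1` A `&` C) = (P (X @^-1` A) * P C)%E]) GE GI) => //=.
- by rewrite preimage_setT setTI probability_setT mul1e.
- move=> S mS SC; rewrite preimage_setC setIC -setDE measureD//; last 2 first.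
  + exact: mXA.
  + by rewrite ltey_eq fin_num_measure.
  have -> : (P C - P (C `&` X @^-1` S) = P C - P (X @^-1` S) * P C)%E by rewrite setIC SC.
  rewrite probability_setC; last exact: mXA.
  rewrite muleBl; [by rewrite mul1e|exact: fin_num_measure|by rewrite fin_num_adde_defr].
- move=> F mF tF FC.
  rewrite preimage_bigcup setI_bigcupl.
  rewrite measure_bigcup//; last 2 first.
  + by move=> i _; apply: measurableI => //; exact: mXA.
  + by apply: trivIset_setIr; exact: tX.
  rewrite measure_bigcup//; last 2 first.
  + by move=> i _; exact: mXA.
  + exact: tX.
  rewrite muleC -[P C]fineK ?fin_num_measure// -nneseriesZl//.
  by apply: eq_eseriesr => i _; rewrite fineK ?fin_num_measure// muleC; exact: FC.
- by rewrite -GE.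
Qed.

(* The joint law of an independent pair is the product of the marginals, so one may integrate
   the two arguments separately. *)
Lemma integral_indep d1 (T1 : measurableType d1) d2 (T2 : measurableType d2)
    (X : Omega -> T1) (Y : Omega -> T2) (G1 : set (set T1)) (G2 : set (set T2))
    (F : T1 * T2 -> \bar R) :
  @measurable d1 T1 = <<s G1 >> -> setI_closed G1 ->
  @measurable d2 T2 = <<s G2 >> -> setI_closed G2 ->
  measurable_fun setT X -> measurable_fun setT Y ->
  (forall A B, G1 A -> G2 B ->
     P (X @^-1` A `&` Y @^-1` B) = (P (X @^-1` A) * P (Y @^-1` B))%E) ->
  measurable_fun setT F -> (forall z, 0 <= F z)%E ->
  (\int[P]_w F (X w, Y w) = \int[P]_w' \int[P]_w F (X w, Y w'))%E.
Proof.
move=> G1E G1I G2E G2I mX mY XY mF F0.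
have mXA B : measurable B -> measurable (X @^-1` B).
  by move=> mB; rewrite -[X in measurable X]setTI; exact: mX.
have mYA B : measurable B -> measurable (Y @^-1` B).
  by move=> mB; rewrite -[X in measurable X]setTI; exact: mY.
have ind A B : measurable A -> measurable B ->
    P (X @^-1` A `&` Y @^-1` B) = (P (X @^-1` A) * P (Y @^-1` B))%E.
  move=> mA mB; apply: (indep_dynkin G1E G1I) => //; first exact: mYA.
  move=> A' GA'; rewrite setIC muleC; apply: (indep_dynkin G2E G2I) => //.
    by apply: mXA; rewrite G1E; exact: sub_gen_smallest.
  by move=> B' GB'; rewrite setIC muleC; exact: XY.
pose X' : {mfun Omega >-> T1} := HB.pack X (isMeasurableFun.Build _ _ _ _ X mX).
pose Y' : {mfun Omega >-> T2} := HB.pack Y (isMeasurableFun.Build _ _ _ _ Y mY).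
have mXY : measurable_fun setT (fun w => (X w, Y w)) by exact: measurable_fun_pair.
pose XY' : {mfun Omega >-> (T1 * T2)%type} :=
  HB.pack (fun w => (X w, Y w)) (isMeasurableFun.Build _ _ _ _ _ mXY).
have E S : measurable S -> (distribution P X' \x distribution P Y')%E S = distribution P XY' S.
  apply: product_measure_unique => A B mA mB.
  by rewrite -[RHS]ind.
rewrite -[LHS](@ge0_integral_distribution _ _ _ _ _ P XY' F)//.
transitivity (\int[(distribution P X' \x distribution P Y')%E]_y F y)%E.
  by apply: eq_measure_integral => S mS _; exact/esym/E.
rewrite fubini_tonelli2// /fubini_G.
rewrite (@ge0_integral_distribution _ _ _ _ _ P Y')//; last 2 first.
- exact: (measurable_fun_fubini_tonelli_G F).
- by move=> y; exact: integral_ge0.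
apply: eq_integral => w' _ /=.
rewrite (@ge0_integral_distribution _ _ _ _ _ P X')//.
exact: measurableT_comp.
Qed.

End independence.

(** * The sigma-algebra generated by a process *)

Section cylinders.
Context {R : realType} {d : measure_display} {Omega : measurableType d} {J : Type}.
Implicit Types (X : J -> Omega -> R) (D : set J).

(** [D] restricts the indices: independence of the processes is stated at times >= 0, and partial
    sums use indices below [n]. An index may occur several times in [s]. *)
Definition cyl D X : set (set Omega) :=
  [set E | exists n (s : 'I_n -> J) (A : 'I_n -> set R),
    [/\ forall i, D (s i), forall i, measurable (A i)
      & E = \bigcap_i (X (s i) @^-1` A i)]].

Lemma cyl_setI D X : setI_closed (cyl D X).
Proof.
move=> _ _ [n [s [A [Ds mA ->]]]] [m [t [B [Dt mB ->]]]].
exists (n + m)%N.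
exists (fun i => match fintype.split i with inl j => s j | inr k => t k end).
exists (fun i => match fintype.split i with inl j => A j | inr k => B k end).
split.
- by move=> i; case: fintype.split.
- by move=> i; case: fintype.split.
apply/seteqP; split => w /=.
  move=> [hA hB] i _ /=; case: fintype.split => j; [exact: hA|exact: hB].
move=> h; split => i _.
  by have := h (unsplit (inl i)) I; rewrite unsplitK.
by have := h (unsplit (inr i)) I; rewrite unsplitK.
Qed.

(** [Omega] with the smaller sigma-algebra: measurability on this type means being a functional of
    [X] on [D], and the identity of [Omega] stands for the process as a random element. *)
Definition cyl_type D X := g_sigma_algebraType (cyl D X).

Lemma measurable_cyl D X i : D i ->
  measurable_fun (setT : set (cyl_type D X)) (X i : cyl_type D X -> R).
Proof.
move=> Di _ B mB; rewrite setTI; apply: sub_gen_smallest.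
exists 1%N, (fun=> i), (fun=> B); split => //.
by apply/seteqP; split => [w ? ? _//|w /(_ ord0 I)].
Qed.

Lemma measurable_id_cyl D X : (forall i, D i -> measurable_fun setT (X i)) ->
  measurable_fun (setT : set Omega) (id : Omega -> cyl_type D X).
Proof.
move=> mX _ B mB; rewrite setTI preimage_id.
apply: (smallest_sub (@sigma_algebra_measurable _ Omega) _ mB).
move=> _ [n [s [A [Ds mA ->]]]].
apply: fin_bigcap_measurable; first exact: finite_finset.
by move=> i _; rewrite -[X in measurable X]setTI; exact: mX.
Qed.

End cylinders.

(** * Linear combinations of independent Gaussian increments *)

Section gaussian_sums.
Context {R : realType} {d : measure_display} {Omega : measurableType d}.
Variable P : probability Omega R.
Notation mu := (@lebesgue_measure R).
Notation phi := (@normal_pdf R 0 1).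
Variables (s : R) (X : nat -> Omega -> R).
Hypotheses (s0 : 0 < s) (mX : forall i, measurable_fun setT (X i))
  (Xlaw : forall i B, measurable B -> P (X i @^-1` B) = normal_prob 0 s B)
  (Xind : forall n, indep_RVs P (fun i : 'I_n => X i)).

Lemma integral_normal_law (i : nat) (h : R -> R) (x c : R) : continuous h ->
  (forall t, 0 <= h t) ->
  (\int[P]_w (h (x + c * X i w))%:E = \int[mu]_z (h (x + c * s * z) * phi z)%:E)%E.
Proof.
move=> ch h0.
have ch' : continuous (fun y => h (x + c * y)).
  move=> y; apply: continuous_comp; last exact: ch.
  by apply: cvgD; [exact: cvg_cst|apply: cvgM; [exact: cvg_cst|exact: cvg_id]].
rewrite (@integral_density _ _ _ _ (X i) (normal_pdf 0 s) (fun y => h (x + c * y))); first last.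
- by [].
- exact: continuous_measurable_fun.
- by move=> B mB; exact: Xlaw.
- exact: normal_pdf_ge0.
- exact: measurable_normal_pdf.
- by [].
- rewrite (@integral_affine _ s 0 (fun y => h (x + c * y) * normal_pdf 0 s y))//.
  + apply: eq_integral => z _; rewrite addr0 mulrA -mulrA; congr (_ * _)%:E.
    rewrite std_pdfE normal_pdfE ?gt_eqF// /normal_peak /normal_fun.
    rewrite subr0 -mulrnAr sqrtrM ?sqr_ge0// sqrtr_sqr gtr0_norm// invfM -(mulr_natl pi).
    rewrite mulrC !mulrA divff ?gt_eqF// mul1r; congr (_ * expR _).
    by rewrite -mulr_natl; field; rewrite gt_eqF.
  + move=> y; apply: cvgM; first exact: ch'.
    by apply: continuous_normal_pdf; rewrite gt_eqF.
  + by move=> y; rewrite mulr_ge0 ?normal_pdf_ge0.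
Qed.

Lemma indep_cyl_next (n : nat) (A : set Omega) (B : set R) :
  cyl [set i | (i < n)%N] X A -> measurable B ->
  P (A `&` X n @^-1` B) = (P A * P (X n @^-1` B))%E.
Proof.
move=> [m [t [C [tn mC ->]]]] mB.
(* A cylinder may repeat or omit an index: all constraints on one index are intersected, and an
   empty intersection is [setT]. *)
pose Bf (U : set R) (i : 'I_n.+1) : set R :=
  if (i < n)%N then \bigcap_(k in [set k | t k = i]) C k else U.
have mBf U i : measurable U -> measurable (Bf U i).
  rewrite /Bf; case: ifPn => // _ _.
  by apply: fin_bigcap_measurable; [exact: finite_finset|move=> k _; exact: mC].
have E U : (\bigcap_i (X (t i) @^-1` C i)) `&` X n @^-1` U = \bigcap_(i in setT) (X (i : 'I_n.+1) @^-1` Bf U i).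
  apply/seteqP; split => w /=.
    move=> [hC hU] i _ /=; rewrite /Bf; case: ifPn => [_ k /= ki|ni].
      by rewrite -ki; exact: hC.
    by have -> : (i : nat) = n by apply/eqP; rewrite eqn_leq -ltnS ltn_ord leqNgt.
  move=> h; split=> [k _|].
    have tk := tn k; have := h (Ordinal (ltnW tk : (t k < n.+1)%N)) I.
    by rewrite /Bf /= tk; exact.
  by have := h ord_max I; rewrite /Bf /= ltnn.
have PE U : measurable U ->
    P ((\bigcap_i (X (t i) @^-1` C i)) `&` X n @^-1` U) =
    ((\prod_(i < n) P (X i @^-1` Bf setT (widen_ord (leqnSn n) i))) * P (X n @^-1` U))%E.
  move=> mU; rewrite E (Xind (fun i => mBf U i mU)) big_ord_recr /=.
  rewrite {2}/Bf /= ltnn; congr (_ * _)%E; apply: eq_bigr => i _.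
  by rewrite /Bf /= ltn_ord.
(* [PE] is used with [U] = [B] and with [U] = [setT]; the second instance identifies the product
   over i < n with the probability of [A]. *)
by rewrite PE// -[X in (P X * _)%E]setIT -(preimage_setT (X n)) PE// preimage_setT probability_setT mule1.
Qed.

(** Induction on [n] for all shifts [x]: the last variable is independent of the others, which the
    induction hypothesis replaces by one Gaussian around the shifted centre; [gaussian_convolution]
    merges the two. The coefficients are deterministic, as they become once [Z] is frozen. *)
Lemma integral_gaussian_sum (c : nat -> R) (h : R -> R) (n : nat) (x : R) :
  (forall i, 0 <= c i) -> continuous h -> (forall t, 0 <= h t) ->
  (\int[P]_w (h (x + \sum_(i < n) c i * X i w))%:E =
   \int[mu]_z (h (x + Num.sqrt (\sum_(i < n) c i ^+ 2 * s ^+ 2) * z) * phi z)%:E)%E.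
Proof.
move=> c0 ch h0; elim: n x => [|n IH] x.
  rewrite !big_ord0 sqrtr0.
  under eq_integral do rewrite big_ord0 addr0.
  under [RHS]eq_integral do rewrite mul0r addr0.
  by rewrite integral_std_pdfZ// integral_cst//= probability_setT mule1.
have mh : measurable_fun setT h by exact: continuous_measurable_fun.
pose D := [set i | (i < n)%N].
pose T1 := cyl_type D X.
pose S (w : T1) := \sum_(i < n) c i * X i w.
have mS : measurable_fun setT S.
  apply: measurable_sum => i; apply: measurable_funM => //.
  by apply: measurable_cyl; exact: ltn_ord.
have mS' : measurable_fun setT (S : Omega -> R).
  apply: measurable_sum => i; apply: measurable_funM => //.
pose F (q : T1 * R) := (h (x + S q.1 + c n * q.2))%:E.
transitivity (\int[P]_w F (w : T1, X n w))%E.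
  by apply: eq_integral => w _; rewrite /F /= big_ord_recr /= addrA.
rewrite (@integral_indep _ _ _ P _ T1 _ _ (id : Omega -> T1) (X n) (cyl D X) measurable F)//; first last.
- by move=> q; rewrite lee_fin.
- apply/measurable_EFinP; apply: measurableT_comp => //; apply: measurable_funD.
    by apply: measurable_funD => //; exact: measurableT_comp.
  by apply: measurable_funM => //; exact: measurable_snd.
- move=> A B; exact: indep_cyl_next.
- exact: measurable_id_cyl.
- exact: measurableI.
- by rewrite sigma_algebra_id//; exact: sigma_algebra_measurable.
- exact: cyl_setI.
set v := \sum_(i < n) c i ^+ 2 * s ^+ 2.
have v0 : 0 <= v by apply: sumr_ge0 => i _; rewrite mulr_ge0 ?sqr_ge0.
pose H (q : Omega * measurableTypeR R) : \bar R := (h (x + c n * X n q.1 + Num.sqrt v * q.2) * phi q.2)%:E.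
transitivity (\int[P]_w \int[mu]_z H (w, z))%E.
  apply: eq_integral => w' _; rewrite /H /= -IH.
  by apply: eq_integral => w _; rewrite /F /= /S; congr (h _)%:E; ring.
rewrite (fubini_tonelli (m1 := P) (m2 := mu) H)//; first last.
- by move=> q; rewrite lee_fin mulr_ge0 ?h0 ?normal_pdf_ge0.
- apply/measurable_EFinP; apply: measurable_funM; last first.
    apply: measurableT_comp; first exact: measurable_normal_pdf.
    exact: measurable_snd.
  apply: measurableT_comp => //; apply: measurable_funD.
    apply: measurable_funD => //; apply: measurable_funM => //.
    by apply: measurableT_comp => //; exact: measurable_fst.
  by apply: measurable_funM => //; exact: measurable_snd.
rewrite big_ord_recr /= -/v.
have -> : v + c n ^+ 2 * s ^+ 2 = Num.sqrt v ^+ 2 + (c n * s) ^+ 2.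
  by rewrite sqr_sqrtr// exprMn.
rewrite -gaussian_convolution ?sqrtr_ge0 ?mulr_ge0 ?c0 ?(ltW s0)//.
apply: eq_integral => z _; rewrite /H /=.
under eq_integral do rewrite addrAC EFinM.
rewrite ge0_integralZr//; first last.
- by rewrite lee_fin normal_pdf_ge0.
- by move=> w _; rewrite lee_fin.
- apply/measurable_EFinP; apply: measurableT_comp => //; apply: measurable_funD => //.
  exact: measurable_funM.
rewrite integral_normal_law//.
under [RHS]eq_integral do rewrite EFinM.
rewrite ge0_integralZr//; first last.
- by rewrite lee_fin normal_pdf_ge0.
- by move=> w _; rewrite lee_fin mulr_ge0 ?h0 ?normal_pdf_ge0.
- apply/measurable_EFinP; apply: measurable_funM; last exact: measurable_normal_pdf.
  by apply: measurableT_comp => //; apply: measurable_funD.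
Qed.

End gaussian_sums.

(** * Derivatives of the Black-Scholes put price *)

Section derive_tools.
Context {R : realType}.
Implicit Types (f g h : R -> R) (t a b c : R).

(* [is_derive] behind a constant that is not a type class, so that unification
   variables for derivatives are left to the explicit rules below. *)
Definition has_deriv f t a : Prop := is_derive t 1 f a.

Lemma has_deriv_eq f t a b : has_deriv f t a -> a = b -> has_deriv f t b.
Proof. by move=> + <-. Qed.

Lemma has_derivD f g t a b : has_deriv f t a -> has_deriv g t b ->
  has_deriv (fun u => f u + g u) t (a + b).
Proof. by rewrite /has_deriv => ? ?; exact: is_deriveD. Qed.

Lemma has_derivN f t a : has_deriv f t a -> has_deriv (fun u => - f u) t (- a).
Proof. by rewrite /has_deriv => ?; exact: is_deriveN. Qed.

Lemma has_derivB f g t a b : has_deriv f t a -> has_deriv g t b ->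
  has_deriv (fun u => f u - g u) t (a - b).
Proof. by rewrite /has_deriv => ? ?; exact: is_deriveB. Qed.

Lemma has_derivM f g t a b : has_deriv f t a -> has_deriv g t b ->
  has_deriv (fun u => f u * g u) t (a * g t + f t * b).
Proof.
rewrite /has_deriv => fa gb; have -> : a * g t + f t * b = f t *: b + g t *: a.
  by rewrite /GRing.scale /= addrC [a * _]mulrC.
exact: is_deriveM.
Qed.

Lemma has_deriv_cst c t : has_deriv (fun=> c) t 0.
Proof. exact: is_derive_cst. Qed.

Lemma has_deriv_id t : has_deriv (fun u : R => u) t 1.
Proof. exact: is_derive_id. Qed.

Lemma has_deriv_comp h f t a b : has_deriv f t a -> has_deriv h (f t) b ->
  has_deriv (fun u => h (f u)) t (b * a).
Proof. by rewrite /has_deriv => ? ?; exact: is_derive1_comp. Qed.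

Lemma has_derivV f t a : f t != 0 -> has_deriv f t a ->
  has_deriv (fun u => (f u)^-1) t (- a / f t ^+ 2).
Proof.
rewrite /has_deriv => f0 fa; have -> : - a / f t ^+ 2 = - (f t) ^- 2 *: a.
  by rewrite /GRing.scale /= mulNr mulrC mulNr.
exact: is_deriveV.
Qed.

Lemma has_derivX f n t a : has_deriv f t a ->
  has_deriv (fun u => f u ^+ n) t (n%:R * f t ^+ n.-1 * a).
Proof.
rewrite /has_deriv => fa; rewrite (_ : (fun u => f u ^+ n) = f ^+ n).
  exact: is_deriveX.
by apply/funext => u; rewrite exprfctE.
Qed.

Lemma has_deriv_sum n (f : nat -> R -> R) (a : nat -> R) t :
  (forall i, (i < n)%N -> has_deriv (f i) t (a i)) ->
  has_deriv (fun u => \sum_(i < n) f i u) t (\sum_(i < n) a i).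
Proof.
rewrite /has_deriv => fa.
rewrite (_ : (fun u => _) = \sum_(i < n) f i); last first.
  by apply/funext => u; rewrite fct_sumE.
by apply: is_derive_sum => i; exact: fa.
Qed.

Lemma has_deriv_expR t : has_deriv expR t (expR t).
Proof. exact: is_derive_expR. Qed.

Lemma has_deriv_sqrt t : 0 < t -> has_deriv Num.sqrt t (2 * Num.sqrt t)^-1.
Proof. exact: is_derive1_sqrt. Qed.

Lemma has_deriv_ln t : 0 < t -> has_deriv (@ln R) t t^-1.
Proof. exact: is_derive1_ln. Qed.

Lemma derive1_near f g t a : (\near t, f t = g t) -> has_deriv g t a ->
  derive1 f t = a.
Proof. by move=> fg [dg <-]; rewrite derive1E; exact: near_eq_derive. Qed.

Lemma has_deriv_continuous f t a : has_deriv f t a -> {for t, continuous f}.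
Proof. by move=> fa; apply/differentiable_continuous/derivable1_diffP; case: fa. Qed.

End derive_tools.

Section taylor.
Context {R : realType}.
Notation mu := (@lebesgue_measure R).

(** [Psi u] is N! times the Taylor polynomial of degree [N] centred at u and evaluated at 1; its
    derivative telescopes to the integrand. Differentiability at order N + 1 supplies the continuity
    of that integrand. *)
Lemma taylor_integral_remainder (f : nat -> R -> R) (N : nat) :
  (forall (n : nat) (t : R), (n <= N.+1)%N -> 0 <= t <= 1 -> has_deriv (f n) t (f n.+1 t)) ->
  (\int[mu]_(u in `[0%R, 1%R]) ((1 - u) ^+ N * f N.+1 u)%:E =
   (N`!%:R * (f 0%N 1 - \sum_(n < N.+1) f n 0 / n`!%:R))%:E)%E.
Proof.
move=> df.
pose Psi u : R := N`!%:R * \sum_(n < N.+1) (1 - u) ^+ n / n`!%:R * f n u.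
have dPsi (t : R) : 0 <= t <= 1 -> has_deriv Psi t ((1 - t) ^+ N * f N.+1 t).
  move=> t01; have facN : N`!%:R != 0 :> R by rewrite pnatr_eq0 -lt0n fact_gt0.
  suff H m : (m <= N)%N -> has_deriv (fun u => \sum_(n < m.+1) (1 - u) ^+ n / n`!%:R * f n u) t
      ((1 - t) ^+ m / m`!%:R * f m.+1 t).
    apply: has_deriv_eq; first exact: (has_derivM (has_deriv_cst _ _) (H N (leqnn N))).
    by rewrite mul0r add0r; field.
  elim: m => [|m IH] mN.
    rewrite (_ : (fun u => _) = f 0%N); last first.
      by apply/funext => u; rewrite big_ord_recr big_ord0 /= expr0 fact0 invr1 !mul1r add0r.
    rewrite expr0 fact0 invr1 !mul1r; exact: df.
  rewrite (_ : (fun u => _) = (fun u => \sum_(n < m.+1) (1 - u) ^+ n / n`!%:R * f n u +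
     (1 - u) ^+ m.+1 / m.+1`!%:R * f m.+1 u)); last first.
    by apply/funext => u; rewrite big_ord_recr.
  apply: has_deriv_eq.
    apply: has_derivD; first exact: IH (ltnW mN).
    apply: has_derivM; last exact: df _ _ (ltnW (mN : (m.+1 < N.+1)%N)) t01.
    apply: has_derivM; last exact: has_deriv_cst.
    apply: has_derivX; apply: has_derivB; [exact: has_deriv_cst|exact: has_deriv_id].
  have m0 : m`!%:R != 0 :> R by rewrite pnatr_eq0 -lt0n fact_gt0.
  have m1 : m.+1%:R != 0 :> R by rewrite pnatr_eq0.
  rewrite factS natrM /=; move: (m`!%:R) (m.+1%:R) m0 m1 => A B m0 m1.
  by field; rewrite m0 m1.
have cPsi : {within `[0%R, 1%R], continuous Psi}.
  apply/subspace_continuousP => t; rewrite /= in_itv/= => t01.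
  by apply: cvg_within_filter; exact: has_deriv_continuous (dPsi t t01).
rewrite (@continuous_FTC2 _ _ Psi)//.
- rewrite /Psi subrr -EFinB -mulrBr; congr (_ * _)%:E; congr (_ - _).
    rewrite big_ord_recl /= expr0 fact0 invr1 !mul1r big1 ?addr0// => i _.
    by rewrite /bump /= expr0n /= !mul0r.
  by apply: eq_bigr => i _; rewrite subr0 expr1n mul1r mulrC.
- apply/subspace_continuousP => t; rewrite /= in_itv/= => t01.
  apply: cvg_within_filter; apply: cvgM; last exact: has_deriv_continuous (df _ _ (leqnn _) t01).
  apply: (has_deriv_continuous (f := fun u : R => (1 - u) ^+ N)).
  by apply: has_derivX; apply: has_derivB; [exact: has_deriv_cst|exact: has_deriv_id].
- have i0 : 0 <= (0 : R) <= 1 by rewrite lexx ler01.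
  have i1 : 0 <= (1 : R) <= 1 by rewrite lexx ler01.
  split.
  + by move=> t; rewrite in_itv/= => /andP[t0 t1]; have [] := dPsi t; rewrite ?(ltW t0) ?(ltW t1).
  + by apply: cvg_at_right_filter; exact: has_deriv_continuous (dPsi _ i0).
  + by apply: cvg_at_left_filter; exact: has_deriv_continuous (dPsi _ i1).
- move=> t; rewrite in_itv/= => /andP[t0 t1]; rewrite derive1E.
  by have [] := dPsi t; rewrite ?(ltW t0) ?(ltW t1).
Qed.

End taylor.

(** * The Gaussian kernel in the log-moneyness and its derivatives *)

Section gauss_kernel.
Context {R : realType}.
Notation phi := (@normal_pdf R 0 1).
Implicit Types (L y : R -> R) (t dL dy : R).

Lemma has_deriv_std_pdf (z : R) : has_deriv phi z (- z * phi z).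
Proof.
rewrite (_ : phi = fun z => (Num.sqrt (2 * pi))^-1 * expR (- (z ^+ 2 / 2))); last first.
  by apply/funext => u; exact: std_pdfE.
apply: has_deriv_eq.
  apply: has_derivM; first exact: has_deriv_cst.
  apply: has_deriv_comp; last exact: has_deriv_expR.
  apply: has_derivN; apply: has_derivM; last exact: has_deriv_cst.
  by apply: has_derivX; exact: has_deriv_id.
by rewrite /=; set c := (Num.sqrt _)^-1; field.
Qed.

Lemma has_deriv_Phi (z : R) : has_deriv Phi z (phi z).
Proof.
have zz : z < z + 1 by rewrite ltrDl.
have := @continuous_FTC1 R phi -oo%O z (z + 1) zz.
case; first last.
- by move=> dF <-; rewrite derive1E; exact: DeriveDef.
- exact: continuous_std_pdf.
- by rewrite ltNyr.
- rewrite (_ : EFin \o phi = fun u => (phi (u + 0))%:E); last first.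
    by apply/funext => u; rewrite addr0.
  exact: integrable_std_pdf_shift.
Qed.

(** The normal density with mean v/2 and variance v at l, that is phi(d_-)/sqrt v. It equals D^2 - D
    applied to the unit-strike put. *)
Definition bskernel (l v : R) : R := phi ((l - v / 2) / Num.sqrt v) / Num.sqrt v.

(* Successive derivatives of the kernel in the log-moneyness [l]: pairs of
   consecutive ones, by the three-term recurrence coming from v g' = - (l - v/2) g. *)
Fixpoint bskernel_pair (m : nat) (l v : R) : R * R :=
  match m with
  | 0%N => (bskernel l v, - ((l - v / 2) / v) * bskernel l v)
  | m'.+1 => let p := bskernel_pair m' l v in
     (p.2, - ((l - v / 2) * p.2 + m'.+1%:R * p.1) / v)
  end.

Definition dkernel m l v := (bskernel_pair m l v).1.

Lemma dkernel0 l v : dkernel 0 l v = bskernel l v. Proof. by []. Qed.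

Lemma dkernel1 l v : dkernel 1 l v = - ((l - v / 2) / v) * bskernel l v.
Proof. by []. Qed.

Lemma dkernelSS m l v :
  dkernel m.+2 l v = - ((l - v / 2) * dkernel m.+1 l v + m.+1%:R * dkernel m l v) / v.
Proof. by []. Qed.

(** The kernel solves a heat equation with drift, d/dv = (D^2 - D)/2. Differentiating along a curve
    (L, y) covers at once both partial derivatives and the segment of Taylor's formula. *)
Lemma has_deriv_bskernel L y t dL dy : has_deriv L t dL -> has_deriv y t dy -> 0 < y t ->
  has_deriv (fun u => bskernel (L u) (y u)) t
    (dL * dkernel 1 (L t) (y t) +
     dy * (2^-1 * (dkernel 2 (L t) (y t) - dkernel 1 (L t) (y t)))).
Proof.
move=> HL Hy y0; have s0 : 0 < Num.sqrt (y t) by rewrite sqrtr_gt0.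
have Hs : has_deriv (fun u => Num.sqrt (y u)) t ((2 * Num.sqrt (y t))^-1 * dy).
  by apply: has_deriv_comp => //; exact: has_deriv_sqrt.
have Hi : has_deriv (fun u => (Num.sqrt (y u))^-1) t
    (- ((2 * Num.sqrt (y t))^-1 * dy) / (Num.sqrt (y t)) ^+ 2).
  by apply: has_derivV => //; rewrite gt_eqF.
apply: has_deriv_eq.
  apply: has_derivM; last exact: Hi.
  apply: has_deriv_comp; last exact: has_deriv_std_pdf.
  apply: has_derivM; last exact: Hi.
  by apply: has_derivB; first exact: HL; apply: has_derivM; [exact: Hy|exact: has_deriv_cst].
rewrite dkernelSS dkernel1 dkernel0 /bskernel /=.
set p := phi _.
have yE : y t = Num.sqrt (y t) ^+ 2 by rewrite sqr_sqrtr// ltW.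
rewrite yE; move: (Num.sqrt (y t)) s0 @p {Hs Hi yE} => s s0 p.
rewrite sqrtr_sqr gtr0_norm// in p *.
by field; rewrite gt_eqF.
Qed.

Lemma has_deriv_dkernel m L y t dL dy : has_deriv L t dL -> has_deriv y t dy -> 0 < y t ->
  has_deriv (fun u => dkernel m (L u) (y u)) t
    (dL * dkernel m.+1 (L t) (y t) +
     dy * (2^-1 * (dkernel m.+2 (L t) (y t) - dkernel m.+1 (L t) (y t)))).
Proof.
move=> HL Hy y0.
have yn0 : y t != 0 by rewrite gt_eqF.
have Hi := has_derivV yn0 Hy.
have Hs : has_deriv (fun u => L u - y u / 2) t (dL - (dy * 2^-1 + y t * 0)).
  by apply: has_derivB => //; apply: has_derivM => //; exact: has_deriv_cst.
(* The recurrence has three terms, so two consecutive orders go through the induction together. *)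
suff [] : has_deriv (fun u => dkernel m (L u) (y u)) t
    (dL * dkernel m.+1 (L t) (y t) +
     dy * (2^-1 * (dkernel m.+2 (L t) (y t) - dkernel m.+1 (L t) (y t)))) /\
  has_deriv (fun u => dkernel m.+1 (L u) (y u)) t
    (dL * dkernel m.+2 (L t) (y t) +
     dy * (2^-1 * (dkernel m.+3 (L t) (y t) - dkernel m.+2 (L t) (y t)))) by [].
elim: m => [|m [IH1 IH2]].
  have H0 := has_deriv_bskernel HL Hy y0; split; first exact: H0.
  apply: has_deriv_eq.
    apply: has_derivM; last exact: H0.
    by apply: has_derivN; apply: has_derivM; [exact: Hs|exact: Hi].
  by rewrite !dkernelSS dkernel1 dkernel0 /=; field.
split => //.
rewrite (_ : (fun u => dkernel m.+2 (L u) (y u)) = fun u =>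
  - ((L u - y u / 2) * dkernel m.+1 (L u) (y u) + m.+1%:R * dkernel m (L u) (y u)) * (y u)^-1)//.
apply: has_deriv_eq.
  apply: has_derivM; last exact: Hi.
  apply: has_derivN; apply: has_derivD.
    by apply: has_derivM; [exact: Hs|exact: IH2].
  by apply: has_derivM; [exact: has_deriv_cst|exact: IH1].
rewrite [dkernel m.+4 _ _]dkernelSS [dkernel m.+3 _ _]dkernelSS [dkernel m.+2 _ _]dkernelSS.
rewrite -!natr1 /=.
by field.
Qed.

End gauss_kernel.

(** * Mixed derivatives as polynomials in the log-derivative, and their bounds *)

Section bs_derivatives.
Context {R : realType}.
Notation phi := (@normal_pdf R 0 1).
Implicit Types (L y : R -> R) (t dL dy l v : R) (p q : {poly R}).

Definition dplus l v : R := (l + v / 2) / Num.sqrt v.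
Definition dminus l v : R := (l - v / 2) / Num.sqrt v.

(** d_+^2 - d_-^2 = 2 l. This cancels the density terms in the [l]-derivative of the put, and later
    trades phi(d_-) for phi(d_+) at the price of exp(l). *)
Lemma std_pdf_dminus l v : 0 < v -> phi (dminus l v) = expR l * phi (dplus l v).
Proof.
move=> v0; rewrite !std_pdfE mulrCA -expRD; congr (_ * expR _).
have vE : v = Num.sqrt v ^+ 2 by rewrite sqr_sqrtr// ltW.
have s0 : 0 < Num.sqrt v by rewrite sqrtr_gt0.
rewrite /dminus /dplus {1 3}vE; move: (Num.sqrt v) s0 => s s0.
by field; rewrite gt_eqF.
Qed.

(* Derivatives in [l] of the put price with unit strike. *)
Fixpoint dput (m : nat) l v : R :=
  match m with
  | 0%N => Phi (- dminus l v) - expR l * Phi (- dplus l v)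
  | m'.+1 => - (expR l * Phi (- dplus l v)) + \sum_(i < m') dkernel i l v
  end.

Lemma dputSS m l v : dput m.+2 l v = dput m.+1 l v + dkernel m l v.
Proof. by rewrite /= big_ord_recr /= addrA. Qed.

(** The [y]-part is the vega identity: in the variance the put moves by half the kernel. Only from
    order 1 on do consecutive [dput] differ by a kernel derivative, so orders 0 and 1 are computed
    directly and [dputSS] carries the rest. *)
Lemma has_deriv_dput m L y t dL dy : has_deriv L t dL -> has_deriv y t dy -> 0 < y t ->
  has_deriv (fun u => dput m (L u) (y u)) t
    (dL * dput m.+1 (L t) (y t) + dy * (2^-1 * dkernel m (L t) (y t))).
Proof.
move=> HL Hy y0; have s0 : 0 < Num.sqrt (y t) by rewrite sqrtr_gt0.
have Hs : has_deriv (fun u => Num.sqrt (y u)) t ((2 * Num.sqrt (y t))^-1 * dy).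
  by apply: has_deriv_comp => //; exact: has_deriv_sqrt.
have sn0 : Num.sqrt (y t) != 0 by rewrite gt_eqF.
have Hi : has_deriv (fun u => (Num.sqrt (y u))^-1) t
    (- ((2 * Num.sqrt (y t))^-1 * dy) / Num.sqrt (y t) ^+ 2) by exact: has_derivV.
have Hh : has_deriv (fun u => y u / 2) t (dy * 2^-1 + y t * 0).
  by apply: has_derivM => //; exact: has_deriv_cst.
have Hp : has_deriv (fun u => expR (L u) * Phi (- dplus (L u) (y u))) t
    (dL * (expR (L t) * Phi (- dplus (L t) (y t))) - dL * bskernel (L t) (y t)
     - dy * (2^-1 * dkernel 1 (L t) (y t))).
  apply: has_deriv_eq.
    apply: has_derivM; first by apply: has_deriv_comp; [exact: HL|exact: has_deriv_expR].
    apply: has_deriv_comp; last exact: has_deriv_Phi.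
    apply: has_derivN; apply: has_derivM; last exact: Hi.
    by apply: has_derivD; [exact: HL|exact: Hh].
  rewrite dkernel1 /bskernel -/(dminus (L t) (y t)) std_pdf_dminus//.
  rewrite [phi (- _)](_ : _ = phi (dplus (L t) (y t))); last by rewrite !std_pdfE sqrrN.
  move: (Phi _) (phi _) (expR _) => A B C.
  have yE : y t = Num.sqrt (y t) ^+ 2 by rewrite sqr_sqrtr// ltW.
  move: s0 yE; move: (Num.sqrt (y t)) => s s0 yE.
  by rewrite yE; field; rewrite gt_eqF.
have H0 : has_deriv (fun u => dput 0 (L u) (y u)) t
    (dL * dput 1 (L t) (y t) + dy * (2^-1 * dkernel 0 (L t) (y t))).
  apply: has_deriv_eq.
    apply: has_derivB; last exact: Hp.
    apply: has_deriv_comp; last exact: has_deriv_Phi.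
    apply: has_derivN; apply: has_derivM; last exact: Hi.
    by apply: has_derivB; [exact: HL|exact: Hh].
  rewrite [phi (- _)](_ : _ = phi (dminus (L t) (y t))); last by rewrite !std_pdfE sqrrN.
  rewrite /= big_ord0 addr0 dkernel1 dkernel0 /bskernel -/(dminus (L t) (y t)).
  move: (Phi _) (phi _) (expR _) => A B C.
  have yE : y t = Num.sqrt (y t) ^+ 2 by rewrite sqr_sqrtr// ltW.
  move: s0 yE; move: (Num.sqrt (y t)) => s s0 yE.
  by rewrite yE; field; rewrite gt_eqF.
have H1 : has_deriv (fun u => dput 1 (L u) (y u)) t
    (dL * dput 2 (L t) (y t) + dy * (2^-1 * dkernel 1 (L t) (y t))).
  rewrite (_ : (fun u => _) = (fun u => - (expR (L u) * Phi (- dplus (L u) (y u))))); last first.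
    by apply/funext => u; rewrite /= big_ord0 addr0.
  apply: has_deriv_eq; first exact: has_derivN Hp.
  by rewrite dputSS /= big_ord0 dkernel0; ring.
case: m => // m; elim: m => // m IH.
rewrite (_ : (fun u => _) = (fun u => dput m.+1 (L u) (y u) + dkernel m (L u) (y u))); last first.
  by apply/funext => u; rewrite dputSS.
apply: has_deriv_eq; first exact: has_derivD IH (has_deriv_dkernel m HL Hy y0).
by rewrite !dputSS; ring.
Qed.

(* [p] is read as a differential operator in the log-moneyness. *)
Definition dputP p l v : R := \sum_(i < size p) p`_i * dput i l v.
Definition dkernelP p l v : R := \sum_(i < size p) p`_i * dkernel i l v.

Lemma dputP_widen n p l v : (size p <= n)%N ->
  dputP p l v = \sum_(i < n) p`_i * dput i l v.
Proof.
move=> pn; rewrite /dputP (big_ord_widen n (fun i => p`_i * dput i l v))//.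
rewrite [RHS](bigID (fun i : 'I_n => (i < size p)%N)) /= [X in _ + X]big1 ?addr0// => i.
by rewrite -leqNgt => pi; rewrite nth_default// mul0r.
Qed.

Lemma dputPD p q l v : dputP (p + q) l v = dputP p l v + dputP q l v.
Proof.
pose n := maxn (size (p + q)) (maxn (size p) (size q)).
rewrite (@dputP_widen n (p + q)) ?leq_max ?leqnn// (@dputP_widen n p) ?leq_max ?leqnn ?orbT//.
rewrite (@dputP_widen n q) ?leq_max ?leqnn ?orbT// -big_split /=.
by apply: eq_bigr => i _; rewrite coefD mulrDl.
Qed.

Lemma dputPZ c p l v : dputP (c *: p) l v = c * dputP p l v.
Proof.
pose n := maxn (size (c *: p)) (size p).
rewrite (@dputP_widen n (c *: p)) ?leq_max ?leqnn// (@dputP_widen n p) ?leq_max ?leqnn ?orbT//.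
by rewrite big_distrr /=; apply: eq_bigr => i _; rewrite coefZ mulrA.
Qed.

Lemma dputP_mulX p l v : dputP ('X * p) l v = \sum_(i < size p) p`_i * dput i.+1 l v.
Proof.
rewrite (@dputP_widen (size p).+1); last first.
  by rewrite (leq_trans (size_polyMleq _ _))// size_polyX.
rewrite big_ord_recl coefXM /= mul0r add0r.
by apply: eq_bigr => i _; rewrite coefXM.
Qed.

(** D^2 - D removes the distribution functions from the put: the difference of [dput] at orders i +
    2 and i + 1 is [dkernel] at order i. *)
Lemma dputP_kernel p l v : dputP (('X^2 - 'X) * p) l v = dkernelP p l v.
Proof.
have -> : ('X^2 - 'X) * p = 'X * ('X * p) + (-1) *: ('X * p).
  by rewrite mulrBl expr2 mulrA scaleN1r.
rewrite dputPD dputPZ dputP_mulX (@dputP_mulX p).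
rewrite (_ : \sum_(i < size ('X * p)) _ = \sum_(i < (size p).+1) ('X * p)`_i * dput i.+1 l v); last first.
  pose n := (size p).+1; have pn : (size ('X * p)%R <= n)%N.
    by rewrite (leq_trans (size_polyMleq _ _))// size_polyX.
  rewrite (big_ord_widen n (fun i => ('X * p)`_i * dput i.+1 l v))//.
  rewrite [RHS](bigID (fun i : 'I_n => (i < size ('X * p)%R)%N)) /= [X in _ + X]big1 ?addr0// => i.
  by rewrite -leqNgt => pi; rewrite nth_default// mul0r.
rewrite big_ord_recl coefXM /= mul0r add0r mulN1r -sumrB.
apply: eq_bigr => i _; rewrite coefXM /bump leq0n add1n /= big_ord_recr /=.
by ring.
Qed.

Lemma has_deriv_dputP p L y t dL dy : has_deriv L t dL -> has_deriv y t dy -> 0 < y t ->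
  has_deriv (fun u => dputP p (L u) (y u)) t
    (dL * dputP ('X * p) (L t) (y t) +
     dy * dputP (2^-1 *: ('X^2 - 'X) * p) (L t) (y t)).
Proof.
move=> HL Hy y0.
apply: has_deriv_eq.
  apply: (@has_deriv_sum _ _ (fun i u => p`_i * dput i (L u) (y u))) => i _.
  by apply: has_derivM; [exact: has_deriv_cst|exact: (has_deriv_dput _ HL Hy y0)].
rewrite dputP_mulX -scalerAl dputPZ dputP_kernel /dkernelP !big_distrr /= -big_split /=.
by apply: eq_bigr => i _; ring.
Qed.

Variables (K T r : R).
Hypothesis K0 : 0 < K.

Definition logm (x : R) := ln (x / K) + r * T.

(* x^j D_x^j is the product of the D_L - i, i < j, and D_y is half of D_L^2 - D_L on the price. *)
Definition bs_poly (j k : nat) : {poly R} :=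
  (\prod_(i < j) ('X - i%:R%:P)) * (2^-1 *: ('X^2 - 'X)) ^+ k.

Definition bs_mixed (j k : nat) (x v : R) : R :=
  K * expR (- (r * T)) * (x ^- j * dputP (bs_poly j k) (logm x) v).

(** Differentiating x^(-j) p(D) in x gives x^(-j-1) (D - j) p(D), and in y multiplies p(D) by (D^2 -
    D)/2: the two recursions built into [bs_poly]. *)
Lemma has_deriv_bs_mixed j k (x y : R -> R) t dx dy : has_deriv x t dx -> has_deriv y t dy ->
  0 < x t -> 0 < y t ->
  has_deriv (fun u => bs_mixed j k (x u) (y u)) t
    (dx * bs_mixed j.+1 k (x t) (y t) + dy * bs_mixed j k.+1 (x t) (y t)).
Proof.
move=> Hx Hy x0 y0.
have HL : has_deriv (fun u => logm (x u)) t (dx / x t).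
  apply: has_deriv_eq.
    apply: has_derivD; last exact: has_deriv_cst.
    apply: has_deriv_comp; last by apply: has_deriv_ln; rewrite divr_gt0.
    by apply: has_derivM; [exact: Hx|exact: has_deriv_cst].
  by rewrite /=; field; rewrite !gt_eqF.
have Hj : has_deriv (fun u => (x u) ^- j) t (- (j%:R * dx * x t ^- j.+1)).
  apply: has_deriv_eq.
    apply: has_derivV; first by rewrite expf_neq0// gt_eqF.
    exact: has_derivX Hx.
  case: j => [|j]; first by rewrite !mul0r oppr0 mul0r.
  by rewrite /= !exprS; field; rewrite expf_neq0 gt_eqF.
apply: has_deriv_eq.
  apply: has_derivM; first exact: has_deriv_cst.
  by apply: has_derivM; [exact: Hj|exact: has_deriv_dputP HL Hy y0].
rewrite /bs_mixed /=.
have -> : bs_poly j.+1 k = 'X * bs_poly j k + (- j%:R) *: bs_poly j k.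
  rewrite /bs_poly big_ord_recr /= scaleNr -(mul_polyC j%:R) -mulrBl.
  by rewrite mulrAC [RHS]mulrC.
have -> : bs_poly j k.+1 = 2^-1 *: ('X^2 - 'X) * bs_poly j k.
  by rewrite /bs_poly exprS mulrCA.
rewrite dputPD dputPZ.
have -> : x t ^- j.+1 = x t ^- j / x t by rewrite exprSr invfM.
by ring.
Qed.

Lemma BS_put_bs_mixed x v : 0 < x -> 0 < v -> BS_put K T r x v = bs_mixed 0 0 x v.
Proof.
move=> x0 v0; rewrite /bs_mixed /bs_poly big_ord0 !expr0 mulr1 invr1 mul1r.
rewrite /dputP size_poly1 big_ord1 coef1 mul1r /BS_put /= mulrBr mulrA.
have -> : K * expR (- (r * T)) * expR (logm x) = x.
  rewrite -mulrA -expRD /logm addrCA addNr addr0 lnK ?posrE ?divr_gt0//.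
  by rewrite mulrCA divff ?mulr1// gt_eqF.
by rewrite /BS_d /dminus /dplus mulN1r mul1r.
Qed.

(** The closed form holds on the open quadrant, so each further derivative is obtained from
    agreement in a neighbourhood, through [derive1_near]. *)
Lemma BS_put_partial_pos j k x v : 0 < x -> 0 < v ->
  BS_put_partial K T r j k x v = bs_mixed j k x v.
Proof.
move=> x0 v0; rewrite /BS_put_partial.
have Hk x' v' : 0 < x' -> 0 < v' ->
    derive1n k (fun w => BS_put K T r x' w) v' = bs_mixed 0 k x' v'.
  move=> x'0; elim: k v' => [|k IH] v' v'0; first by rewrite derive1n0 BS_put_bs_mixed.
  rewrite derive1nS; apply: (@derive1_near _ _ (bs_mixed 0 k x')).
    by near=> w; apply: IH; near: w; exact: lt_nbhsr.
  apply: has_deriv_eq.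
    exact: (has_deriv_bs_mixed 0 k (has_deriv_cst x' v') (has_deriv_id v')).
  by rewrite mul0r add0r mul1r.
elim: j x x0 => [|j IH] x x0; first by rewrite derive1n0 Hk.
rewrite derive1nS; apply: (@derive1_near _ _ (fun w => bs_mixed j k w v)).
  by near=> w; apply: IH; near: w; exact: lt_nbhsr.
apply: has_deriv_eq.
  exact: (has_deriv_bs_mixed j k (has_deriv_id x) (has_deriv_cst v x)).
by rewrite mul1r mul0r addr0.
Unshelve. all: by end_near. Qed.

(* For negative variance the square root is 0, so [BS_put] is affine in [x] and constant in [v]. *)
Lemma BS_put_partial_neg j k x v : (2 <= j + k)%N -> v < 0 ->
  BS_put_partial K T r j k x v = 0.
Proof.
move=> jk v0; rewrite /BS_put_partial.
have HB x' v' : v' < 0 -> BS_put K T r x' v' = K * expR (- (r * T)) * Phi 0 - x' * Phi 0.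
  by move=> v'0; rewrite /BS_put /BS_d ler0_sqrtr ?ltW// invr0 !mulr0 oppr0.
have Hk x' v' : v' < 0 ->
    derive1n k (fun w => BS_put K T r x' w) v' =
    if k is 0 then K * expR (- (r * T)) * Phi 0 - x' * Phi 0 else 0.
  elim: k {jk} v' => [|k IH] v' v'0; first by rewrite derive1n0 HB.
  rewrite derive1nS; apply: (@derive1_near _ _
    (fun=> if k is 0 then K * expR (- (r * T)) * Phi 0 - x' * Phi 0 else 0)).
    by near=> w; apply: IH; near: w; exact: lt_nbhsl.
  exact: has_deriv_cst.
under eq_fun do rewrite Hk//.
case: k jk {Hk} => [|k] jk.
  rewrite addn0 in jk; case: j jk => [//|[//|j]] _.
  have H1 : derive1 (fun x' => K * expR (- (r * T)) * Phi 0 - x' * Phi 0) = (fun=> - Phi 0).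
    apply/funext => w; apply: (@derive1_near _ _ (fun x' => K * expR (- (r * T)) * Phi 0 - x' * Phi 0)).
      by near=> z.
    apply: has_deriv_eq.
      apply: has_derivB; first exact: has_deriv_cst.
      by apply: has_derivM; [exact: has_deriv_id|exact: has_deriv_cst].
    by rewrite mul1r mulr0 addr0 sub0r.
  have H2 c : derive1 (fun=> c : R) = (fun=> 0).
    apply/funext => w; apply: (@derive1_near _ _ (fun=> c)); first by near=> z.
    exact: has_deriv_cst.
  rewrite /derive1n iterSr H1 iterSr H2.
  by elim: j => // j IH; rewrite iterSr H2.
elim: j {jk} x => // j IH x; rewrite derive1nS.
apply: (@derive1_near _ _ (fun=> 0)); last exact: has_deriv_cst.
by near=> w; exact: IH.
Unshelve. all: by end_near. Qed.

(** The power is at most exp(m (2 + c |z|)), and m c |z| - z^2/2 <= (m c)^2/2 by completing the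
    square; hence the constant. *)
Lemma std_pdf_poly_bound (c : R) (m : nat) : 0 <= c ->
  exists2 C : R, 0 <= C & forall z, (2 + c * `|z|) ^+ m * phi z <= C.
Proof.
move=> c0; exists ((Num.sqrt (2 * pi))^-1 * expR (m%:R * 2 + (m%:R * c) ^+ 2 / 2)).
  by rewrite mulr_ge0 ?expR_ge0 ?invr_ge0.
move=> z; rewrite std_pdfE mulrCA ler_wpM2l ?invr_ge0//.
have h : (2 + c * `|z|) ^+ m <= expR (m%:R * (2 + c * `|z|)).
  rewrite expRM_natl lerXn2r ?nnegrE ?expR_ge0 ?addr_ge0 ?mulr_ge0//.
  by apply: le_trans (expR_ge1Dx _); rewrite lerDr.
apply: le_trans (ler_wpM2r (expR_ge0 _) h) _.
rewrite -expRD ler_expR -(real_normK (num_real z)).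
have : 0 <= (`|z| - m%:R * c) ^+ 2 by exact: sqr_ge0.
by move: (`|z|) (m%:R) => a n; nra.
Qed.

Lemma bskernel_ge0 l v : 0 <= bskernel l v.
Proof. by rewrite /bskernel mulr_ge0 ?normal_pdf_ge0 ?invr_ge0. Qed.

(** A step of the recurrence multiplies by (l - v/2)/v or by (m+1)/v, the latter at most (m+1)/[v0];
    the degree in the former grows by at most one per step. *)
Lemma dkernel_le_bskernel (v0 : R) m : 0 < v0 ->
  exists2 A : R, 0 <= A & forall l v, v0 <= v ->
    `|dkernel m l v| <= A * (1 + `|(l - v / 2) / v|) ^+ m * bskernel l v.
Proof.
move=> v00.
pose Q m := exists2 A : R, 0 <= A & forall l v, v0 <= v ->
    `|dkernel m l v| <= A * (1 + `|(l - v / 2) / v|) ^+ m * bskernel l v.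
suff [] : Q m /\ Q m.+1 by [].
elim: m => [|m [[A0 A00 H0] [A1 A10 H1]]].
  split; exists 1 => // l v vv.
    by rewrite expr0 dkernel0 !mul1r ger0_norm ?bskernel_ge0.
  rewrite expr1 dkernel1 mul1r normrM normrN (ger0_norm (bskernel_ge0 _ _)).
  by rewrite ler_wpM2r ?bskernel_ge0// lerDr.
split; first by exists A1.
exists (A1 + m.+1%:R / v0 * A0); first by rewrite addr_ge0// mulr_ge0// divr_ge0// ltW.
move=> l v vv; have v_gt0 : 0 < v by exact: lt_le_trans vv.
rewrite dkernelSS mulNr normrN mulrDl
  [X in `|X + _|](_ : _ = (l - v / 2) / v * dkernel m.+1 l v); last by ring.
rewrite [X in `|_ + X|](_ : _ = m.+1%:R / v * dkernel m l v); last by ring.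
apply: le_trans (ler_normD _ _) _; rewrite !normrM.
have := H0 l v vv; have := H1 l v vv.
set a := `|(l - v / 2)| * _; have -> : `|(l - v / 2) / v| = a by rewrite /a normrM.
have a0 : 0 <= a by rewrite mulr_ge0.
set g := bskernel l v; have g0 : 0 <= g by exact: bskernel_ge0.
move=> h1 h0.
have e1 : 1 <= 1 + a by rewrite lerDl.
apply: (@le_trans _ _ (a * (A1 * (1 + a) ^+ m.+1 * g) + m.+1%:R / v0 * (A0 * (1 + a) ^+ m * g))).
  apply: lerD; first exact: ler_wpM2l.
  apply: ler_pM => //; rewrite ?mulr_ge0// normr_nat normfV gtr0_norm//.
  by rewrite ler_wpM2l// lef_pV2.
have p0 : 0 <= (1 + a) ^+ m by rewrite exprn_ge0// addr_ge0.
have pS : (1 + a) ^+ m <= (1 + a) ^+ m.+2.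
  by rewrite ler_weXn2l// ltnW.
rewrite !mulrDl; apply: lerD.
  rewrite [(1 + a) ^+ m.+2]exprS [leRHS](_ : _ = (1 + a) * (A1 * (1 + a) ^+ m.+1 * g)); last by ring.
  apply: ler_wpM2r; last by rewrite lerDr.
  by apply: mulr_ge0 => //; apply: mulr_ge0 => //; apply: exprn_ge0; apply: addr_ge0.
move: ((1 + a) ^+ m) ((1 + a) ^+ m.+2) pS => q1 q2 q12.
rewrite [leLHS](_ : _ = m.+1%:R / v0 * A0 * g * q1); last by ring.
rewrite [leRHS](_ : _ = m.+1%:R / v0 * A0 * g * q2); last by ring.
have iv0 : 0 <= v0^-1 by rewrite invr_ge0 ltW.
by apply: ler_wpM2l => //; apply: mulr_ge0; [rewrite !mulr_ge0|exact: g0].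
Qed.

(** (l - v/2)/v is d_-/sqrt v and also d_+/sqrt v - 1. The first form against phi(d_-) gives the
    constant bound; the second against exp(l) phi(d_+) gives the bound with exp(l), its extra 1
    being the reason for the 2 in [std_pdf_poly_bound]. *)
Lemma dkernel_bound (v0 : R) m : 0 < v0 ->
  exists2 C : R, 0 <= C & forall l v, v0 <= v ->
    `|dkernel m l v| <= C /\ `|dkernel m l v| <= C * expR l.
Proof.
move=> v00; have [A A0 HA] := dkernel_le_bskernel m v00.
pose c := (Num.sqrt v0)^-1.
have c0 : 0 <= c by rewrite invr_ge0.
have [B B0 HB] := std_pdf_poly_bound m c0.
exists (A * (B * c)); first by rewrite !mulr_ge0.
move=> l v vv; have v_gt0 : 0 < v by exact: lt_le_trans vv.
have s0 : 0 < Num.sqrt v by rewrite sqrtr_gt0.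
have sc : (Num.sqrt v)^-1 <= c by rewrite lef_pV2 ?posrE ?sqrtr_gt0// ler_wsqrtr.
have vE : v = Num.sqrt v ^+ 2 by rewrite sqr_sqrtr// ltW.
have key (z q : R) : 0 <= q -> `|(l - v / 2) / v| <= 1 + c * `|z| ->
    A * (1 + `|(l - v / 2) / v|) ^+ m * (q * phi z / Num.sqrt v) <= A * (B * c) * q.
  move=> q0 hz; rewrite -!mulrA ler_wpM2l//.
  rewrite [leRHS](_ : _ = q * (B * c)); last by ring.
  rewrite mulrCA ler_wpM2l// mulrA; apply: ler_pM => //.
  - by rewrite mulr_ge0 ?normal_pdf_ge0// exprn_ge0// addr_ge0.
  - apply: le_trans (HB z); rewrite ler_wpM2r ?normal_pdf_ge0//.
    by rewrite lerXn2r ?nnegrE ?addr_ge0 ?mulr_ge0//; lra.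
split; apply: le_trans (HA l v vv) _.
  rewrite -[leRHS]mulr1 /bskernel -/(dminus l v) -[phi _]mul1r; apply: key => //.
  have -> : (l - v / 2) / v = dminus l v * (Num.sqrt v)^-1.
    by rewrite /dminus -mulrA -invfM -expr2 -vE.
  rewrite normrM normfV (gtr0_norm s0) mulrC.
  apply: (@le_trans _ _ (c * `|dminus l v|)); first by rewrite ler_wpM2r.
  by rewrite lerDr.
rewrite /bskernel -/(dminus l v) std_pdf_dminus//; apply: key; first exact: expR_ge0.
have -> : (l - v / 2) / v = dplus l v * (Num.sqrt v)^-1 - 1.
  rewrite /dplus -mulrA -invfM -expr2 -vE mulrBl mulrDl.
  by field; rewrite gt_eqF.
apply: le_trans (ler_normB _ _) _; rewrite normr1 addrC lerD2l normrM normfV (gtr0_norm s0) mulrC.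
by rewrite ler_wpM2r.
Qed.

Lemma dkernelP_bound (v0 : R) p : 0 < v0 ->
  exists2 C : R, 0 <= C & forall l v, v0 <= v ->
    `|dkernelP p l v| <= C /\ `|dkernelP p l v| <= C * expR l.
Proof.
move=> v00; rewrite /dkernelP; elim: (size p) => [|n [C C0 HC]].
  by exists 0 => // l v _; rewrite big_ord0 normr0 mul0r.
have [D D0 HD] := dkernel_bound n v00.
exists (C + `|p`_n| * D); first by rewrite addr_ge0 ?mulr_ge0.
move=> l v vv; have [h1 h2] := HC l v vv; have [h3 h4] := HD l v vv.
rewrite big_ord_recr /=; split; apply: le_trans (ler_normD _ _) _.
  by apply: lerD => //; rewrite normrM ler_wpM2l.
by rewrite mulrDl; apply: lerD => //; rewrite normrM -mulrA ler_wpM2l.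
Qed.

(** For k > 0 a variance derivative contributes a multiple of D^2 - D; for k = 0, [j] is at least 2
    and the product contains D (D - 1). The delta, j = 1 and k = 0, has no such factor. *)
Lemma bs_poly_factor j k : (2 <= j + k)%N -> exists p, bs_poly j k = ('X^2 - 'X) * p.
Proof.
case: k => [|k] jk.
  rewrite addn0 in jk; case: j jk => [//|[//|j]] _.
  exists (\prod_(i < j) ('X - i.+2%:R%:P)).
  rewrite /bs_poly expr0 mulr1 !big_ord_recl /= subr0 mulrA; congr (_ * _).
  by rewrite /bump /= mulrBr mulr1 expr2.
exists ((\prod_(i < j) ('X - i%:R%:P)) * (2^-1 *: (2^-1 *: ('X^2 - 'X)) ^+ k)).
by rewrite /bs_poly exprS -!mul_polyC; ring.
Qed.

(** Since K exp(-rT) exp(l) = x, the bound with exp(l) gains one power of x when j > 0; for j = 0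
    the constant bound serves, and [j.-1] covers both. *)
Lemma bs_mixed_bound (v0 : R) j k : 0 < v0 -> (2 <= j + k)%N ->
  exists2 C : R, 0 <= C & forall (x v : R), 0 < x -> v0 <= v ->
    `|bs_mixed j k x v| <= C * x ^- j.-1.
Proof.
move=> v00 /bs_poly_factor[p pE].
have [C C0 HC] := dkernelP_bound p v00.
pose D := K * expR (- (r * T)); have D0 : 0 < D by rewrite mulr_gt0 ?expR_gt0.
(* The summand [D] is spent when j = 0, the summand 1 when j > 0. *)
exists (C * (D + 1)); first by rewrite mulr_ge0// addr_ge0// ltW.
move=> x v x0 vv; rewrite /bs_mixed -/D pE dputP_kernel.
have [h1 h2] := HC (logm x) v vv.
have xj n : 0 <= x ^- n by rewrite invr_ge0 exprn_ge0// ltW.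
rewrite normrM [X in _ * X]normrM (gtr0_norm D0) (ger0_norm (xj j)).
case: j {pE} => [|j] /=.
  rewrite expr0 invr1 mul1r mulr1 mulrC.
  by apply: ler_pM => //; [exact: ltW|rewrite lerDl].
have eD : D * expR (logm x) = x.
  rewrite /D -mulrA -expRD /logm addrCA addNr addr0 lnK ?posrE ?divr_gt0//.
  by rewrite mulrCA divff ?mulr1// gt_eqF.
have -> : D * (x ^- j.+1 * `|dkernelP p (logm x) v|) = x ^- j.+1 * (D * `|dkernelP p (logm x) v|) by ring.
apply: (@le_trans _ _ (x ^- j.+1 * (D * (C * expR (logm x))))).
  by rewrite !ler_wpM2l// ltW.
rewrite [D * (C * _)]mulrCA eD.
have -> : x ^- j.+1 * (C * x) = C * x ^- j.
  by rewrite exprSr invfM; move: (x ^- j) => z; field; rewrite gt_eqF.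
by rewrite ler_wpM2r// ler_peMr// lerDr ltW.
Qed.

Definition segment_deriv (x0 v0 a b : R) (n : nat) (u : R) : R :=
  \sum_(k < n.+1) 'C(n, k)%:R * a ^+ (n - k) * b ^+ k *
    bs_mixed (n - k) k (x0 + u * a) (v0 + u * b).

(** The chain rule raises one of the two indices by one; regrouping by powers of [b] is Pascal's
    rule. *)
Lemma has_deriv_segment (x0 v0 a b : R) n u : 0 < x0 + u * a -> 0 < v0 + u * b ->
  has_deriv (segment_deriv x0 v0 a b n) u (segment_deriv x0 v0 a b n.+1 u).
Proof.
move=> hx hv.
have aff c e : has_deriv (fun w => c + w * e) u e.
  apply: has_deriv_eq.
    apply: has_derivD; first exact: has_deriv_cst.
    by apply: has_derivM; [exact: has_deriv_id|exact: has_deriv_cst].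
  by rewrite /=; ring.
pose B j k := bs_mixed j k (x0 + u * a) (v0 + u * b).
apply: has_deriv_eq.
  apply: (@has_deriv_sum _ _ (fun k w => 'C(n, k)%:R * a ^+ (n - k) * b ^+ k *
    bs_mixed (n - k) k (x0 + w * a) (v0 + w * b))) => k _.
  apply: has_derivM; first exact: has_deriv_cst.
  exact: (has_deriv_bs_mixed (n - k) k (aff x0 a) (aff v0 b) hx hv).
rewrite /segment_deriv -/B /=.
transitivity (\sum_(k < n.+1) 'C(n, k)%:R * (a ^+ (n.+1 - k) * b ^+ k * B (n.+1 - k)%N k) +
    \sum_(k < n.+1) 'C(n, k)%:R * (a ^+ (n - k) * b ^+ k.+1 * B (n - k)%N k.+1)).
  rewrite -big_split /=; apply: eq_bigr => k _.
  have kn : (k <= n)%N by rewrite -ltnS.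
  by rewrite /B subSn// !exprS; ring.
rewrite [RHS]big_ord_recl [X in X + _ = _]big_ord_recl !bin0 !subn0 -addrA.
rewrite /B mulrA; congr (_ + _); first by rewrite mulrA.
transitivity (\sum_(i < n.+1) ('C(n, i.+1)%:R * (a ^+ (n - i) * b ^+ i.+1 * B (n - i)%N i.+1) +
    'C(n, i)%:R * (a ^+ (n - i) * b ^+ i.+1 * B (n - i)%N i.+1))); last first.
  by apply: eq_bigr => i _; rewrite !lift0 binS subSS natrD /B; ring.
rewrite big_split /=; congr (_ + _).
rewrite [RHS]big_ord_recr /= bin_small// mul0r addr0.
by apply: eq_bigr => i _; rewrite [bump 0 i](_ : _ = i.+1)// subSS.
Qed.

Lemma BS_put_taylor (x0 v0 x v : R) (N : nat) :
  0 < x0 -> 0 < v0 -> 0 < x -> 0 < v ->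
  (\int[lebesgue_measure]_(u in `[0%R, 1%R])
      ((1 - u) ^+ N * segment_deriv x0 v0 (x - x0) (v - v0) N.+1 u)%:E =
   (N`!%:R * (BS_put K T r x v -
      \sum_(n < N.+1) segment_deriv x0 v0 (x - x0) (v - v0) n 0 / n`!%:R))%:E)%E.
Proof.
move=> x00 v00 xp vp.
have pos (c e u : R) : 0 < c -> 0 < e -> 0 <= u <= 1 -> 0 < c + u * (e - c).
  by move=> c0 e0 /andP[u0 u1]; nra.
rewrite taylor_integral_remainder; last first.
  by move=> n u _ u01; apply: has_deriv_segment; exact: pos.
congr (_ * (_ - _))%:E.
by rewrite /segment_deriv big_ord1 bin0 !expr0 !mul1r subnn BS_put_bs_mixed//; congr (bs_mixed _ _ _ _); ring.
Qed.

End bs_derivatives.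

(** * Paths of the variance process *)

Section stieltjes_sums.
Context {R : realType}.
Implicit Types (g f : R -> R) (L B dt t : R) (m n b c : nat).

Lemma le_of_eq (x y : R) : x = y -> x <= y.
Proof. by move=> ->. Qed.

(** Mesh and number of cells are independent, so that dyadic grids of different intervals can be
    compared through a common refinement. *)
Definition grid_sum g f dt n : R :=
  \sum_(0 <= i < n) g (i%:R * dt) * (f (i.+1%:R * dt) - f (i%:R * dt)).

Definition lipschitz_on L B g : Prop :=
  forall x y, 0 <= x <= B -> 0 <= y <= B -> `|g x - g y| <= L * `|x - y|.

Definition nondecreasing_pos f : Prop := forall x y, 0 <= x -> x <= y -> f x <= f y.

Lemma grid_mono dt m n : 0 <= dt -> (m <= n)%N -> m%:R * dt <= n%:R * dt.
Proof. by move=> dt0 mn; rewrite ler_wpM2r// ler_nat. Qed.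

Lemma grid_block g f L B dt m n : lipschitz_on L B g -> nondecreasing_pos f ->
  0 <= L -> 0 <= dt -> (m <= n)%N -> n%:R * dt <= B ->
  `|g (m%:R * dt) * (f (n%:R * dt) - f (m%:R * dt)) -
    \sum_(m <= i < n) g (i%:R * dt) * (f (i.+1%:R * dt) - f (i%:R * dt))| <=
  L * ((n - m)%:R * dt) * (f (n%:R * dt) - f (m%:R * dt)).
Proof.
move=> gL fN L0 dt0 mn nB.
have p0 k : 0 <= k%:R * dt by rewrite mulr_ge0.
have step i : 0 <= f (i.+1%:R * dt) - f (i%:R * dt).
  by rewrite subr_ge0; apply: fN => //; exact: grid_mono.
have tel : f (n%:R * dt) - f (m%:R * dt) = \sum_(m <= i < n) (f (i.+1%:R * dt) - f (i%:R * dt)).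
  by rewrite telescope_sumr.
rewrite tel !big_distrr /= -sumrB.
apply: le_trans (ler_norm_sum _ _ _) _.
apply: ler_sum_nat => i /andP[mi ni].
rewrite -mulrBl normrM (ger0_norm (step i)) ler_wpM2r//.
apply: le_trans (gL _ _ _ _) _.
- by rewrite p0 (le_trans _ nB)// grid_mono.
- by rewrite p0 (le_trans _ nB)// grid_mono// ltnW.
rewrite ler_wpM2l// -mulrBl normrM (ger0_norm dt0) ler_wpM2r//.
rewrite distrC -natrB// normr_nat ler_nat leq_sub2r//; exact: ltnW.
Qed.

(** Merging blocks of [b] cells moves the argument of [g] by at most the coarse mesh; weighted by
    the increments of the monotone [f], this costs L times the mesh times the total increment. *)
Lemma grid_refine g f L B dt b c : lipschitz_on L B g -> nondecreasing_pos f ->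
  0 <= L -> 0 <= dt -> (c * b)%:R * dt <= B ->
  `|grid_sum g f (b%:R * dt) c - grid_sum g f dt (c * b)| <=
  L * (b%:R * dt) * (f ((c * b)%:R * dt) - f 0).
Proof.
move=> gL fN L0 dt0; elim: c => [|c IH] cB.
  by rewrite /grid_sum mul0n !big_nil mul0r subrr normr0 subrr mulr0.
have cbB : (c * b)%:R * dt <= B.
  by apply: le_trans cB; apply: grid_mono => //; rewrite leq_mul2r leqnSn orbT.
have {}IH := IH cbB.
rewrite /grid_sum big_nat_recr//= -/(grid_sum g f (b%:R * dt) c).
rewrite mulSnr (@big_cat_nat _ _ _ (c * b)%N)//= ?leq_addr// -/(grid_sum g f dt (c * b)).
have E k : k%:R * (b%:R * dt) = (k * b)%:R * dt by rewrite natrM mulrA.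
rewrite !E mulSnr opprD addrACA.
apply: le_trans (ler_normD _ _) _.
have blk := @grid_block g f L B dt (c * b) (c * b + b) gL fN L0 dt0 (leq_addr _ _).
rewrite -mulSnr in blk; have {}blk := blk cB; rewrite mulSnr addKn in blk.
apply: le_trans (lerD IH blk) _.
by rewrite -mulrDr addrC addrA subrK.
Qed.

Lemma cvg_of_geometric (u : nat -> R) (C : R) : 0 <= C ->
  (forall n m, (n <= m)%N -> `|u n - u m| <= C / 2 ^+ n) ->
  exists2 l, u @ \oo --> l & forall n, `|u n - l| <= C / 2 ^+ n.
Proof.
move=> C0 H.
have c0 : (fun n => C / 2 ^+ n) @ \oo --> (0 : R).
  have : (fun n => C * 2^-1 ^+ n) @ \oo --> C * 0.
    by apply: cvgMr; apply: cvg_expr; rewrite ger0_norm ?invr_ge0// invf_lt1 ?ltr1n.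
  by rewrite mulr0; under eq_fun do rewrite exprVn.
have cu : cvg (u @ \oo).
  apply/cauchy_cvgP/cauchy_exP => e e0.
  have /cvgrPdist_lt/(_ e e0)[n _ Hn] := c0.
  exists (u n); exists n => // m /= nm; rewrite /ball /=.
  apply: le_lt_trans (H _ _ nm) _.
  by have := Hn n (leqnn n); rewrite sub0r normrN ger0_norm ?divr_ge0 ?exprn_ge0.
exists (limn u) => // n.
have un : (fun m => `|u n - u m|) @ \oo --> `|u n - limn u|.
  by apply: cvg_norm; apply: cvgB => //; exact: cvg_cst.
rewrite -(cvg_lim _ un)//; apply: limr_le; first by apply/cvg_ex; eexists; exact: un.
by exists n => // m /= nm; exact: H.
Qed.

(** Turns the [limn] inside [stieltjes_int] into a genuine limit, with an error linear in the
    mesh. *)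
Lemma stieltjes_int_rate g f L t : lipschitz_on L t g -> nondecreasing_pos f ->
  0 <= L -> 0 <= t ->
  (fun n => grid_sum g f (t / 2 ^+ n) (2 ^ n)) @ \oo --> stieltjes_int g f 0 t /\
  forall n, `|grid_sum g f (t / 2 ^+ n) (2 ^ n) - stieltjes_int g f 0 t| <=
    L * t * (f t - f 0) / 2 ^+ n.
Proof.
move=> gL fN L0 t0.
have dtE (n : nat) : (2 ^ n)%:R * (t / 2 ^+ n) = t.
  by rewrite natrX mulrCA divff ?mulr1// expf_neq0.
have [||l ul lr] := @cvg_of_geometric (fun n => grid_sum g f (t / 2 ^+ n) (2 ^ n)) (L * t * (f t - f 0)).
- by rewrite !mulr_ge0// subr_ge0; exact: fN.
- move=> n m nm.
  have bE : t / 2 ^+ n = (2 ^ (m - n))%:R * (t / 2 ^+ m).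
    rewrite natrX -[in 2 ^+ m](subnK nm) exprD.
    have a0 : 2 ^+ (m - n) != 0 :> R by rewrite expf_neq0.
    have b0 : 2 ^+ n != 0 :> R by rewrite expf_neq0.
    by move: (2 ^+ (m - n)) (2 ^+ n) a0 b0 => a b a0 b0; field; rewrite a0 b0.
  have nmE : (2 ^ n * 2 ^ (m - n))%N = (2 ^ m)%N by rewrite -expnD subnKC.
  have := @grid_refine g f L t (t / 2 ^+ m) (2 ^ (m - n)) (2 ^ n) gL fN L0.
  rewrite nmE dtE -bE => /(_ _ (lexx _)); rewrite divr_ge0 ?exprn_ge0// => /(_ isT).
  by rewrite mulrA mulrAC.
suff E : stieltjes_int g f 0 t = l by rewrite E; split.
rewrite /stieltjes_int -(cvg_lim _ ul)//; congr (lim (_ @ \oo)).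
apply/funext => n; rewrite /grid_sum big_mkord; apply: eq_bigr => i _.
by rewrite /dyadic_pt !add0r subr0 !mulrA.
Qed.

Lemma expR_lipschitz (c a b : R) : a <= c -> b <= c ->
  `|expR a - expR b| <= expR c * `|a - b|.
Proof.
wlog ab : a b / b <= a.
  move=> H ac bc; have [ba|/ltW ab] := leP b a; first exact: H.
  by rewrite distrC (distrC a); exact: H.
move=> ac bc; rewrite !ger0_norm ?subr_ge0 ?ler_expR//.
apply: (@le_trans _ _ (expR a * (a - b))); last by rewrite ler_wpM2r ?subr_ge0 ?ler_expR.
have := expR_ge1Dx (b - a); rewrite -(ler_pM2l (expR_gt0 a)) -expRD.
by rewrite [a + _]addrC subrK; nra.
Qed.

Variables (lam T sig0sq : R) (f : R -> R).
Hypotheses (lam0 : 0 < lam) (T0 : 0 < T) (sig0 : 0 < sig0sq) (fN : nondecreasing_pos f).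

Let Lexp := expR (lam * T) * lam.

Lemma Lexp_ge0 : 0 <= Lexp. Proof. by rewrite mulr_ge0 ?expR_ge0// ltW. Qed.

Lemma lipschitz_expR B : B <= T -> lipschitz_on Lexp B (fun s => expR (lam * s)).
Proof.
move=> BT x y /andP[x0 xB] /andP[y0 yB].
apply: le_trans (@expR_lipschitz (lam * T) _ _ _ _) _.
- by rewrite ler_wpM2l ?(ltW lam0)// (le_trans xB).
- by rewrite ler_wpM2l ?(ltW lam0)// (le_trans yB).
by rewrite -mulrBr normrM (gtr0_norm lam0) mulrA.
Qed.

Lemma lipschitz_alpha : lipschitz_on 1 T (fun s => alpha lam s T).
Proof.
move=> x y /andP[x0 xB] /andP[y0 yB].
rewrite /alpha -mulrBl opprB addrCA addrAC subrr add0r normrM normfV (gtr0_norm lam0) mul1r.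
rewrite ler_pdivrMr//.
apply: le_trans (@expR_lipschitz 0 _ _ _ _) _.
- by rewrite oppr_le0 mulr_ge0 ?subr_ge0// ltW.
- by rewrite oppr_le0 mulr_ge0 ?subr_ge0// ltW.
rewrite expR0 mul1r [X in `|X|](_ : _ = (y - x) * lam); last by ring.
by rewrite normrM (distrC x) (gtr0_norm lam0).
Qed.

Definition path_var (t : R) : R :=
  expR (- (lam * t)) * (sig0sq + stieltjes_int (fun s => expR (lam * s)) f 0 t).

Definition path_intvar : R :=
  sig0sq * alpha lam 0 T + stieltjes_int (fun s => alpha lam s T) f 0 T.

Lemma grid_sum_ge0 g dt n : 0 <= dt -> (forall i, (i < n)%N -> 0 <= g (i%:R * dt)) ->
  0 <= grid_sum g f dt n.
Proof.
move=> dt0 g0; rewrite /grid_sum big_nat_cond; apply: sumr_ge0 => i /andP[/andP[_ i_n] _].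
rewrite mulr_ge0 ?g0// subr_ge0; apply: fN; first by rewrite mulr_ge0.
exact: grid_mono.
Qed.

Lemma stieltjes_int_ge0 g L t : lipschitz_on L t g -> 0 <= L -> 0 <= t ->
  (forall s, 0 <= s <= t -> 0 <= g s) -> 0 <= stieltjes_int g f 0 t.
Proof.
move=> gL L0 t0 g0; have [cv _] := stieltjes_int_rate gL fN L0 t0.
rewrite -(cvg_lim _ cv)//; apply: limr_ge; first by apply/cvg_ex; eexists; exact: cv.
near=> n; apply: grid_sum_ge0; first by rewrite divr_ge0 ?exprn_ge0.
move=> i i_n; apply: g0; rewrite mulr_ge0 ?divr_ge0 ?exprn_ge0//=.
rewrite mulrCA ler_piMr// ler_pdivrMr ?exprn_gt0// mul1r -natrX ler_nat; exact: ltnW.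
Unshelve. all: by end_near. Qed.

Lemma path_intvar_ge : sig0sq * alpha lam 0 T <= path_intvar.
Proof.
rewrite /path_intvar lerDl; apply: (stieltjes_int_ge0 lipschitz_alpha) => //; first exact: ltW.
move=> s /andP[s0 sT]; rewrite /alpha divr_ge0 ?(ltW lam0)// subr_ge0 -[leRHS]expR0 ler_expR.
by rewrite oppr_le0 mulr_ge0 ?subr_ge0// ltW.
Qed.

Lemma path_var_ge0 t : 0 <= t <= T -> 0 <= path_var t.
Proof.
move=> /andP[t0 tT]; rewrite /path_var mulr_ge0 ?expR_ge0// addr_ge0 ?(ltW sig0)//.
apply: (stieltjes_int_ge0 (lipschitz_expR tT)) => //; exact: Lexp_ge0.
Qed.

Section level.
Variable n : nat.
Let dt := T / 2 ^+ n.
Let N := (2 ^ n)%N.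
Let F := f T - f 0.

Lemma level_dt_gt0 : 0 < dt. Proof. by rewrite divr_gt0 ?exprn_gt0. Qed.

Lemma level_end : N%:R * dt = T.
Proof. by rewrite /N /dt natrX mulrCA divff ?mulr1// expf_neq0. Qed.

Let pt (i : nat) := i%:R * dt.
(* The variance with its Stieltjes integral replaced by the sum over the grid; it solves a linear
   recursion, and summing the recursion produces the integrated variance. *)
Let w (i : nat) := expR (- (lam * pt i)) *
  (sig0sq + grid_sum (fun s => expR (lam * s)) f dt i).
Let q := expR (- (lam * dt)).

Lemma pt_le i : (i <= N)%N -> 0 <= pt i <= T.
Proof.
move=> iN; rewrite /pt mulr_ge0 ?(ltW level_dt_gt0)//= -level_end.
by apply: grid_mono => //; exact: ltW level_dt_gt0.
Qed.

Lemma F_ge0 : 0 <= F. Proof. by rewrite subr_ge0; apply: fN => //; exact: ltW. Qed.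

(** The integral up to [pt i] is defined by dyadic grids of [0, pt i], which need not refine the
    grid of level [n]. Both are coarsenings of the grid with 2^m i cells of mesh dt/2^m; the first
    error vanishes as m grows, the second stays of order [dt]. *)
Lemma path_var_grid i : (i <= N)%N -> `|path_var (pt i) - w i| <= Lexp * dt * F.
Proof.
move=> iN; have /andP[p0 pT] := pt_le iN.
rewrite /path_var /w -mulrBr opprD addrACA subrr add0r normrM (ger0_norm (expR_ge0 _)).
apply: (@le_trans _ _ `|stieltjes_int (fun s => expR (lam * s)) f 0 (pt i) -
    grid_sum (fun s => expR (lam * s)) f dt i|).
  rewrite ler_piMl// -[leRHS]expR0 ler_expR oppr_le0 mulr_ge0//; exact: ltW.
have gL := lipschitz_expR pT.
have [cv _] := stieltjes_int_rate gL fN Lexp_ge0 p0.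
have cv2 : (fun m => `|grid_sum (fun s => expR (lam * s)) f (pt i / 2 ^+ m) (2 ^ m) -
      grid_sum (fun s => expR (lam * s)) f dt i| - Lexp * (pt i / 2 ^+ m) * F) @ \oo -->
    `|stieltjes_int (fun s => expR (lam * s)) f 0 (pt i) -
    grid_sum (fun s => expR (lam * s)) f dt i| - Lexp * (pt i * 0) * F.
  apply: cvgB; first by apply: cvg_norm; apply: cvgB => //; exact: cvg_cst.
  apply: cvgM; last exact: cvg_cst.
  apply: cvgM; first exact: cvg_cst.
  apply: cvgM; first exact: cvg_cst.
  have : (fun m : nat => 2^-1 ^+ m) @ \oo --> (0 : R).
    by apply: cvg_expr; rewrite ger0_norm ?invr_ge0// invf_lt1 ?ltr1n.
  by under eq_fun do rewrite exprVn.
rewrite mulr0 mulr0 mul0r subr0 in cv2.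
rewrite -(cvg_lim _ cv2)//; apply: limr_le; first by apply/cvg_ex; eexists; exact: cv2.
near=> m.
have mE : dt = (2 ^ m)%:R * (dt / 2 ^+ m).
  by rewrite natrX mulrCA divff ?mulr1// expf_neq0.
have iE : pt i / 2 ^+ m = i%:R * (dt / 2 ^+ m) by rewrite /pt mulrA.
have d0 : 0 <= dt / 2 ^+ m by rewrite divr_ge0 ?exprn_ge0// ltW// level_dt_gt0.
have iiE : (2 ^ m * i)%:R * (dt / 2 ^+ m) = pt i by rewrite natrM mulrAC -mE mulrC.
have gT := lipschitz_expR (lexx T).
have FE : f (pt i) - f 0 <= F by rewrite lerD2r; exact: fN.
have h1 := @grid_refine _ f Lexp T (dt / 2 ^+ m) i (2 ^ m) gT fN Lexp_ge0 d0.
have h2 := @grid_refine _ f Lexp T (dt / 2 ^+ m) (2 ^ m) i gT fN Lexp_ge0 d0.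
rewrite -mE in h2; rewrite -iE in h1; rewrite mulnC in h2; rewrite iiE in h1 h2.
have {}h1 := h1 pT; have {}h2 := h2 pT.
rewrite lerBlDr [leRHS]addrC.
have LE x : 0 <= x -> Lexp * x * (f (pt i) - f 0) <= Lexp * x * F.
  by move=> x0; rewrite ler_wpM2l// mulr_ge0 ?Lexp_ge0.
apply: le_trans (ler_distD (grid_sum (fun s => expR (lam * s)) f (dt / 2 ^+ m) (2 ^ m * i)) _ _) _.
apply: lerD.
  by apply: le_trans h1 _; apply: LE; rewrite divr_ge0 ?exprn_ge0.
by rewrite distrC; apply: le_trans h2 _; apply: LE; rewrite ltW// level_dt_gt0.
Unshelve. all: by end_near. Qed.

Lemma wS i : w i.+1 = q * w i + q * (f (pt i.+1) - f (pt i)).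
Proof.
rewrite /w /grid_sum big_nat_recr//= -/(pt i) -/(pt i.+1).
have -> : expR (- (lam * pt i.+1)) = q * expR (- (lam * pt i)).
  by rewrite -expRD /pt; congr expR; rewrite -natr1; ring.
have e : expR (- (lam * pt i)) * expR (lam * pt i) = 1 by rewrite -expRD addNr expR0.
set A := \sum_(0 <= j < i) _; rewrite -!mulrA -!mulrDr; congr (_ * _).
by rewrite addrA mulrDr mulrA e mul1r.
Qed.

Lemma w_bound i : 0 <= w i <= sig0sq + (f (pt i) - f 0).
Proof.
have q0 : 0 <= q by exact: expR_ge0.
have q1 : q <= 1.
  by rewrite -expR0 ler_expR oppr_le0 mulr_ge0// ltW// level_dt_gt0.
have d0 := ltW level_dt_gt0.
elim: i => [|i /andP[w0 w1]].
  by rewrite /w /pt /grid_sum big_nil mul0r mulr0 oppr0 expR0 mul1r addr0 subrr addr0 lexx ltW.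
have st : 0 <= f (pt i.+1) - f (pt i).
  by rewrite subr_ge0; apply: fN; [rewrite mulr_ge0|exact: grid_mono].
rewrite wS; apply/andP; split; first by rewrite addr_ge0// mulr_ge0.
rewrite -mulrDr; apply: (@le_trans _ _ (w i + (f (pt i.+1) - f (pt i)))).
  by rewrite ler_piMl// addr_ge0.
by move: w1; lra.
Qed.

(** Discrete form of lam I_T = sigma_0^2 - sigma_T^2 + Z_(lam T): the recursion telescopes, and lam
    alpha = 1 - exp(-lam (T - s)) recovers the grid sum of [alpha]. The term in (1 - q) F is the
    discretisation defect. *)
Lemma sum_w : (1 - q) * \sum_(0 <= i < N) w i =
  lam * (sig0sq * alpha lam 0 T + grid_sum (fun s => alpha lam s T) f dt N) - (1 - q) * F.
Proof.
have tel m : (1 - q) * \sum_(0 <= i < m) w i = w 0%N - w m + q * (f (pt m) - f 0).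
  elim: m => [|m IH]; first by rewrite big_nil mulr0 /pt mul0r !subrr mulr0 addr0.
  by rewrite big_nat_recr//= mulrDr IH wS; ring.
have ptN : pt N = T by exact: level_end.
have wN : w N = expR (- (lam * T)) * sig0sq +
    \sum_(0 <= i < N) expR (- (lam * (T - pt i))) * (f (pt i.+1) - f (pt i)).
  rewrite /w ptN mulrDr; congr (_ + _); rewrite /grid_sum big_distrr /=.
  apply: eq_bigr => i _; rewrite mulrA -expRD -/(pt i) -/(pt i.+1).
  by congr (expR _ * _); ring.
have lE : lam * grid_sum (fun s => alpha lam s T) f dt N =
    F - \sum_(0 <= i < N) expR (- (lam * (T - pt i))) * (f (pt i.+1) - f (pt i)).
  have -> : F = \sum_(0 <= i < N) (f (pt i.+1) - f (pt i)).
    by rewrite telescope_sumr// ptN /pt mul0r.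
  rewrite -sumrB /grid_sum big_distrr /=; apply: eq_bigr => i _.
  by rewrite -/(pt i) -/(pt i.+1) /alpha; field; rewrite gt_eqF.
have w0 : w 0%N = sig0sq.
  by rewrite /w /pt /grid_sum big_nil mul0r mulr0 oppr0 expR0 mul1r addr0.
rewrite tel [lam * (_ + _)]mulrDr lE ptN -/F w0 wN /alpha subr0.
by field; rewrite gt_eqF.
Qed.

(** All errors are of order [dt]: the path against the recursion, lam dt against 1 - q, and the
    defect left in [sum_w]. *)
Lemma path_riemann_bound :
  `|\sum_(0 <= i < N) path_var (pt i) * dt -
    (sig0sq * alpha lam 0 T + grid_sum (fun s => alpha lam s T) f dt N)| <=
  (Lexp * T * F + (lam * T * (sig0sq + F) + F)) * dt.
Proof.
have dt0 := level_dt_gt0.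
set I := _ + grid_sum _ _ _ _.
have h1 : `|\sum_(0 <= i < N) path_var (pt i) * dt - \sum_(0 <= i < N) w i * dt| <= Lexp * T * F * dt.
  rewrite -sumrB; apply: le_trans (ler_norm_sum _ _ _) _.
  apply: (@le_trans _ _ (\sum_(0 <= i < N) Lexp * dt * F * dt)).
    apply: ler_sum_nat => i /andP[_ iN].
    by rewrite -mulrBl normrM (gtr0_norm dt0) ler_wpM2r ?(ltW dt0)// path_var_grid// ltnW.
  rewrite sumr_const_nat subn0 -mulr_natl -[in leRHS]level_end.
  by apply: le_of_eq; ring.
have S0 : 0 <= \sum_(0 <= i < N) w i.
  by apply: sumr_ge0 => i _; have /andP[] := w_bound i.
have SB : (\sum_(0 <= i < N) w i) * dt <= T * (sig0sq + F).
  rewrite -level_end -mulrA mulrC [leRHS]mulrCA ler_wpM2l ?(ltW dt0)//.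
  apply: (@le_trans _ _ (\sum_(0 <= i < N) (sig0sq + F))).
    apply: ler_sum_nat => i /andP[_ iN]; have /andP[_ wi] := w_bound i.
    apply: le_trans wi _; rewrite lerD2l lerD2r; have /andP[p0 pT] := pt_le (ltnW iN).
    exact: fN.
  by rewrite sumr_const_nat subn0 mulr_natl.
have q1 : 1 - q <= lam * dt.
  by have := expR_ge1Dx (- (lam * dt)); rewrite -/q; lra.
(* From q (1 + x) <= 1 with x = lam dt: replacing 1 - q by x costs at most x^2. *)
have q2 : lam * dt - (1 - q) <= (lam * dt) ^+ 2.
  have := expR_ge1Dx (lam * dt); have : q * expR (lam * dt) = 1 by rewrite -expRD addNr expR0.
  have : 0 <= q by exact: expR_ge0.
  have : 0 < lam * dt by rewrite mulr_gt0.
  move: (expR (lam * dt)) (lam * dt) => e x x0 qq qe ex.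
  have : q * (1 + x) <= q * expR x by exact: ler_wpM2l.
  rewrite qe => qx; have [|pos] := leP (x - (1 - q)) 0.
    by move=> /le_trans; apply; rewrite sqr_ge0.
  by nra.
have h2 : `|\sum_(0 <= i < N) w i * dt - I| <= (lam * T * (sig0sq + F) + F) * dt.
  have IE : lam * I = (1 - q) * \sum_(0 <= i < N) w i + (1 - q) * F by rewrite sum_w subrK.
  rewrite -big_distrl /=; move: S0 SB IE; set S := \sum_(0 <= i < N) w i => S0 SB IE.
  have F0 := F_ge0.
  have e1 : lam * (S * dt - I) = (lam * dt - (1 - q)) * S - (1 - q) * F.
    by rewrite mulrBr IE; ring.
  have q0 : 0 <= 1 - q by rewrite subr_ge0 -expR0 ler_expR oppr_le0 mulr_ge0// ltW.
  rewrite -(ler_pM2l lam0) -{1}(gtr0_norm lam0) -normrM e1.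
  apply: le_trans (ler_normB _ _) _.
  rewrite [`|_ * S|]ger0_norm ?mulr_ge0 ?subr_ge0//.
  rewrite ger0_norm ?mulr_ge0//.
  have b1 : (lam * dt - (1 - q)) * S <= lam ^+ 2 * dt * (T * (sig0sq + F)).
    apply: (@le_trans _ _ ((lam * dt) ^+ 2 * S)); first by rewrite ler_wpM2r.
    rewrite [leLHS](_ : _ = lam ^+ 2 * dt * (S * dt)); last by ring.
    by apply: ler_wpM2l => //; rewrite mulr_ge0 ?sqr_ge0// ltW.
  have b2 : (1 - q) * F <= lam * dt * F by rewrite ler_wpM2r.
  by apply: le_trans (lerD b1 b2) _; apply: le_of_eq; ring.
apply: le_trans (ler_distD (\sum_(0 <= i < N) w i * dt) _ _) _.
by rewrite mulrDl; exact: lerD.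
Qed.

End level.

Lemma path_riemann_cvg :
  (fun n => \sum_(0 <= i < 2 ^ n) path_var (i%:R * (T / 2 ^+ n)) * (T / 2 ^+ n)) @ \oo
    --> path_intvar.
Proof.
pose I n := sig0sq * alpha lam 0 T + grid_sum (fun s => alpha lam s T) f (T / 2 ^+ n) (2 ^ n).
have [cI _] := stieltjes_int_rate lipschitz_alpha fN ler01 (ltW T0).
have cvI : I @ \oo --> path_intvar by apply: cvgD => //; exact: cvg_cst.
pose C := Lexp * T * (f T - f 0) + (lam * T * (sig0sq + (f T - f 0)) + (f T - f 0)).
pose V n := \sum_(0 <= i < 2 ^ n) path_var (i%:R * (T / 2 ^+ n)) * (T / 2 ^+ n).
have cvD : (fun n => C * (T / 2 ^+ n)) @ \oo --> (0 : R).
  have : (fun n => C * (T * 2^-1 ^+ n)) @ \oo --> C * (T * 0).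
    apply: cvgMr; apply: cvgMr; apply: cvg_expr.
    by rewrite ger0_norm ?invr_ge0// invf_lt1 ?ltr1n.
  by rewrite !mulr0; under eq_fun do rewrite exprVn.
have cvVI : (fun n => V n - I n) @ \oo --> (0 : R).
  apply/norm_cvg0P; apply: (@squeeze_cvgr _ _ _ _ (fun=> 0) (fun n => C * (T / 2 ^+ n))) => //.
    by near=> n; rewrite normr_ge0 /= /V /I; exact: path_riemann_bound.
  exact: cvg_cst.
rewrite -[path_intvar]add0r (_ : (fun n => _) = (fun n => (V n - I n) + I n)); last first.
  by apply/funext => n; rewrite subrK.
exact: cvgD.
Unshelve. all: by end_near. Qed.

End stieltjes_sums.

Section bns_paths.
Context {R : realType} {Omega : Type}.
Variables (lam T sig0sq : R) (Z : R -> Omega -> R) (w : Omega).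
Hypotheses (lam0 : 0 < lam) (T0 : 0 < T) (sig0 : 0 < sig0sq)
  (ZN : forall s t, 0 <= s -> s <= t -> Z s w <= Z t w).

Lemma nondecreasing_time_change : nondecreasing_pos (fun s => Z (lam * s) w).
Proof. by move=> x y x0 xy; apply: ZN; rewrite ?mulr_ge0 ?ler_wpM2l ?(ltW lam0). Qed.

Lemma bns_intvar_ge : sig0sq * alpha lam 0 T <= bns_intvar lam sig0sq Z T w.
Proof. exact: (path_intvar_ge sig0sq lam0 T0 nondecreasing_time_change). Qed.

Lemma bns_vol_riemann_cvg :
  (fun n => \sum_(i < 2 ^ n) bns_vol lam sig0sq Z (dyadic_pt 0 T n i) w ^+ 2 * (T / 2 ^+ n))
    @ \oo --> bns_intvar lam sig0sq Z T w.
Proof.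
rewrite (_ : (fun n => _) = fun n => \sum_(0 <= i < 2 ^ n)
    path_var lam sig0sq (fun s => Z (lam * s) w) (i%:R * (T / 2 ^+ n)) * (T / 2 ^+ n)).
  exact: (path_riemann_cvg lam0 T0 sig0 nondecreasing_time_change).
apply/funext => n; rewrite big_mkord; apply: eq_bigr => i _.
rewrite /bns_vol sqr_sqrtr /dyadic_pt add0r subr0 -mulrA// .
rewrite -[bns_var _ _ _ _ _]/(path_var lam sig0sq (fun s => Z (lam * s) w) _).
apply: (path_var_ge0 (T := T)) => //; first exact: nondecreasing_time_change.
rewrite mulr_ge0 ?divr_ge0 ?exprn_ge0 ?(ltW T0)//=.
by rewrite mulrCA ler_piMr ?(ltW T0)// ler_pdivrMr ?exprn_gt0// mul1r -natrX ler_nat ltnW.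
Qed.

End bns_paths.

(** * Exponential moments of a subordinator *)

Section monotone_additive.
Context {R : realType}.

(** Cauchy's equation for a monotone function: with k the integer part of n t, both n l(t) and n t
    l(1) lie between k l(1) and (k + 1) l(1), so n |l(t) - t l(1)| <= l(1) for every n. *)
Lemma monotone_additive_linear (l : R -> R) :
  (forall s t, 0 <= s -> 0 <= t -> l (s + t) = l s + l t) ->
  (forall s t, 0 <= s -> s <= t -> l s <= l t) ->
  forall t, 0 <= t -> l t = t * l 1.
Proof.
move=> lD lN t t0.
have l0 : l 0 = 0.
  by have := lD 0 0 (lexx _) (lexx _); rewrite addr0 => h; apply: (addrI (l 0)); rewrite -h addr0.
have lM n s : 0 <= s -> l (n%:R * s) = n%:R * l s.
  move=> s0; elim: n => [|n IH]; first by rewrite !mul0r.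
  by rewrite -natr1 mulrDl mul1r lD ?mulr_ge0// IH mulrDl mul1r.
have l1 : 0 <= l 1 by rewrite -l0; exact: lN.
have key n : n%:R * `|l t - t * l 1| <= l 1.
  have nt0 : 0 <= n%:R * t by rewrite mulr_ge0.
  have /andP[kn nk] := truncn_itv nt0.
  set k := Num.truncn _ in kn nk.
  have h1 : k%:R * l 1 <= n%:R * l t.
    by rewrite -(lM n t)// -lM// mulr1; exact: lN.
  have h2 : n%:R * l t <= k.+1%:R * l 1.
    by rewrite -(lM n t)// -lM// mulr1; apply: lN => //; exact: ltW.
  have h3 : k%:R * l 1 <= n%:R * t * l 1 by rewrite ler_wpM2r.
  have h4 : n%:R * t * l 1 <= k.+1%:R * l 1 by rewrite ler_wpM2r// ltW.
  rewrite -[X in X * _](ger0_norm (ler0n R n)) -normrM ler_norml mulrBr.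
  by move: h2 h4; rewrite -natr1 mulrDl mul1r mulrA; lra.
apply/eqP; rewrite -subr_eq0; apply/eqP/normr0_eq0/eqP.
rewrite eq_le normr_ge0 andbT leNgt; apply/negP => d0.
have := key (Num.truncn (l 1 / `|l t - t * l 1|)).+1.
rewrite leNgt => /negP; apply.
by rewrite -ltr_pdivrMr//; apply: truncnS_gt.
Qed.

End monotone_additive.

Section levy_mgf.
Context {R : realType} {d : measure_display} {Omega : measurableType d}.
Variables (P : probability Omega R) (Z : R -> Omega -> R).
Hypothesis HZ : levy_subordinator P Z.

Definition lmgf (rho t : R) : \bar R := (\int[P]_w (expR (rho * Z t w))%:E)%E.

Let mZ t : measurable_fun setT (Z t). Proof. by have [] := HZ. Qed.

Lemma measurable_expZ rho t : measurable_fun setT (fun w => (expR (rho * Z t w))%:E).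
Proof.
apply/measurable_EFinP; apply: measurableT_comp => //; exact: measurable_funM.
Qed.

Lemma lmgf_ge0 rho t : (0 <= lmgf rho t)%E.
Proof. by apply: integral_ge0 => w _; rewrite lee_fin expR_ge0. Qed.

Lemma levy_ae0 : {ae P, forall w, Z 0 w = 0}.
Proof. by have [_ + _ _] := HZ; apply: filterS => w []. Qed.

Lemma levy_ae_mono : {ae P, forall w, forall s t, 0 <= s -> s <= t -> Z s w <= Z t w}.
Proof. by have [_ + _ _] := HZ; apply: filterS => w []. Qed.

Lemma lmgf0 rho : lmgf rho 0 = 1%E.
Proof.
rewrite /lmgf -(probability_setT P) -[RHS]mul1e -integral_cst//.
apply: ae_eq_integral => //; first exact: measurable_expZ.
by have := levy_ae0; apply: filterS => w Zw0 _; rewrite Zw0 mulr0 expR0.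
Qed.

(** The exponential splits over the increments on [0, s] and [s, s + t], and stationarity gives the
    second the law of Z_t. As Z_0 = 0 only almost surely, Z_s and Z_s - Z_0 are identified under the
    integral. *)
Lemma lmgfD rho s t : 0 <= s -> 0 <= t -> lmgf rho (s + t) = (lmgf rho s * lmgf rho t)%E.
Proof.
move=> s0 t0.
have [_ _ Zlaw Zind] := HZ.
pose tt (i : nat) : R := if i is 0 then 0 else if i is 1 then s else s + t.
have tt0 : 0 <= tt 0%N by [].
have ttN i : tt i <= tt i.+1 by case: i => [|[|i]] //=; rewrite lerDl.
have ind := Zind 2%N tt tt0 ttN.
pose X w := Z s w - Z 0 w; pose Y w := Z (s + t) w - Z s w.
have mX : measurable_fun setT X by exact: measurable_funB.
have mY : measurable_fun setT Y by exact: measurable_funB.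
pose F (q : R * R) : \bar R := (expR (rho * q.1) * expR (rho * q.2))%:E.
have mF : measurable_fun setT F.
  apply/measurable_EFinP; apply: measurable_funM; apply: measurableT_comp => //;
    by apply: measurable_funM.
have mRE : (measurable : set (set R)) = <<s measurable >>.
  by rewrite sigma_algebra_id//; exact: sigma_algebra_measurable.
transitivity (\int[P]_w F (X w, Y w))%E.
  apply: ae_eq_integral => //; first exact: measurable_expZ.
    by apply: measurableT_comp => //; exact: measurable_fun_pair.
  have := levy_ae0; apply: filterS => w Zw0 _.
  by rewrite /F /= -expRD /X /Y Zw0; congr (expR _)%:E; ring.
rewrite (integral_indep (G1 := measurable) (G2 := measurable))//; first last.
- by move=> q; rewrite lee_fin mulr_ge0 ?expR_ge0.
- move=> A B mA mB.
  pose BB (i : 'I_2) : set R := if i == ord0 then A else B.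
  have mBB i : measurable (BB i) by rewrite /BB; case: ifP.
  have := ind BB mBB; rewrite big_ord_recl big_ord1 => <-.
  congr (P _); apply/seteqP; split => w /=.
    by move=> [hA hB] i _ /=; rewrite /BB; case: i => -[|[|//]] hi.
  by move=> h; split; [exact: (h ord0 I)|exact: (h (lift ord0 ord0) I)].
- exact: measurableI.
- exact: measurableI.
transitivity (\int[P]_w' (lmgf rho s * (expR (rho * Y w'))%:E))%E.
  apply: eq_integral => w' _; rewrite /F /=.
  under eq_integral do rewrite EFinM.
  rewrite ge0_integralZr//.
  - congr (_ * _)%E; apply: ae_eq_integral => //.
    + by apply/measurable_EFinP; apply: measurableT_comp => //; exact: measurable_funM.
    + exact: measurable_expZ.
    + by have := levy_ae0; apply: filterS => w Zw0 _; rewrite /X Zw0 subr0.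
  - by apply/measurable_EFinP; apply: measurableT_comp => //; exact: measurable_funM.
rewrite ge0_integralZl; first last.
- exact: lmgf_ge0.
- by move=> w _; rewrite lee_fin expR_ge0.
- by apply/measurable_EFinP; apply: measurableT_comp => //; exact: measurable_funM.
- exact: measurableT.
congr (_ * _)%E.
pose Y' : {mfun Omega >-> R} := HB.pack Y (isMeasurableFun.Build _ _ _ _ Y mY).
pose Zt : {mfun Omega >-> R} := HB.pack (Z t) (isMeasurableFun.Build _ _ _ _ (Z t) (mZ t)).
pose e (x : R) : \bar R := (expR (rho * x))%:E.
have me : measurable_fun setT e.
  by apply/measurable_EFinP; apply: measurableT_comp => //; exact: measurable_funM.
have e0 x : (0 <= e x)%E by rewrite lee_fin expR_ge0.
rewrite /lmgf -[LHS](ge0_integral_distribution (P := P) Y' me e0).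
rewrite -[RHS](ge0_integral_distribution (P := P) Zt me e0).
apply: eq_measure_integral => B mB _.
have := Zlaw s (s + t) s0; rewrite lerDl => /(_ t0 B mB).
by rewrite addrAC subrr add0r.
Qed.

Lemma lmgf_gt0 rho t : (0 < lmgf rho t)%E.
Proof.
rewrite lt_neqAle lmgf_ge0 andbT eq_sym; apply/eqP => h.
have : ae_eq P setT (fun w => (expR (rho * Z t w))%:E) (cst 0%E).
  apply/(ae_eq_integral_abs P measurableT (measurable_expZ rho t)).
  rewrite -[RHS]h; apply: eq_integral => w _.
  by rewrite gee0_abs// lee_fin expR_ge0.
move=> [A [mA PA sA]].
have AT : A = setT.
  apply/seteqP; split => // w _; apply: sA => /(_ I) /= [].
  by apply/eqP; rewrite gt_eqF ?expR_gt0.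
have : (1 = 0 :> \bar R)%E by rewrite -(probability_setT P) -AT; exact: PA.
by move=> /eqP; rewrite onee_eq0.
Qed.

Lemma le_lmgf rho t rho' t' :
  {ae P, forall w, rho * Z t w <= rho' * Z t' w} -> (lmgf rho t <= lmgf rho' t')%E.
Proof.
move=> h; apply: ae_ge0_le_integral => //.
- exact: measurable_expZ.
- exact: measurable_expZ.
- by apply: filterS h => w h _; rewrite lee_fin ler_expR.
Qed.

(** For rho >= 0 the time is raised to an integer, where multiplicativity gives a finite power; for
    rho < 0 the integrand is almost surely at most 1, whence the comparison with [lmgf 0 0]. *)
Lemma lmgf_lty rho t : (lmgf rho 1 < +oo)%E -> 0 <= t -> (lmgf rho t < +oo)%E.
Proof.
move=> f1 t0; have [r0|r0] := leP 0 rho.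
  have H n : (lmgf rho n%:R < +oo)%E.
    elim: n => [|n IH]; first by rewrite lmgf0 ltry.
    by rewrite -natr1 lmgfD// lte_mul_pinfty ?lmgf_ge0// ge0_fin_numE ?lmgf_ge0.
  apply: le_lt_trans (H (Num.truncn t).+1).
  apply: le_lmgf; have := levy_ae_mono; apply: filterS => w Zw.
  by rewrite ler_wpM2l// Zw// ltW// truncnS_gt.
apply: (@le_lt_trans _ _ (lmgf 0 0)); last by rewrite lmgf0 ltry.
apply: le_lmgf; have := levy_ae_mono; have := levy_ae0; apply: filterS2 => w Zw0 Zw.
by rewrite mul0r mulr_le0_ge0 ?(ltW r0)// -Zw0; exact: Zw.
Qed.

(** The logarithm of [lmgf] is additive in time and monotone: nondecreasing for rho >= 0, while for
    rho < 0 its negative is. *)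
Lemma lmgfE rho t : (lmgf rho 1 < +oo)%E -> 0 <= t ->
  lmgf rho t = (expR (t * ln (fine (lmgf rho 1))))%:E.
Proof.
move=> f1 t0.
have fin s : 0 <= s -> lmgf rho s \is a fin_num.
  by move=> s0; rewrite ge0_fin_numE ?lmgf_ge0//; exact: lmgf_lty.
have pos s : 0 <= s -> 0 < fine (lmgf rho s).
  by move=> s0; rewrite -lte_fin fineK ?fin// lmgf_gt0.
pose l s := ln (fine (lmgf rho s)).
have lD s u : 0 <= s -> 0 <= u -> l (s + u) = l s + l u.
  by move=> s0 u0; rewrite /l lmgfD// fineM ?fin// lnM ?posrE ?pos.
suff E : l t = t * l 1.
  by rewrite -/(l 1) -E /l lnK ?posrE ?pos// fineK ?fin.
have [r0|r0] := leP 0 rho.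
  apply: monotone_additive_linear; [exact: lD| |exact: t0] => s u s0 su.
  have u0 := le_trans s0 su.
  rewrite /l ler_ln ?posrE ?pos// fine_le ?fin//.
  apply: le_lmgf; have := levy_ae_mono; apply: filterS => w Zw.
  by rewrite ler_wpM2l// Zw.
suff : - l t = t * - l 1 by rewrite mulrN => /oppr_inj.
apply: (@monotone_additive_linear _ (fun s => - l s)); last exact: t0.
  by move=> s u s0 u0; rewrite lD// opprD.
move=> s u s0 su; have u0 := le_trans s0 su.
rewrite lerN2 /l ler_ln ?posrE ?pos// fine_le ?fin//.
apply: le_lmgf; have := levy_ae_mono; apply: filterS => w Zw.
by rewrite ler_wnM2l ?(ltW r0)// Zw.
Qed.

(** Some theta above [rho] has a finite exponential moment, and Z_1 >= 0 almost surely makes the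
    moment monotone in the exponent. *)
Lemma lmgf1_lty rho : (rho%:E < kappa_hat P Z)%E -> (lmgf rho 1 < +oo)%E.
Proof.
move=> /ereal_sup_gt[_ [theta kt <-]]; rewrite lte_fin => rt.
apply: (@le_lt_trans _ _ (lmgf theta 1)).
  apply: le_lmgf; have := levy_ae_mono; have := levy_ae0; apply: filterS2 => w Zw0 Zw.
  by rewrite ler_wpM2r ?(ltW rt)// -Zw0; exact: Zw.
move: kt; rewrite /= /kappa -/(lmgf theta 1) -[mgf P Z theta]/(lmgf theta 1).
by have := lmgf_ge0 theta 1; case: (lmgf theta 1) => // x _ _; rewrite ltry.
Qed.

(** The compensator cancels because E exp(rho Z_(lam T)) = exp(lam T kappa(rho)); kappa(rho) is
    finite here, so [fine] loses nothing. *)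
Lemma lmgf_bns_P lam rho T : 0 < lam -> 0 <= T -> (rho%:E < kappa_hat P Z)%E ->
  (\int[P]_w (bns_P lam rho (fine (kappa P Z rho)) Z T w)%:E = 1)%E.
Proof.
move=> lam0 T0 /lmgf1_lty f1.
have -> : fine (kappa P Z rho) = ln (fine (lmgf rho 1)).
  rewrite /kappa -[mgf P Z rho]/(lmgf rho 1).
  by move: f1 (lmgf_ge0 rho 1); case: (lmgf rho 1).
rewrite /bns_P.
under eq_integral do rewrite expRD EFinM.
rewrite ge0_integralZr//.
- rewrite -/(lmgf rho (lam * T)) lmgfE// ?mulr_ge0// ?ltW//.
  by rewrite -EFinM -expRD subrr expR0.
- exact: measurable_expZ.
Qed.

End levy_mgf.

(** * Conditioning on the subordinator *)

Section measurable_limits.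
Context {R : realType} {d : measure_display} {T : measurableType d}.

(* No convergence is assumed: where the sequence diverges, [limn] is the default point,
   and the set of convergence is measurable by Cauchy's criterion. *)
Lemma measurable_fun_limn (u : nat -> T -> R) :
  (forall n, measurable_fun setT (u n)) ->
  measurable_fun setT (fun x => limn (fun n => u n x)).
Proof.
move=> mu.
pose E k N n := [set x | `|u (N + n)%N x - u N x| <= k.+1%:R^-1].
pose D := \bigcap_k \bigcup_N \bigcap_n E k N n.
have mE k N n : measurable (E k N n).
  rewrite -[X in measurable X]setTI; apply: (measurable_fun_ler _ _ _ (Y := [set true])) => //.
  by apply: measurableT_comp => //; exact: measurable_funB.
have mD : measurable D.
  apply: bigcapT_measurable => k; apply: bigcupT_measurable => N.
  exact: bigcapT_measurable.
have DP x : D x <-> cvgn (fun n => u n x).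
  split=> [Dx|].
    apply/cauchy_cvgP/cauchy_exP => e e0.
    have [k ke] : exists k : nat, k.+1%:R^-1 < e.
      exists (Num.truncn e^-1); rewrite invf_plt ?posrE//.
      exact: truncnS_gt.
    have [N _ HN] := Dx k I.
    exists (u N x); exists N => // m /= Nm.
    by rewrite /ball /= distrC -(subnKC Nm); apply: le_lt_trans ke; exact: HN.
  move=> cu k _; have k0 : 0 < (k.+1%:R^-1 / 2 : R) by rewrite divr_gt0 ?invr_gt0.
  have /cvgrPdist_lt/(_ _ k0)[N _ HN] := cu.
  exists N => // n _; rewrite /E /=.
  apply: le_trans (ler_distD (limn (fun n => u n x)) _ _) _.
  have h1 := HN _ (leqnn N); have h2 := HN _ (leq_addr n N).
  rewrite distrC (splitr k.+1%:R^-1); apply: lerD; exact: ltW.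
rewrite -(setUv D); apply/measurable_funU => //; first exact: measurableC.
split.
  apply: (@measurable_fun_cvg _ _ _ _ u); first by move=> m; exact: measurable_funTS.
  by move=> x /DP.
apply: (eq_measurable_fun (cst point)); last exact: measurable_cst.
by move=> x; rewrite inE => Dx; rewrite dvgP// => /DP.
Qed.

Lemma measurable_stieltjes_int (g : R -> R) (Y : R -> T -> R) (t : R) : 0 <= t ->
  (forall s, 0 <= s -> measurable_fun setT (Y s)) ->
  measurable_fun setT (fun w => stieltjes_int g (fun s => Y s w) 0 t).
Proof.
move=> t0 mY; apply: measurable_fun_limn => n.
have p0 i : 0 <= dyadic_pt 0 t n i.
  by rewrite /dyadic_pt add0r subr0 divr_ge0 ?mulr_ge0 ?exprn_ge0.
apply: measurable_sum => i; apply: measurable_funM => //.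
by apply: measurable_funB; exact: mY.
Qed.

Lemma measurable_sqrt : measurable_fun setT (@Num.sqrt R).
Proof. by apply: continuous_measurable_fun; exact: sqrt_continuous. Qed.

Lemma measurable_Phi : measurable_fun setT (@Phi R).
Proof.
by apply: continuous_measurable_fun => z; exact: (has_deriv_continuous (has_deriv_Phi z)).
Qed.

(** Off 0 the inverse is x exp(-ln(x^2)); at 0 the convention 1/0 = 0 is kept. *)
Lemma measurable_invr : measurable_fun setT (@GRing.inv R).
Proof.
rewrite (_ : GRing.inv = fun x : R => if x == 0 then 0 else x * expR (- ln (x ^+ 2))); last first.
  apply/funext => x; case: eqVneq => [->|x0]; first by rewrite invr0.
  by rewrite expRN lnK ?posrE ?exprn_even_gt0 ?x0// expr2 invfM mulrA divff ?mul1r.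
apply: measurable_fun_ifT => //; first exact: measurable_fun_eqr.
apply: measurable_funM => //; apply: measurableT_comp => //; apply: measurableT_comp => //.
by apply: measurableT_comp; [exact: measurable_ln|exact: exprn_measurable].
Qed.

Variables (Z : R -> T -> R) (lam sig0sq t : R).
Hypotheses (mZ : forall s, 0 <= s -> measurable_fun setT (Z s)) (lam0 : 0 < lam) (t0 : 0 <= t).

Let mZl s : 0 <= s -> measurable_fun setT (Z (lam * s)).
Proof. by move=> s0; apply: mZ; rewrite mulr_ge0// ltW. Qed.

(** Besides [Omega] itself, this is applied to [cyl_type D0 Z], where it says that the volatility is
    a functional of [Z]. *)
Lemma measurable_bns_vol : measurable_fun setT (bns_vol lam sig0sq Z t).
Proof.
apply: measurableT_comp; first exact: measurable_sqrt.
apply: measurable_funM => //; apply: measurable_funD => //.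
exact: (@measurable_stieltjes_int _ (fun s => Z (lam * s))).
Qed.

Lemma measurable_bns_intvar : measurable_fun setT (bns_intvar lam sig0sq Z t).
Proof.
apply: measurable_funD => //.
exact: (@measurable_stieltjes_int _ (fun s => Z (lam * s))).
Qed.

Lemma measurable_bns_P rho kap : measurable_fun setT (bns_P lam rho kap Z t).
Proof.
apply: measurableT_comp => //; apply: measurable_funB => //.
by apply: measurable_funM => //; exact: mZl.
Qed.

End measurable_limits.

Section put_price.
Context {R : realType} {d : measure_display} {Omega : measurableType d}.
Notation mu := (@lebesgue_measure R).
Notation phi := (@normal_pdf R 0 1).
Variables (P : probability Omega R) (W Z : R -> Omega -> R) (stoch : Omega -> R).
Variables (T r lam sig0sq S0 K rho kap : R).
Hypotheses (T0 : 0 < T) (lam0 : 0 < lam) (sig0 : 0 < sig0sq) (S00 : 0 < S0) (K0 : 0 < K).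
Hypotheses (HW : brownian_motion P W) (HZ : levy_subordinator P Z) (WZ : indep_processes P W Z).
Hypothesis Hst : stoch_int_of P (bns_vol lam sig0sq Z) W T stoch.

Let D0 : set R := [set s | 0 <= s].
Let vol n i := bns_vol lam sig0sq Z (dyadic_pt 0 T n i).
Let dW n i w := W (dyadic_pt 0 T n i.+1) w - W (dyadic_pt 0 T n i) w.
Let PT := bns_P lam rho kap Z T.
Let IT := bns_intvar lam sig0sq Z T.
Let K' := K * expR (- (r * T)).
(** The discounted payoff as a function of the value [x] of the stochastic integral, all else frozen
    at [w]; discounting cancels the drift r T. *)
Let payoff w x := Num.max (K' - S0 * PT w * expR (- (IT w / 2) + x)) 0.

Let mW t : measurable_fun setT (W t). Proof. by have [] := HW. Qed.
Let mZ t : measurable_fun setT (Z t). Proof. by have [] := HZ. Qed.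
Let K'0 : 0 < K'. Proof. by rewrite mulr_gt0 ?expR_gt0. Qed.

Lemma dyadic_ge0 n i : 0 <= dyadic_pt 0 T n i.
Proof. by rewrite /dyadic_pt add0r subr0 divr_ge0 ?mulr_ge0 ?exprn_ge0// ltW. Qed.

Lemma dyadic_step n i : dyadic_pt 0 T n i.+1 - dyadic_pt 0 T n i = T / 2 ^+ n.
Proof. by rewrite /dyadic_pt !add0r subr0 -natr1; field; rewrite expf_neq0. Qed.

Lemma dyadic_lt n i : dyadic_pt 0 T n i < dyadic_pt 0 T n i.+1.
Proof. by rewrite -subr_gt0 dyadic_step divr_gt0 ?exprn_gt0. Qed.

Lemma payoffE w x : payoff w x =
  Num.max (K' - expR (ln (S0 * PT w * expR (- (IT w / 2))) + x)) 0.
Proof.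
rewrite /payoff [in LHS]expRD [in RHS]expRD lnK ?mulrA// posrE mulr_gt0 ?expR_gt0//.
by rewrite mulr_gt0 ?expR_gt0.
Qed.

Lemma payoff_ge0 w x : 0 <= payoff w x.
Proof. by rewrite le_max lexx orbT. Qed.

Lemma payoff_le w x : payoff w x <= K'.
Proof.
rewrite ge_max (ltW K'0) andbT lerBlDr lerDl.
by rewrite mulr_ge0 ?expR_ge0// mulr_ge0 ?expR_ge0// ltW.
Qed.

Lemma payoff_lipschitz w x y : `|payoff w x - payoff w y| <= K' * `|x - y|.
Proof.
rewrite !payoffE; apply: le_trans (put_payoff_lipschitz _ _ K'0) _.
by rewrite opprD addrACA subrr add0r.
Qed.

Lemma continuous_payoff w : continuous (payoff w).
Proof.
move=> x; apply/cvgrPdist_lt => e e0; near=> y.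
apply: le_lt_trans (payoff_lipschitz w x y) _.
rewrite mulrC -ltr_pdivlMr//; near: y.
by apply: cvgr_dist_lt; rewrite ?divr_gt0//; exact: cvg_id.
Unshelve. all: by end_near. Qed.

Lemma measurable_payoff d1 (T1 : measurableType d1) (f : T1 -> Omega) (x : T1 -> R) :
  measurable_fun setT (fun q => PT (f q)) -> measurable_fun setT (fun q => IT (f q)) ->
  measurable_fun setT x -> measurable_fun setT (fun q => (payoff (f q) (x q))%:E).
Proof.
move=> mP mI mx; apply/measurable_EFinP; apply: measurable_maxr => //.
apply: measurable_funB => //; apply: measurable_funM; first exact: measurable_funM.
apply: measurableT_comp => //; apply: measurable_funD => //.
by apply: measurableT_comp => //; exact: measurable_funM.
Qed.

Lemma dW_gaussian n : let s := Num.sqrt (T / 2 ^+ n) in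
  [/\ 0 < s, (forall i, measurable_fun setT (dW n i)),
    (forall i B, measurable B -> P (dW n i @^-1` B) = normal_prob 0 s B)
  & (forall m, indep_RVs P (fun i : 'I_m => dW n i))].
Proof.
have [_ _ Wlaw Wind] := HW; split.
- by rewrite sqrtr_gt0 divr_gt0 ?exprn_gt0.
- by move=> i; exact: measurable_funB.
- by move=> i B mB; rewrite -(dyadic_step n i); exact: Wlaw (dyadic_ge0 _ _) (dyadic_lt _ _) _ mB.
- move=> m; apply: (Wind m (dyadic_pt 0 T n)); first exact: dyadic_ge0.
  by move=> i; exact/ltW/dyadic_lt.
Qed.

Let V n w := \sum_(i < 2 ^ n) vol n i w ^+ 2 * (T / 2 ^+ n).
Let X n w := \sum_(i < 2 ^ n) vol n i w * dW n i w.

Lemma mZcyl s : 0 <= s -> measurable_fun setT (Z s : cyl_type D0 Z -> R).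
Proof. by move=> s0; exact: measurable_cyl. Qed.

(* Conditionally on [Z] the Riemann sum is a centred Gaussian of variance [V n]. *)
Lemma payoff_riemann n : (\int[P]_w (payoff w (X n w))%:E =
  \int[P]_w \int[mu]_z (payoff w (Num.sqrt (V n w) * z) * phi z)%:E)%E.
Proof.
have [s0 mdW dWlaw dWind] := dW_gaussian n.
(* The first copy of [Omega] feeds [W], the second feeds [Z]; on the diagonal this is the payoff of
   the Riemann sum. *)
pose F (q : cyl_type D0 W * cyl_type D0 Z) : \bar R :=
  (payoff q.2 (\sum_(i < 2 ^ n) vol n i q.2 * dW n i q.1))%:E.
rewrite -[LHS]/(\int[P]_w F (w, w))%E.
rewrite (@integral_indep _ _ _ P _ (cyl_type D0 W) _ (cyl_type D0 Z) (id : Omega -> cyl_type D0 W)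
  (id : Omega -> cyl_type D0 Z) (cyl D0 W) (cyl D0 Z) F); first last.
- by move=> q; rewrite lee_fin payoff_ge0.
- apply: (@measurable_payoff _ _ (fun q : cyl_type D0 W * cyl_type D0 Z => q.2)).
  + apply: (measurableT_comp (f := PT : cyl_type D0 Z -> R)); last exact: measurable_snd.
    by apply: (measurable_bns_P mZcyl) => //; exact: ltW.
  + apply: (measurableT_comp (f := IT : cyl_type D0 Z -> R)); last exact: measurable_snd.
    by apply: (measurable_bns_intvar _ mZcyl) => //; exact: ltW.
  + apply: measurable_sum => i; apply: measurable_funM.
      apply: (measurableT_comp (f := vol n i : cyl_type D0 Z -> R)); last exact: measurable_snd.
      by apply: (measurable_bns_vol _ mZcyl) => //; exact: dyadic_ge0.
    apply: (measurableT_comp (f := dW n i : cyl_type D0 W -> R)); last exact: measurable_fst.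
    by apply: measurable_funB; apply: measurable_cyl; exact: dyadic_ge0.
- move=> A B [m1 [s1 [A1 [Ds1 mA1 ->]]]] [m2 [s2 [A2 [Ds2 mA2 ->]]]].
  exact: WZ.
- by apply: measurable_id_cyl => s _; exact: mZ.
- by apply: measurable_id_cyl => s _; exact: mW.
- exact: cyl_setI.
- by [].
- exact: cyl_setI.
- by [].
apply: eq_integral => w _; rewrite /F /=.
have := @integral_gaussian_sum _ _ _ P _ (dW n) s0 mdW dWlaw dWind (fun i => vol n i w)
  (payoff w) (2 ^ n) 0 (fun i => sqrtr_ge0 _) (@continuous_payoff w) (payoff_ge0 w).
rewrite sqr_sqrtr; last by apply: divr_ge0; [exact: ltW|exact: exprn_ge0].
under eq_integral do rewrite add0r.
by under [in RHS]eq_integral do rewrite add0r.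
Qed.

Let mIT : measurable_fun setT IT.
Proof. by apply: measurable_bns_intvar => //; exact: ltW. Qed.

Let mPT : measurable_fun setT PT.
Proof. by apply: measurable_bns_P => //; exact: ltW. Qed.

Let mvol n i : measurable_fun setT (vol n i).
Proof. by apply: measurable_bns_vol => //; exact: dyadic_ge0. Qed.

Let mV n : measurable_fun setT (V n).
Proof.
apply: measurable_sum => i; apply: measurable_funM => //.
exact: measurable_funX.
Qed.

Let mX n : measurable_fun setT (X n).
Proof.
apply: measurable_sum => i; apply: measurable_funM => //.
exact: measurable_funB.
Qed.

Lemma measurable_gauss_payoff (v : Omega -> R) : measurable_fun setT v ->
  measurable_fun setT (fun w => \int[mu]_z (payoff w (Num.sqrt (v w) * z) * phi z)%:E)%E.
Proof.
move=> mv.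
pose F (q : Omega * measurableTypeR R) : \bar R := (payoff q.1 (Num.sqrt (v q.1) * q.2) * phi q.2)%:E.
apply: (measurable_fun_fubini_tonelli_F (m2 := mu) F).
- apply/measurable_EFinP; apply: measurable_funM; last first.
    apply: measurableT_comp; first exact: measurable_normal_pdf.
    exact: measurable_snd.
  apply/measurable_EFinP; apply: measurable_payoff.
  + by apply: measurableT_comp => //; exact: measurable_fst.
  + by apply: measurableT_comp => //; exact: measurable_fst.
  + apply: measurable_funM; last exact: measurable_snd.
    apply: measurableT_comp; first exact: measurable_sqrt.
    by apply: measurableT_comp => //; exact: measurable_fst.
- by move=> q; rewrite lee_fin mulr_ge0 ?payoff_ge0 ?normal_pdf_ge0.
Qed.

Let measurable_payoff_pdf w (s : R) :
  measurable_fun setT (fun z : measurableTypeR R => (payoff w (s * z) * phi z)%:E).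
Proof.
apply/measurable_EFinP; apply: measurable_funM; last exact: measurable_normal_pdf.
apply: (measurableT_comp (f := payoff w)); last exact: measurable_funM.
by apply: continuous_measurable_fun; exact: (@continuous_payoff w).
Qed.

Lemma gauss_payoff_le w (s : R) : (\int[mu]_z (payoff w (s * z) * phi z)%:E <= K'%:E)%E.
Proof.
rewrite -(integral_std_pdfZ (ltW K'0)); apply: ge0_le_integral => //.
- by move=> z _; rewrite lee_fin mulr_ge0 ?payoff_ge0 ?normal_pdf_ge0.
- apply/measurable_EFinP; apply: measurable_funM => //; exact: measurable_normal_pdf.
- by move=> z _; rewrite lee_fin ler_wpM2r ?normal_pdf_ge0 ?payoff_le.
Qed.

Lemma gauss_payoff_ge0 w (s : R) : (0 <= \int[mu]_z (payoff w (s * z) * phi z)%:E)%E.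
Proof.
by apply: integral_ge0 => z _; rewrite lee_fin mulr_ge0 ?payoff_ge0 ?normal_pdf_ge0.
Qed.

Lemma gauss_payoff_cvg w (s : nat -> R) (l : R) : s @ \oo --> l ->
  (fun n => \int[mu]_z (payoff w (s n * z) * phi z)%:E)%E @ \oo -->
  (\int[mu]_z (payoff w (l * z) * phi z)%:E)%E.
Proof.
move=> sl.
have [] := @dominated_convergence _ _ _ mu setT measurableT
  (fun n z => (payoff w (s n * z) * phi z)%:E) (fun z => (payoff w (l * z) * phi z)%:E)
  (fun z => (K' * phi z)%:E).
- by move=> n; exact: measurable_payoff_pdf.
- exact: measurable_payoff_pdf.
- apply: aeW => z _; apply: cvg_EFin; first by apply: nearW.
  apply: cvgM; last exact: cvg_cst.
  apply: continuous_cvg; first exact: continuous_payoff.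
  by apply: cvgM => //; exact: cvg_cst.
- under eq_fun do rewrite EFinM.
  by apply: integrableZl => //; exact: integrable_normal_pdf.
- apply: aeW => z n _; rewrite gee0_abs lee_fin ?mulr_ge0 ?payoff_ge0 ?normal_pdf_ge0//.
  by rewrite ler_wpM2r ?normal_pdf_ge0 ?payoff_le.
by [].
Qed.

Lemma payoff_riemann_cvg :
  (fun n => \int[P]_w (payoff w (X n w))%:E)%E @ \oo -->
  (\int[P]_w \int[mu]_z (payoff w (Num.sqrt (IT w) * z) * phi z)%:E)%E.
Proof.
under eq_fun do rewrite payoff_riemann.
have [] := @dominated_convergence _ _ _ P setT measurableT
  (fun n w => \int[mu]_z (payoff w (Num.sqrt (V n w) * z) * phi z)%:E)%E
  (fun w => \int[mu]_z (payoff w (Num.sqrt (IT w) * z) * phi z)%:E)%E (cst K'%:E).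
- by move=> n; exact: measurable_gauss_payoff.
- exact: measurable_gauss_payoff.
- have := levy_ae_mono HZ; apply: filterS => w Zw _.
  apply: gauss_payoff_cvg; apply: continuous_cvg; first exact: sqrt_continuous.
  exact: bns_vol_riemann_cvg.
- exact: finite_measure_integrable_cst.
- apply: aeW => w n _; rewrite gee0_abs ?gauss_payoff_ge0//; exact: gauss_payoff_le.
by [].
Qed.

Let mst : measurable_fun setT stoch. Proof. by have [] := Hst. Qed.

Lemma integrable_payoff (x : Omega -> R) : measurable_fun setT x ->
  P.-integrable setT (fun w => (payoff w (x w))%:E).
Proof.
move=> mx; apply: (@le_integrable _ _ _ P setT measurableT _ (cst K'%:E)).
- by apply: (measurable_payoff (f := id)).
- by move=> w _ /=; rewrite lee_fin !ger0_norm ?payoff_ge0 ?(ltW K'0)// payoff_le.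
- exact: finite_measure_integrable_cst.
Qed.

(** Where |X n - stoch| < eps the Lipschitz bound gives K' eps = e/2; on the complement, of
    probability at most e/2/K', the payoffs differ by at most [K']. *)
Lemma payoff_stoch_cvg :
  (fun n => Ex P (fun w => payoff w (X n w))) @ \oo --> Ex P (fun w => payoff w (stoch w)).
Proof.
have [_ cst0] := Hst.
apply/cvgrPdist_le => e e0.
pose eps := e / 2 / K'.
have eps0 : 0 < eps by rewrite !divr_gt0.
pose A n := [set w | eps <= `|X n w - stoch w|].
have mA n : measurable (A n).
  rewrite -[X in measurable X]setTI; apply: (measurable_fun_ler _ _ _ (Y := [set true])) => //.
  by apply: measurableT_comp => //; exact: measurable_funB.
have cA : (fun n => fine (P (A n))) @ \oo --> (0 : R).
  have := cst0 eps eps0; rewrite -[0%E]/((0 : R)%:E) => /fine_cvgP[_].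
  by apply: cvg_trans.
have eps1 : 0 < e / 2 / K' by [].
have /cvgrPdist_le/(_ _ eps1) := cA; apply: filterS => n.
rewrite sub0r normrN ger0_norm ?fine_ge0// => PA.
have fA : P (A n) \is a fin_num by exact: fin_num_measure.
rewrite /Ex -[fine _]/(Rintegral P setT (fun w => payoff w (stoch w))).
rewrite -[X in _ - X]/(Rintegral P setT (fun w => payoff w (X n w))).
rewrite -RintegralB//; [|exact: integrable_payoff|exact: integrable_payoff].
have iD : P.-integrable setT (fun w => (payoff w (stoch w) - payoff w (X n w))%:E).
  by under eq_fun do rewrite EFinB; apply: integrableB => //; exact: integrable_payoff.
have i1 : P.-integrable setT (cst (K' * eps)%:E : Omega -> \bar R).
  exact: finite_measure_integrable_cst.
have i2 : P.-integrable setT (fun w => (K'%:E * (\1_(A n) w)%:E)%E).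
  by apply: integrableZl => //; exact: integrable_indic.
have bE : EFin \o (fun w => K' * eps + K' * \1_(A n) w) =
    (fun w => cst (K' * eps)%:E w + K'%:E * (\1_(A n) w)%:E)%E.
  by apply/funext => w; rewrite /= EFinD EFinM.
have iB : P.-integrable setT (EFin \o (fun w => K' * eps + K' * \1_(A n) w)).
  by rewrite bE; exact: integrableD.
apply: le_trans (le_normr_Rintegral _ iD) _ => //.
apply: (@le_trans _ _ (Rintegral P setT (fun w => K' * eps + K' * \1_(A n) w))).
  apply: le_Rintegral => //.
  - exact: integrable_norm.
  - move=> w _; rewrite indicE; case: (boolP (w \in A n)) => [_|nA].
      rewrite mulr1; apply: (@le_trans _ _ K'); last by rewrite lerDr mulr_ge0// ltW.
      have := payoff_ge0 w (stoch w); have := payoff_ge0 w (X n w).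
      have := payoff_le w (stoch w); have := payoff_le w (X n w).
      by rewrite ler_norml; lra.
    rewrite mulr0 addr0 distrC; apply: le_trans (payoff_lipschitz _ _ _) _.
    rewrite ler_wpM2l ?(ltW K'0)//; apply/ltW; rewrite ltNge.
    by apply: contra nA => h; rewrite inE.
rewrite /Rintegral -[X in (\int[P]_(w in _) X w)%E]/(EFin \o (fun w => K' * eps + K' * \1_(A n) w)) bE.
rewrite integralD// integralZl//; last exact: integrable_indic.
rewrite integral_cst// [X in (_ * X + _)%E](_ : _ = 1%E) ?mule1; last exact: probability_setT.
have -> : (\int[P]_w (\1_(A n) w)%:E = (fine (P (A n)))%:E)%E.
  by rewrite (fineK fA) integral_indic// setIT.
rewrite -EFinM -EFinD /=.
apply: (@le_trans _ _ (e / 2 + K' * (e / 2 / K'))).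
  apply: lerD; last by rewrite ler_wpM2l// ltW.
  by rewrite /eps mulrCA divff ?mulr1// gt_eqF.
by rewrite mulrCA divff ?mulr1 ?gt_eqF// -splitr.
Qed.

Lemma put_payoff_stoch :
  (\int[P]_w (payoff w (stoch w))%:E =
   \int[P]_w \int[mu]_z (payoff w (Num.sqrt (IT w) * z) * phi z)%:E)%E.
Proof.
have fin1 : (\int[P]_w (payoff w (stoch w))%:E)%E \is a fin_num.
  by apply: integrable_fin_num => //; exact: integrable_payoff.
have fin2 n : (\int[P]_w (payoff w (X n w))%:E)%E \is a fin_num.
  by apply: integrable_fin_num => //; exact: integrable_payoff.
have : (fun n => \int[P]_w (payoff w (X n w))%:E)%E @ \oo --> (\int[P]_w (payoff w (stoch w))%:E)%E.
  rewrite -(fineK fin1) (_ : (fun n => _) = fun n => (Ex P (fun w => payoff w (X n w)))%:E).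
    by apply: cvg_EFin; [exact: nearW|exact: payoff_stoch_cvg].
  by apply/funext => n; rewrite /Ex (fineK (fin2 n)).
move=> h; exact: (cvg_unique _ h payoff_riemann_cvg).
Qed.

Lemma measurable_BS_put (x y : Omega -> R) : measurable_fun setT x -> measurable_fun setT y ->
  measurable_fun setT (fun w => BS_put K T r (x w) (y w)).
Proof.
move=> mx my.
have mPhi := @measurable_Phi R.
have ms : measurable_fun setT (fun w => Num.sqrt (y w)).
  by apply: measurableT_comp => //; exact: measurable_sqrt.
have msV : measurable_fun setT (fun w => (Num.sqrt (y w))^-1).
  by apply: measurableT_comp => //; exact: measurable_invr.
have md s : measurable_fun setT (fun w => BS_d K T r s (x w) (y w)).
  rewrite /BS_d; apply: measurable_funM => //; apply: measurable_funD.
    apply: measurable_funD => //; apply: measurableT_comp; first exact: measurable_ln.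
    exact: measurable_funM.
  by apply: measurable_funM => //; exact: measurable_funM.
apply: measurable_funB; apply: measurable_funM => //.
  by apply: measurableT_comp => //; exact: measurableT_comp.
by apply: measurableT_comp => //; exact: measurableT_comp.
Qed.

Lemma bns_intvar_ae_ge : {ae P, forall w, sig0sq * alpha lam 0 T <= IT w}.
Proof. by have := levy_ae_mono HZ; apply: filterS => w Zw; exact: bns_intvar_ge. Qed.

Lemma alpha_gt0 : 0 < sig0sq * alpha lam 0 T.
Proof.
rewrite mulr_gt0// /alpha divr_gt0// subr_gt0 -[ltRHS]expR0 ltr_expR oppr_lt0.
by rewrite subr0 mulr_gt0.
Qed.

Lemma discounted_put_payoff w :
  expR (- (r * T)) * Num.max (K - bns_S S0 r lam sig0sq rho kap Z stoch T w) 0 =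
  payoff w (stoch w).
Proof.
rewrite maxr_pMr ?expR_ge0// mulr0 /payoff; congr (Num.max _ _).
rewrite mulrBr mulrC -/K'; congr (_ - _); rewrite /bns_S -/PT -/IT mulrCA -expRD.
by congr (_ * expR _); ring.
Qed.

Lemma integrable_put_payoff : P.-integrable setT
  (fun w => (expR (- (r * T)) * Num.max (K - bns_S S0 r lam sig0sq rho kap Z stoch T w) 0)%:E).
Proof. by under eq_fun do rewrite discounted_put_payoff; exact: integrable_payoff. Qed.

Lemma put_price_BS :
  (\int[P]_w (expR (- (r * T)) * Num.max (K - bns_S S0 r lam sig0sq rho kap Z stoch T w) 0)%:E =
   \int[P]_w (BS_put K T r (S0 * PT w) (IT w))%:E)%E.
Proof.
under eq_integral do rewrite discounted_put_payoff.
rewrite put_payoff_stoch; apply: ae_eq_integral => //.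
- exact: measurable_gauss_payoff.
- apply/measurable_EFinP; apply: measurable_BS_put => //; exact: measurable_funM.
- have := bns_intvar_ae_ge; apply: filterS => w /(lt_le_trans alpha_gt0) I0 _.
  by rewrite -gaussian_put// mulr_gt0// expR_gt0.
Qed.

End put_price.

(** * Expansion of the price *)

Section lincomb.
Context {R : realType} {d : measure_display} {T : measurableType d}.
Variables (mu : {measure set T -> \bar R}) (D : set T) (mD : measurable D).

Lemma Rintegral_lincomb (n : nat) (c : nat -> R) (f : nat -> T -> R) :
  (forall k, (k < n)%N -> mu.-integrable D (EFin \o f k)) ->
  mu.-integrable D (EFin \o (fun x => \sum_(k < n) c k * f k x)) /\
  \int[mu]_(x in D) (\sum_(k < n) c k * f k x) = \sum_(k < n) c k * \int[mu]_(x in D) f k x.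
Proof.
elim: n => [|n IH] intf.
  rewrite big_ord0; under eq_fun do rewrite big_ord0; split; first exact: integrable0.
  by rewrite Rintegral_cst// mul0r.
have [i1 e1] := IH (fun k kn => intf k (ltnW kn)).
have i2 : mu.-integrable D (EFin \o (fun x => c n * f n x)).
  rewrite (_ : EFin \o _ = fun x => ((c n)%:E * (EFin \o f n) x)%E)//.
  by apply: integrableZl => //; exact: intf.
under eq_fun do rewrite big_ord_recr /=.
split; last by rewrite RintegralD// e1 RintegralZl ?big_ord_recr//; exact: intf.
exact: (integrableD mD i1 i2).
Qed.

End lincomb.

Section mixed_measurable.
Context {R : realType} {d : measure_display} {T : measurableType d}.
Implicit Types (x y l v : T -> R).

Lemma measurable_dkernel m l v : measurable_fun setT l -> measurable_fun setT v ->
  measurable_fun setT (fun w => dkernel m (l w) (v w)).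
Proof.
move=> ml mv.
have mV : measurable_fun setT (fun w => (v w)^-1).
  by apply: measurableT_comp => //; exact: measurable_invr.
have ms : measurable_fun setT (fun w => (Num.sqrt (v w))^-1).
  apply: measurableT_comp; first exact: measurable_invr.
  by apply: measurableT_comp => //; exact: measurable_sqrt.
have mc : measurable_fun setT (fun w => l w - v w / 2).
  by apply: measurable_funB => //; exact: measurable_funM.
have m0 : measurable_fun setT (fun w => bskernel (l w) (v w)).
  apply: measurable_funM => //; apply: measurableT_comp; first exact: measurable_normal_pdf.
  exact: measurable_funM.
suff [] : measurable_fun setT (fun w => dkernel m (l w) (v w)) /\
  measurable_fun setT (fun w => dkernel m.+1 (l w) (v w)) by [].
elim: m => [|m [IH0 IH1]]; split => //.
  apply: measurable_funM => //; apply: measurableT_comp => //.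
  exact: measurable_funM.
apply: measurable_funM => //; apply: measurableT_comp => //; apply: measurable_funD.
  exact: measurable_funM.
exact: measurable_funM.
Qed.

Lemma measurable_dput m l v : measurable_fun setT l -> measurable_fun setT v ->
  measurable_fun setT (fun w => dput m (l w) (v w)).
Proof.
move=> ml mv.
have mPhi := @measurable_Phi R.
have ms : measurable_fun setT (fun w => (Num.sqrt (v w))^-1).
  apply: measurableT_comp; first exact: measurable_invr.
  by apply: measurableT_comp => //; exact: measurable_sqrt.
have mp : measurable_fun setT (fun w => expR (l w) * Phi (- dplus (l w) (v w))).
  apply: measurable_funM; first exact: measurableT_comp.
  apply: measurableT_comp => //; apply: measurableT_comp => //; apply: measurable_funM => //.
  by apply: measurable_funD => //; exact: measurable_funM.
case: m => [|m].
  apply: measurable_funB => //.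
  apply: measurableT_comp => //; apply: measurableT_comp => //; apply: measurable_funM => //.
  by apply: measurable_funB => //; exact: measurable_funM.
apply: measurable_funD; first exact: measurableT_comp.
by apply: measurable_sum => i; exact: measurable_dkernel.
Qed.

Lemma measurable_bs_mixed K0 T0 r j k x y : measurable_fun setT x -> measurable_fun setT y ->
  measurable_fun setT (fun w => bs_mixed K0 T0 r j k (x w) (y w)).
Proof.
move=> mx my; apply: measurable_funM => //; apply: measurable_funM.
  apply: measurableT_comp; first exact: measurable_invr.
  exact: measurable_funX.
apply: measurable_sum => i; apply: measurable_funM => //; apply: measurable_dput => //.
apply: measurable_funD => //; apply: measurableT_comp; first exact: measurable_ln.
exact: measurable_funM.
Qed.

End mixed_measurable.

Lemma segment_gt0 (R : realDomainType) (a b u : R) : 0 < a -> 0 < b -> 0 <= u <= 1 ->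
  0 < (1 - u) * a + u * b.
Proof. by move=> a0 b0 /andP[u0 u1]; nra. Qed.

(** * The integral remainder as a measurable, bounded function of the end point *)

Section remainder.
Context {R : realType}.
Notation mu := (@lebesgue_measure R).
Variables (K T r : R).
Hypothesis K0 : 0 < K.
Let I01 : set R := `[0%R, 1%R].

(** A measurable stand-in for [BS_put_partial] at x > 0 and order at least 2: for v < 0 the iterated
    derivatives are indeed 0, for v = 0 the value is a convention. *)
Definition bs_cut j k (x v : R) : R := if 0 < v then bs_mixed K T r j k x v else 0.

Lemma measurable_bs_cut d1 (T1 : measurableType d1) j k (x y : T1 -> R) :
  measurable_fun setT x -> measurable_fun setT y ->
  measurable_fun setT (fun w => bs_cut j k (x w) (y w)).
Proof.
move=> mx my; apply: measurable_fun_ifT => //; first exact: measurable_fun_ltr.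
exact: measurable_bs_mixed.
Qed.

Definition bs_remainder (N j k : nat) (x0 v0 x v : R) : R :=
  \int[mu]_(u in I01) ((1 - u) ^+ N * bs_cut j k ((1 - u) * x0 + u * x) ((1 - u) * v0 + u * v)).

Let integrand N j k x0 v0 x v u :=
  (1 - u) ^+ N * bs_cut j k ((1 - u) * x0 + u * x) ((1 - u) * v0 + u * v).

Lemma measurable_remainder_integrand d1 (T1 : measurableType d1) N j k (x0 v0 : R)
   (u x v : T1 -> R) : measurable_fun setT u ->
  measurable_fun setT x -> measurable_fun setT v ->
  measurable_fun setT (fun q => integrand N j k x0 v0 (x q) (v q) (u q)).
Proof.
move=> m1 m2 m3; apply: measurable_funM; first by apply: measurable_funX; exact: measurable_funB.
by apply: measurable_bs_cut; apply: measurable_funD; apply: measurable_funM => //; exact: measurable_funB.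
Qed.

Let m01 : measurable I01. Proof. exact: measurable_itv. Qed.

Let measurable_integrand N j k x0 v0 x v :
  measurable_fun setT (fun u : measurableTypeR R => integrand N j k x0 v0 x v u).
Proof. by apply: (@measurable_remainder_integrand _ (measurableTypeR R) _ _ _ _ _ id). Qed.

(* The segment meets the line of zero variance, where [BS_put_partial] is not smooth,
   at one point at most. *)
Lemma bs_remainder_partial N j k x0 v0 x v : (2 <= j + k)%N -> 0 < x0 -> 0 < v0 -> 0 < x ->
  \int[mu]_(u in I01) ((1 - u) ^+ N *
    BS_put_partial K T r j k ((1 - u) * x0 + u * x) ((1 - u) * v0 + u * v)) =
  bs_remainder N j k x0 v0 x v.
Proof.
move=> jk x00 v00 xp; congr fine.
(* The parameter at which the variance vanishes. If v = v0 the quotient is 0 by convention, and the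
   variance stays at v0 > 0. *)
pose c := v0 / (v0 - v).
have eqf u : (I01 `\ c) u -> (1 - u) ^+ N *
    BS_put_partial K T r j k ((1 - u) * x0 + u * x) ((1 - u) * v0 + u * v) = integrand N j k x0 v0 x v u.
  rewrite /I01 /= in_itv /= => -[/andP[u0 u1] uc]; congr (_ * _); rewrite /bs_cut.
  have x1 : 0 < (1 - u) * x0 + u * x by nra.
  case: ltrgtP => [v1|v1|v1]; first exact: BS_put_partial_pos.
    exact: BS_put_partial_neg.
  exfalso; apply: uc; rewrite /c.
  have vv : v0 - v != 0 by apply/eqP; nra.
  by apply: (mulIf vv); rewrite divfK//; nra.
have mg : measurable_fun (I01 `\ c : set (measurableTypeR R)) (fun u => (integrand N j k x0 v0 x v u)%:E).
  by apply: measurable_funTS; apply/measurable_EFinP; exact: measurable_integrand.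
have mD : measurable (I01 `\ c : set (measurableTypeR R)) by exact: measurableD.
rewrite -(@integral_setD1 _ _ c)//; last first.
  apply: eq_measurable_fun mg => u; rewrite inE => /eqf uE.
  by rewrite uE.
rewrite -[RHS](@integral_setD1 _ _ c)//.
by apply: eq_integral => u; rewrite inE => /eqf ->.
Qed.

(** Uniform in the end point [x]: x >= (1 - u) x0 on the segment gives (1 - u)^N x^(1-j) <= x0^(1-j)
    for j > 0. Each remainder term is then dominated by a moment of order N + 1. *)
Lemma bs_remainder_bound N j k (x0 v1 : R) : (2 <= j + k)%N -> (0 < N)%N -> (j <= N.+1)%N ->
  0 < x0 -> 0 < v1 ->
  exists2 C : R, 0 <= C & forall v0 x v, v1 <= v0 -> v1 <= v -> 0 < x ->
    mu.-integrable I01 (EFin \o integrand N j k x0 v0 x v) /\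
    `|bs_remainder N j k x0 v0 x v| <= C.
Proof.
move=> jk N0 jN x00 v10.
have [C C0 HC] := bs_mixed_bound T r K0 v10 jk.
have D0 : 0 <= C * x0 ^- j.-1 by rewrite mulr_ge0// invr_ge0 exprn_ge0// ltW.
exists (C * x0 ^- j.-1) => // v0 x v hv0 hv xp.
have bd u : I01 u -> `|integrand N j k x0 v0 x v u| <= C * x0 ^- j.-1.
  rewrite /I01 /= in_itv /= => /andP[u0 u1]; rewrite /integrand.
  (* At u = 1 the lower bound (1 - u) x0 degenerates; there the integrand is 0 because N > 0. *)
  have [->|un1] := eqVneq u 1; first by rewrite subrr expr0n gtn_eqF// mul0r normr0.
  have u1' : 0 < 1 - u by rewrite subr_gt0 lt_neqAle un1.
  have vv : v1 <= (1 - u) * v0 + u * v by nra.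
  have xx : (1 - u) * x0 <= (1 - u) * x0 + u * x by rewrite lerDl mulr_ge0// ltW.
  have xx0 : 0 < (1 - u) * x0 by exact: mulr_gt0.
  have X0 : 0 < (1 - u) * x0 + u * x by exact: lt_le_trans xx.
  rewrite /bs_cut (lt_le_trans v10 vv) normrM ger0_norm ?exprn_ge0 ?(ltW u1')//.
  apply: le_trans (ler_wpM2l _ (HC _ _ X0 vv)) _; first by rewrite exprn_ge0// ltW.
  rewrite mulrCA ler_wpM2l//.
  apply: (@le_trans _ _ ((1 - u) ^+ j.-1 * ((1 - u) * x0) ^- j.-1)); last first.
    by rewrite exprMn invfM mulrA divff ?mul1r// expf_neq0// gt_eqF.
  apply: ler_pM; rewrite ?exprn_ge0 ?invr_ge0 ?exprn_ge0// ?(ltW X0) ?(ltW u1')//.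
    by apply: ler_wiXn2l; rewrite ?(ltW u1')//; [lra|rewrite -ltnS; case: (j) jN].
  rewrite lef_pV2 ?posrE ?exprn_gt0//.
  by apply: lerXn2r; rewrite ?nnegrE ?(ltW xx0) ?(ltW X0).
have mu1 : mu I01 = 1%E by rewrite /I01 lebesgue_measure_itv /= lte_fin ltr01 sube0.
have iC : mu.-integrable I01 (EFin \o (fun=> C * x0 ^- j.-1)).
  apply: continuous_compact_integrable; first exact: segment_compact.
  by apply: continuous_subspaceT => z; exact: cvg_cst.
have ii : mu.-integrable I01 (EFin \o integrand N j k x0 v0 x v).
  apply: le_integrable iC => //.
    by apply: measurable_funTS; apply/measurable_EFinP; exact: measurable_integrand.
  by move=> u Iu /=; rewrite lee_fin [leRHS]ger0_norm// bd.
split => //.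
have h := @le_normr_Rintegral _ (measurableTypeR R) _ mu I01 _ m01 ii.
apply: (le_trans h).
apply: (@le_trans _ _ (\int[mu]_(u in I01) (C * x0 ^- j.-1))); last first.
  by rewrite Rintegral_cst// [X in _ * X](_ : _ = 1) ?mulr1//; exact: (congr1 fine mu1).
by apply: le_Rintegral => //; exact: integrable_norm.
Qed.

Lemma measurable_bs_remainder d1 (T1 : measurableType d1) N j k x0 v0 (x v : T1 -> R) :
  measurable_fun setT x -> measurable_fun setT v ->
  measurable_fun setT (fun w => bs_remainder N j k x0 v0 (x w) (v w)).
Proof.
move=> mx mv; apply: measurableT_comp => //.
pose F (q : T1 * measurableTypeR R) : R :=
  \1_I01 q.2 * integrand N j k x0 v0 (x q.1) (v q.1) q.2.
have mF : measurable_fun setT F.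
  apply: measurable_funM.
    by apply: measurableT_comp; [exact: measurable_indic|exact: measurable_snd].
  by apply: measurable_remainder_integrand => //; apply: measurableT_comp => //; exact: measurable_fst.
rewrite (_ : (fun w => _) = (fun w => (\int[mu]_u ((EFin \o F)^\+ (w, u))) -
    (\int[mu]_u ((EFin \o F)^\- (w, u))))%E).
  apply: emeasurable_funB; apply: (measurable_fun_fubini_tonelli_F (m2 := mu)).
  - by apply: measurable_funepos; exact/measurable_EFinP.
  - by move=> q; exact: funepos_ge0.
  - by apply: measurable_funeneg; exact/measurable_EFinP.
  - by move=> q; exact: funeneg_ge0.
apply/funext => w; rewrite integral_mkcond.
transitivity (\int[mu]_u (F (w, u))%:E)%E; last first.
  by rewrite integralE; congr (_ - _)%E; apply: eq_integral => u _; rewrite ?funeposE ?funenegE.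
by apply: eq_integral => u _; rewrite patchE /F indicE /=; case: ifP; rewrite ?mul1r ?mul0r.
Qed.

Lemma BS_put_taylor_remainder N x0 v0 x v : (0 < N)%N -> 0 < x0 -> 0 < v0 -> 0 < x -> 0 < v ->
  BS_put K T r x v =
  \sum_(n < N.+1) (n`!%:R)^-1 * (\sum_(k < n.+1) 'C(n, k)%:R * (x - x0) ^+ (n - k) *
     (v - v0) ^+ k * BS_put_partial K T r (n - k) k x0 v0) +
  (N`!%:R)^-1 * \sum_(k < N.+2) 'C(N.+1, k)%:R * (x - x0) ^+ (N.+1 - k) * (v - v0) ^+ k *
     bs_remainder N (N.+1 - k) k x0 v0 x v.
Proof.
move=> N0 x00 v00 xp vp.
have f0 n : (n`!%:R : R) != 0 by rewrite pnatr_eq0 -lt0n fact_gt0.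
(* The variance stays above this minimum along the segment, so each term is integrable and the
   integral of the sum may be split. *)
pose m := Num.min v0 v.
have m0 : 0 < m by rewrite lt_min v00.
have ii k : (k < N.+2)%N -> mu.-integrable I01 (EFin \o integrand N (N.+1 - k) k x0 v0 x v).
  move=> kN; have jk : (2 <= N.+1 - k + k)%N by rewrite subnK.
  have [C _ HC] := bs_remainder_bound jk N0 (leq_subr _ _) x00 m0.
  by have [] := HC v0 x v; rewrite ?ge_min ?lexx ?orbT.
pose c k := 'C(N.+1, k)%:R * (x - x0) ^+ (N.+1 - k) * (v - v0) ^+ k.
have [_] := @Rintegral_lincomb _ _ (measurableTypeR R) mu I01 m01 _ c _ ii.
have := BS_put_taylor T r K0 N x00 v00 xp vp; move/(congr1 fine) => /= tay.
rewrite (_ : \int[mu]_(u in I01) _ = N`!%:R * (BS_put K T r x v - \sum_(n < N.+1)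
   segment_deriv K T r x0 v0 (x - x0) (v - v0) n 0 / n`!%:R)); last first.
  rewrite -tay; congr fine; apply: eq_integral => u; rewrite inE /I01 /= in_itv /= => /andP[u0 u1].
  congr (_%:E); rewrite /segment_deriv mulr_sumr; apply: eq_bigr => k _.
  rewrite /integrand /bs_cut.
  have e a b : a + u * (b - a) = (1 - u) * a + u * b by ring.
  have -> : 0 < (1 - u) * v0 + u * v by nra.
  by rewrite !e /c mulrCA.
move=> h; rewrite -h mulKf//.
rewrite [X in _ = X + _](_ : _ = \sum_(n < N.+1)
   segment_deriv K T r x0 v0 (x - x0) (v - v0) n 0 / n`!%:R); first by ring.
apply: eq_bigr => n _; rewrite mulrC; congr (_ / _).
apply: eq_bigr => k _; rewrite !mul0r !addr0 BS_put_partial_pos//.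
Qed.

End remainder.

Section expansion.
Context {R : realType} {d : measure_display} {Omega : measurableType d}.
Variables (P : probability Omega R) (X V : Omega -> R) (K T r x0 v1 : R) (N : nat).
Hypotheses (K0 : 0 < K) (x00 : 0 < x0) (v10 : 0 < v1) (N0 : (0 < N)%N).
Hypotheses (mX : measurable_fun setT X) (mV : measurable_fun setT V).
Hypotheses (X0 : forall w, 0 < X w) (Vv1 : {ae P, forall w, v1 <= V w}).
Let EV := Ex P V.
Hypothesis moments : forall n k : nat, (1 <= n <= N.+1)%N -> (k <= n)%N ->
  (\int[P]_w (`|X w - 1| ^+ (n - k) * `|V w - EV| ^+ k)%:E < +oo)%E.

Let moment n k w := (X w - 1) ^+ (n - k) * (V w - EV) ^+ k.

Let mmoment n k : measurable_fun setT (moment n k).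
Proof.
by apply: measurable_funM; apply: measurable_funX; exact: measurable_funB.
Qed.

Lemma integrable_moment n k : (n <= N.+1)%N -> (k <= n)%N ->
  P.-integrable setT (fun w => (moment n k w)%:E).
Proof.
case: n => [_|n nN kn].
  rewrite leqn0 => /eqP ->; rewrite (_ : (fun w => _) = cst 1%E).
    exact: finite_measure_integrable_cst.
  by apply/funext => w; rewrite /moment !expr0 mulr1.
apply/integrableP; split; first exact/measurable_EFinP.
have := moments (n := n.+1) nN kn; congr (_ < _)%E; apply: eq_integral => w _.
by rewrite /moment /= normrM !normrX.
Qed.

(** The moment with n = k = 1 is V - EV, where [EV] is a real number by construction; adding this
    constant gives integrability of [V] without circularity. *)
Lemma integrable_of_moments : P.-integrable setT (fun w => (V w)%:E).
Proof.
have i1 := integrable_moment (leqW N0) (leqnn 1).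
have i2 : P.-integrable setT (cst EV%:E : Omega -> \bar R) by exact: finite_measure_integrable_cst.
have := integrableD measurableT i1 i2; congr (P.-integrable _ _).
by apply/funext => w; rewrite /moment /= expr0 mul1r expr1 -EFinD subrK.
Qed.

Let integrable_X : P.-integrable setT (fun w => (X w)%:E).
Proof.
have i1 := integrable_moment (leqW N0) (leq0n 1).
have i2 : P.-integrable setT (cst 1%:E : Omega -> \bar R) by exact: finite_measure_integrable_cst.
have := integrableD measurableT i1 i2; congr (P.-integrable _ _).
by apply/funext => w; rewrite /moment /= expr0 mulr1 expr1 -EFinD subrK.
Qed.

Lemma Ex_ge_of_ae : v1 <= EV.
Proof.
(* The lower bound on [V] holds almost surely; the maximum has the same integral and satisfies it
   everywhere. *)
have mm : measurable_fun setT (fun w => Num.max (V w) v1) by exact: measurable_maxr.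
have e : (\int[P]_w (V w)%:E = \int[P]_w (Num.max (V w) v1)%:E)%E.
  apply: ae_eq_integral => //; [exact/measurable_EFinP|exact/measurable_EFinP|].
  by move: Vv1; apply: filterS => w vw _; rewrite max_l.
have : (\int[P]_w (cst v1%:E w) <= \int[P]_w (V w)%:E)%E.
  rewrite e; apply: ge0_le_integral => //.
  - by move=> w _; rewrite lee_fin ltW.
  - exact/measurable_EFinP.
  - by move=> w _; rewrite lee_fin le_max lexx orbT.
have fV : (\int[P]_w (V w)%:E)%E \is a fin_num.
  by apply: integrable_fin_num => //; exact: integrable_of_moments.
rewrite integral_cst// [X in (_ * X)%E](_ : _ = 1%E) ?mule1; last exact: probability_setT.
by rewrite -(fineK fV) lee_fin.
Qed.

Let EV0 : 0 < EV. Proof. exact: lt_le_trans Ex_ge_of_ae. Qed.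

Let remainder k w := moment N.+1 k w *
  bs_remainder K T r N (N.+1 - k) k x0 EV (x0 * X w) (V w).

Lemma integrable_remainder k : (k <= N.+1)%N ->
  P.-integrable setT (fun w => (remainder k w)%:E).
Proof.
move=> kN; have jk : (2 <= N.+1 - k + k)%N by rewrite subnK.
have [C C0 HC] := bs_remainder_bound T r K0 jk N0 (leq_subr _ _) x00 v10.
have mb : measurable_fun setT (fun w => bs_remainder K T r N (N.+1 - k) k x0 EV (x0 * X w) (V w)).
  by apply: measurable_bs_remainder => //; exact: measurable_funM.
apply/integrableP; split; first by apply/measurable_EFinP; exact: measurable_funM.
have i1 := integrable_moment (leqnn _) kN.
have : P.-integrable setT (fun w => (C%:E * (moment N.+1 k w)%:E)%E) by exact: integrableZl.
move=> /integrableP[_]; apply: le_lt_trans.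
apply: ae_ge0_le_integral => //.
- by apply: measurableT_comp => //; apply/measurable_EFinP; exact: measurable_funM.
- by apply: measurableT_comp => //; apply/measurable_EFinP; exact: measurable_funM.
move: Vv1; apply: filterS => w vw _.
have [_ b] := HC EV (x0 * X w) (V w) Ex_ge_of_ae vw (mulr_gt0 x00 (X0 w)).
by rewrite -EFinM lee_fin /remainder !normrM mulrC ler_wpM2r// (ger0_norm C0).
Qed.

Lemma put_expansion : Ex P X = 1 ->
  Ex P (fun w => BS_put K T r (x0 * X w) (V w)) =
  BS_put K T r x0 EV + \sum_(2 <= n < N.+1) (n`!%:R)^-1 *
      \sum_(0 <= k < n.+1) 'C(n, k)%:R * x0 ^+ (n - k) * Ex P (moment n k) *
        BS_put_partial K T r (n - k) k x0 EV +
  (N`!%:R)^-1 * \sum_(0 <= k < N.+2) 'C(N.+1, k)%:R * x0 ^+ (N.+1 - k) * Ex P (remainder k).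
Proof.
move=> EX1.
pose a n k := 'C(n, k)%:R * x0 ^+ (n - k) * BS_put_partial K T r (n - k) k x0 EV.
pose b k := 'C(N.+1, k)%:R * x0 ^+ (N.+1 - k).
pose h n w := \sum_(k < n.+1) a n k * moment n k w.
pose g w := \sum_(k < N.+2) b k * remainder k w.
have [hi he] : (forall n, (n < N.+1)%N -> P.-integrable setT (EFin \o h n)) /\
    (forall n, (n < N.+1)%N -> \int[P]_w h n w = \sum_(k < n.+1) a n k * \int[P]_w moment n k w).
  split=> n nN; have [] := @Rintegral_lincomb _ _ _ P setT measurableT n.+1 (a n) (moment n) => // k kn;
    exact: integrable_moment (leqW _) _.
have [gi ge] := @Rintegral_lincomb _ _ _ P setT measurableT N.+2 b remainder integrable_remainder.
have [si se] := @Rintegral_lincomb _ _ _ P setT measurableT N.+1 (fun n => n`!%:R^-1) h hi.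
have gi' : P.-integrable setT (EFin \o (fun w => N`!%:R^-1 * g w)).
  rewrite (_ : EFin \o _ = fun w => ((N`!%:R^-1)%:E * (EFin \o g) w)%E)//.
  exact: integrableZl.
have -> : Ex P (fun w => BS_put K T r (x0 * X w) (V w)) =
    \int[P]_w (\sum_(n < N.+1) n`!%:R^-1 * h n w + N`!%:R^-1 * g w).
  congr fine; apply: ae_eq_integral => //.
  - by apply/measurable_EFinP; apply: measurable_BS_put => //; exact: measurable_funM.
  - have /integrableP[] := integrableD measurableT si gi'; by [].
  move: Vv1; apply: filterS => w vw _; congr (_%:E).
  rewrite (BS_put_taylor_remainder T r K0 N0 x00 EV0 (mulr_gt0 x00 (X0 w)) (lt_le_trans v10 vw)).
  (* Origin of the powers of [x0] in the expansion. *)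
  have xE n : (x0 * X w - x0) ^+ n = x0 ^+ n * (X w - 1) ^+ n.
    by rewrite -exprMn mulrBr mulr1.
  congr (_ + _ * _).
    by apply: eq_bigr => n _; congr (_ * _); apply: eq_bigr => k _; rewrite xE /a /moment; ring.
  by apply: eq_bigr => k _; rewrite xE /b /remainder /moment; ring.
rewrite RintegralD// RintegralZl// se ge; congr (_ + _ * _); last first.
  by rewrite big_mkord.
have E0 : \int[P]_w moment 0 0 w = 1.
  rewrite (_ : moment 0 0 = cst 1); last by apply/funext => w; rewrite /moment !expr0 mulr1.
  rewrite Rintegral_cst// mul1r [X in fine X](_ : _ = 1%E)//; exact: probability_setT.
have E10 : \int[P]_w moment 1 0 w = 0.
  rewrite (_ : moment 1 0 = fun w => X w - 1); last by apply/funext => w; rewrite /moment expr0 mulr1.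
  rewrite RintegralB//; last exact: finite_measure_integrable_cst.
  rewrite -[X in X - _ = _]/(Ex P X) EX1 Rintegral_cst// mul1r [X in fine X](_ : _ = 1%E) ?subrr//.
  exact: probability_setT.
have E11 : \int[P]_w moment 1 1 w = 0.
  rewrite (_ : moment 1 1 = fun w => V w - EV); last by apply/funext => w; rewrite /moment expr0 mul1r.
  rewrite RintegralB//; [|exact: integrable_of_moments|exact: finite_measure_integrable_cst].
  rewrite -[X in X - _ = _]/EV Rintegral_cst// [X in fine X](_ : _ = 1%E) ?mulr1 ?subrr//.
  exact: probability_setT.
transitivity (\sum_(0 <= n < N.+1) n`!%:R^-1 * \sum_(k < n.+1) a n k * \int[P]_w moment n k w).
  by rewrite big_mkord; apply: eq_bigr => n _; rewrite he.
have s0 : \sum_(k < 1) a 0%N k * \int[P]_w moment 0 k w = BS_put K T r x0 EV.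
  rewrite -(big_mkord xpredT (fun k => a 0%N k * \int[P]_w moment 0 k w)) big_nat1 E0 mulr1.
  by rewrite /a bin0 expr0 !mul1r.
have s1 : \sum_(k < 2) a 1%N k * \int[P]_w moment 1 k w = 0.
  rewrite -(big_mkord xpredT (fun k => a 1%N k * \int[P]_w moment 1 k w)) big_ltn// big_nat1.
  have z (p q u v : R) : u = 0 -> v = 0 -> p * u + q * v = 0 by move=> -> ->; rewrite !mulr0 addr0.
  exact: z E10 E11.
rewrite big_ltn// big_ltn// s0 s1 mulr0 add0r fact0 invr1 mul1r; congr (_ + _).
apply: eq_bigr => n _; rewrite big_mkord; congr (_ * _); apply: eq_bigr => k _.
exact: mulrAC.
Qed.

End expansion.

Theorem mainTheorem1 (R : realType) (d : measure_display) (Omega : measurableType d)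
    (P : probability Omega R)
    (T r lam sig0sq S0 K rho : R) (W Z : R -> Omega -> R) (stoch : Omega -> R) (N : nat) :
  0 < T -> 0 < lam -> 0 < sig0sq -> 0 < S0 -> 0 < K ->
  brownian_motion P W -> levy_subordinator P Z -> indep_processes P W Z ->
  (0 < kappa_hat P Z)%E -> (rho%:E < kappa_hat P Z)%E ->
  (* stoch = int_0^T sigma_s dW_s *)
  stoch_int_of P (bns_vol lam sig0sq Z) W T stoch ->
  (1 <= N)%N ->
  let kap := fine (kappa P Z rho) in
  let PT := bns_P lam rho kap Z T in
  let IT := bns_intvar lam sig0sq Z T in
  let EI := Ex P IT in
  let ST := bns_S S0 r lam sig0sq rho kap Z stoch T in
  (forall n k : nat, (1 <= n <= N.+1)%N -> (k <= n)%N ->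
     (\int[P]_w (`|PT w - 1| ^+ (n - k) * `|IT w - EI| ^+ k)%:E < +oo)%E) ->
  let put_price := Ex P (fun w => expR (- (r * T)) * Num.max (K - ST w) 0) in
  let term_N (n k : nat) : Omega -> R := fun w =>
    (PT w - 1) ^+ (n - k) * (IT w - EI) ^+ k in
  let Pi_N :=
    BS_put K T r S0 EI +
    \sum_(2 <= n < N.+1) (n`!%:R)^-1 *
      \sum_(0 <= k < n.+1) 'C(n, k)%:R * S0 ^+ (n - k) * Ex P (term_N n k) *
        BS_put_partial K T r (n - k) k S0 EI in
  let rem_int (n : nat) (w : Omega) : R :=
    fine (\int[@lebesgue_measure R]_(u in `[0%R, 1%R])
      ((1 - u) ^+ N * BS_put_partial K T r (N.+1 - n) n
          ((1 - u) * S0 + u * PT w * S0) ((1 - u) * EI + u * IT w))%:E)%E in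
  let rem_term (n : nat) : Omega -> R := fun w =>
    (PT w - 1) ^+ (N.+1 - n) * (IT w - EI) ^+ n * rem_int n w in
  let R_N :=
    (N`!%:R)^-1 * \sum_(0 <= n < N.+2) 'C(N.+1, n)%:R * S0 ^+ (N.+1 - n) *
      Ex P (rem_term n) in
  [/\ put_price = Pi_N + R_N,
      (* all derivatives are evaluated at points with positive coordinates *)
      0 < S0 /\ 0 < EI,
      {ae P, forall w, forall u : R, 0 <= u <= 1 ->
          0 < (1 - u) * S0 + u * PT w * S0 /\ 0 < (1 - u) * EI + u * IT w},
      (* all expectations are finite *)
      P.-integrable setT (fun w => (expR (- (r * T)) * Num.max (K - ST w) 0)%:E) /\
      P.-integrable setT (fun w => (IT w)%:E)
    & (forall n k : nat, (2 <= n <= N)%N -> (k <= n)%N ->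
         P.-integrable setT (fun w => (term_N n k w)%:E)) /\
      (forall n : nat, (n <= N.+1)%N ->
         P.-integrable setT (fun w => (rem_term n w)%:E))].
Proof.
move=> T0 lam0 sig0 S00 K0 HW HZ WZ kh0 rhok Hst N0 kap PT IT EI ST moments.
have mZ s : 0 <= s -> measurable_fun setT (Z s) by move=> _; have [] := HZ.
have mP : measurable_fun setT PT by apply: measurable_bns_P => //; exact: ltW.
have mI : measurable_fun setT IT by apply: measurable_bns_intvar => //; exact: ltW.
have P0 w : 0 < PT w by exact: expR_gt0.
have a0 : 0 < sig0sq * alpha lam 0 T by exact: alpha_gt0.
have aI : {ae P, forall w, sig0sq * alpha lam 0 T <= IT w} by exact: bns_intvar_ae_ge.
have aE : sig0sq * alpha lam 0 T <= EI by exact: Ex_ge_of_ae a0 N0 mP mI aI moments.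
have E0 : 0 < EI by exact: lt_le_trans aE.
have EP : Ex P PT = 1 by rewrite /Ex lmgf_bns_P// ltW.
move=> put_price term_N Pi_N rem_int rem_term R_N.
(* An identity for every [w], not just almost every one: integrability of [rem_term n] includes
   measurability, which [bs_remainder] provides. *)
have rem_intE n w : (n <= N.+1)%N ->
    rem_int n w = bs_remainder K T r N (N.+1 - n) n S0 EI (S0 * PT w) (IT w).
  move=> nN; rewrite -bs_remainder_partial// ?mulr_gt0// ?subnK//.
  by congr fine; apply: eq_integral => u _; rewrite -mulrA [PT w * S0]mulrC.
have rem_termE n : (n <= N.+1)%N -> rem_term n = fun w =>
    (PT w - 1) ^+ (N.+1 - n) * (IT w - EI) ^+ n *
    bs_remainder K T r N (N.+1 - n) n S0 EI (S0 * PT w) (IT w).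
  by move=> nN; apply/funext => w; rewrite /rem_term rem_intE.
split.
- transitivity (Ex P (fun w => BS_put K T r (S0 * PT w) (IT w))).
    exact: (congr1 fine (put_price_BS r rho kap T0 lam0 sig0 S00 K0 HW HZ WZ Hst)).
  rewrite /R_N; under eq_big_nat => n /andP[_ nN] do rewrite rem_termE//.
  by have := put_expansion T r K0 S00 a0 N0 mP mI P0 aI moments EP.
- by [].
- move: aI; apply: filterS => w Iw u /andP[u0 u1].
  have I0 : 0 < IT w by exact: lt_le_trans Iw.
  by rewrite -mulrA; split; apply: segment_gt0; rewrite ?u0 ?mulr_gt0.
- split; first exact: (integrable_put_payoff r rho kap T0 lam0 S00 K0 HZ Hst).
  exact: (integrable_of_moments N0 mP mI moments).
- split=> [n k /andP[_ nN] kn|n nN].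
    by apply: (integrable_moment mP mI moments) => //; exact: leqW.
  have := integrable_remainder T r K0 S00 a0 N0 mP mI P0 aI moments nN.
  by rewrite (rem_termE n nN).
Qed.
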